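(* Let $X$ be a regular and generically smooth non-empty scheme of finite type over a field $k$. Then $\delta(X/k)=\delta_{sep}(X/k)$.
   Context: $X/k$ is generically smooth if it contains a dense open subset which is smooth over $k$. The index $\delta(X/k)$ is the greatest common divisor of the degrees $[k(P):k]$ of all closed points $P$ of $X$. The separable index $\delta_{sep}(X/k)$ is the greatest common divisor of the degrees of the separable closed points of $X$, i.e., the closed points $P$ such that $k(P)/k$ is a separable extension (such points exist when $X/k$ is generically smooth and non-empty). *)

(* Defs.v *)
(* Schemes are locally ringed spaces: a sheaf of
   commutative rings on a topological space, locally isomorphic to a spectrum.
   Rings are [comPzRingType]s because sections over the empty set form the zero
   ring. *)
From HB Require Import structures.
From mathcomp Require Import all_boot all_order all_algebra all_field.
From mathcomp Require Import generic_quotient.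
From mathcomp Require Import boolp classical_sets functions topology.

Set Implicit Arguments.
Unset Strict Implicit.
Unset Printing Implicit Defensive.

Import GRing.Theory.

Local Open Scope classical_set_scope.
Local Open Scope ring_scope.
Local Open Scope quotient_scope.

Section Ideals.
Variable A : comPzRingType.

Definition is_ideal (I : set A) :=
  [/\ I 0, (forall a b, I a -> I b -> I (a + b)) & (forall a b, I b -> I (a * b))].

Definition is_prime_ideal (P : set A) :=
  [/\ is_ideal P, ~ P 1 & forall a b, P (a * b) -> P a \/ P b].

Definition ideal_gen (n : nat) (a : 'I_n -> A) : set A :=
  [set b | exists c : 'I_n -> A, b = \sum_(i < n) c i * a i].

Definition invertible (a : A) := exists b, a * b = 1.

Definition noetherian :=
  forall I, is_ideal I -> exists (n : nat) (a : 'I_n -> A), I = ideal_gen a.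

Definition nonunits : set A := [set a | ~ invertible a].

(* 0 is a nonunit, so the zero ring is excluded. *)
Definition is_local := is_ideal nonunits.

Definition prime_chain (n : nat) (P : nat -> set A) :=
  (forall i, (i <= n)%N -> is_prime_ideal (P i)) /\
  (forall i, (i < n)%N -> P i `<` P i.+1).

Definition has_krull_dim (d : nat) :=
  (exists P, prime_chain d P) /\ (forall n P, prime_chain n P -> (n <= d)%N).

(* A Noetherian local ring of dimension d is regular when its maximal ideal is
   generated by d elements. *)
Definition regular_local :=
  [/\ noetherian, is_local &
      exists2 d, has_krull_dim d &
        exists a : 'I_d -> A, nonunits = ideal_gen a].

End Ideals.

(* B, with structure map g, is the localization A[1/f]. *)
Definition is_localization (A B : comPzRingType) (f : A) (g : A -> B) :=
  [/\ invertible (g f),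
      (forall b, exists a n, b * g f ^+ n = g a) &
      (forall a, g a = 0 -> exists n, f ^+ n * a = 0)].

Section Algebras.
Variables (k A : comPzRingType) (iota : {rmorphism k -> A}).

Definition finitely_generated_algebra :=
  exists (n : nat) (a : 'I_n -> A), forall S : set A,
    (forall c, S (iota c)) -> (forall i, S (a i)) ->
    (forall b c, S b -> S c -> S (b + c)) ->
    (forall b c, S b -> S c -> S (b * c)) ->
    S = setT.

(* A ring map C -> B over k is a map p out of a k-algebra C, so the structure map
   of B is p \o gam; f and g range over morphisms of k-algebras. *)
Definition formally_smooth :=
  forall (C B : comPzRingType) (gam : {rmorphism k -> C})
    (p : {rmorphism C -> B}) (f : {rmorphism A -> B}),
    (forall b, exists c, p c = b) ->
    (forall c c', p c = 0 -> p c' = 0 -> c * c' = 0) ->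
    (forall a, f (iota a) = p (gam a)) ->
    exists g : {rmorphism A -> C},
      (forall a, g (iota a) = gam a) /\ (forall a, p (g a) = f a).

(* Over a field, finite generation is finite presentation. *)
Definition smooth_algebra := finitely_generated_algebra /\ formally_smooth.

End Algebras.

Record opens (T : topologicalType) := Opens { oset :> set T; _ : open oset }.

Lemma oset_open (T : topologicalType) (U : opens T) : open (oset U).
Proof. by case: U. Qed.

Definition opensT (T : topologicalType) : opens T := Opens (@openT T).

Definition opensI (T : topologicalType) (U V : opens T) : opens T :=
  Opens (openI (oset_open U) (oset_open V)).

Lemma opensIl (T : topologicalType) (U V : opens T) : opensI U V `<=` U.
Proof. by move=> y []. Qed.

Lemma opensIr (T : topologicalType) (U V : opens T) : opensI U V `<=` V.
Proof. by move=> y []. Qed.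

Lemma subopensT (T : topologicalType) (U : opens T) : U `<=` opensT T.
Proof. by []. Qed.

Record ringedSpace := RingedSpace {
  carrier :> topologicalType;
  sect : opens carrier -> comPzRingType;
  restr : forall U V : opens carrier, V `<=` U -> {rmorphism sect U -> sect V};
  restr_id : forall (U : opens carrier) (h : U `<=` U) s, restr h s = s;
  restr_comp : forall (U V W : opens carrier) (hUV : V `<=` U) (hVW : W `<=` V) (hUW : W `<=` U) s,
    restr hVW (restr hUV s) = restr hUW s;
  sheaf_locality : forall (U : opens carrier) (I : Type) (V : I -> opens carrier)
      (h : forall i, V i `<=` U),
    U `<=` \bigcup_i V i ->
    forall s t, (forall i, restr (h i) s = restr (h i) t) -> s = t;
  sheaf_gluing : forall (U : opens carrier) (I : Type) (V : I -> opens carrier)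
      (h : forall i, V i `<=` U),
    U `<=` \bigcup_i V i ->
    forall s : (forall i, sect (V i)),
      (forall i j (W : opens carrier) (hi : W `<=` V i) (hj : W `<=` V j),
         restr hi (s i) = restr hj (s j)) ->
      exists t : sect U, forall i, restr (h i) t = s i
}.

Section Stalk.
Variables (X : ringedSpace) (x : X).

Record germ_rep := GermRep {
  gdom : opens X; gdomP : oset gdom x; gsec : sect gdom }.

HB.instance Definition _ := gen_eqMixin germ_rep.
HB.instance Definition _ := gen_choiceMixin germ_rep.

Definition germ_eqv (r s : germ_rep) :=
  exists (W : opens X) (hr : W `<=` gdom r) (hs : W `<=` gdom s),
    oset W x /\ restr hr (gsec r) = restr hs (gsec s).

Definition germ_eqb (r s : germ_rep) : bool := `[< germ_eqv r s >].

Lemma germ_eqb_refl : reflexive germ_eqb.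
Proof.
move=> r; apply/asboolP; exists (gdom r), (@subset_refl _ _), (@subset_refl _ _).
by split=> //; exact: gdomP.
Qed.

Lemma germ_eqb_sym : symmetric germ_eqb.
Proof.
by move=> r s; apply/asboolP/asboolP=> -[W [h [h' [Wx e]]]]; exists W, h', h.
Qed.

Lemma germ_eqb_trans : transitive germ_eqb.
Proof.
move=> s r t /asboolP[V [h1 [h2 [Vx e]]]] /asboolP[W [h3 [h4 [Wx e']]]].
have hV : opensI V W `<=` V by move=> y [].
have hW : opensI V W `<=` W by move=> y [].
apply/asboolP; exists (opensI V W).
exists (subset_trans hV h1), (subset_trans hW h4); split; first by split.
rewrite -(restr_comp h1 hV) -(restr_comp h4 hW) e -e'.
by rewrite !(restr_comp _ _ (subset_trans hV h2)).
Qed.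

Canonical germ_equiv := EquivRel germ_eqb germ_eqb_refl germ_eqb_sym germ_eqb_trans.

(* The local ring O_{X,x}: the colimit of the rings O(U) over the open
   neighbourhoods U of x. *)
Definition stalk := {eq_quot germ_equiv}.

HB.instance Definition _ := Choice.on stalk.
HB.instance Definition _ := EqQuotient.on stalk.

Definition germ (U : opens X) (Ux : oset U x) (s : sect U) : stalk :=
  \pi_stalk (GermRep Ux s).

Lemma germP (U V : opens X) (Ux : oset U x) (Vx : oset V x) (s : sect U) (t : sect V) :
  germ Ux s = germ Vx t <-> germ_eqv (GermRep Ux s) (GermRep Vx t).
Proof.
rewrite /germ; split=> [/eqP|h].
  by rewrite eqmodE => /asboolP.
by apply/eqP; rewrite eqmodE; apply/asboolP.
Qed.

Lemma germ_restr (U V : opens X) (h : V `<=` U) (Ux : oset U x) (Vx : oset V x) s :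
  germ Vx (restr h s) = germ Ux s.
Proof.
apply/germP; exists V, (@subset_refl _ _), h; split=> //=.
by rewrite (restr_comp _ _ h).
Qed.

Lemma germ_surj (a : stalk) : exists U (Ux : oset U x) (s : sect U), a = germ Ux s.
Proof.
by elim/quotW: a => -[U Ux s]; exists U, Ux, s.
Qed.

Lemma germ_surj2 (a b : stalk) :
  exists U (Ux : oset U x) (s t : sect U), a = germ Ux s /\ b = germ Ux t.
Proof.
have [U [Ux [s ->]]] := germ_surj a; have [V [Vx [t ->]]] := germ_surj b.
have hU : opensI U V `<=` U by move=> y [].
have hV : opensI U V `<=` V by move=> y [].
have UVx : oset (opensI U V) x by split.
by exists (opensI U V), UVx, (restr hU s), (restr hV t); rewrite !germ_restr.
Qed.

Lemma germ_surj3 (a b c : stalk) : exists U (Ux : oset U x) (s t u : sect U),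
  [/\ a = germ Ux s, b = germ Ux t & c = germ Ux u].
Proof.
have [U [Ux [s [t [-> ->]]]]] := germ_surj2 a b.
have [V [Vx [u ->]]] := germ_surj c.
have hU : opensI U V `<=` U by move=> y [].
have hV : opensI U V `<=` V by move=> y [].
have UVx : oset (opensI U V) x by split.
exists (opensI U V), UVx, (restr hU s), (restr hU t), (restr hV u).
by rewrite !germ_restr.
Qed.

Definition grep2 (op : forall R : comPzRingType, R -> R -> R) (r s : germ_rep) :=
  GermRep (conj (gdomP r) (gdomP s) : oset (opensI (gdom r) (gdom s)) x)
    (op _ (restr (@opensIl _ _ _) (gsec r)) (restr (@opensIr _ _ _) (gsec s))).

Definition stalk_op op (a b : stalk) : stalk :=
  \pi_stalk (grep2 op (repr a) (repr b)).

Lemma germ_op (op : forall R : comPzRingType, R -> R -> R)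
    (opM : forall (R S : comPzRingType) (f : {rmorphism R -> S}),
       {morph f : y z / op R y z >-> op S y z})
    (U : opens X) (Ux : oset U x) (s t : sect U) :
  stalk_op op (germ Ux s) (germ Ux t) = germ Ux (op _ s t).
Proof.
have reprP (u : sect U) : germ_eqv (repr (germ Ux u)) (GermRep Ux u).
  apply/asboolP; rewrite -[`[< _ >]]/(germ_equiv _ _) -eqmodE.
  by rewrite reprK.
have [V [hV [hV' [Vx eV]]]] := reprP s.
have [W [hW [hW' [Wx eW]]]] := reprP t.
rewrite /stalk_op; apply/eqP; rewrite eqmodE; apply/asboolP.
have lV : opensI V W `<=` V by move=> y [].
have lW : opensI V W `<=` W by move=> y [].
have h : opensI V W `<=` opensI (gdom (repr (germ Ux s))) (gdom (repr (germ Ux t))).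
  by move=> y [/hV ? /hW ?].
exists (opensI V W), h, (subset_trans lV hV'); split; first by split.
rewrite /= !opM !(restr_comp _ _ (subset_trans lV hV)).
rewrite !(restr_comp _ _ (subset_trans lW hW)).
rewrite -(restr_comp hV lV) -(restr_comp hW lW) eV eW /=.
by rewrite !(restr_comp _ _ (subset_trans lV hV')).
Qed.

Definition stalk_add := stalk_op (fun R => +%R).
Definition stalk_mul := stalk_op (fun R => *%R).
Definition stalk_opp (a : stalk) : stalk :=
  germ (gdomP (repr a)) (- gsec (repr a)).
Definition stalk0 : stalk := germ (I : oset (opensT X) x) 0.
Definition stalk1 : stalk := germ (I : oset (opensT X) x) 1.

Lemma germD U (Ux : oset U x) (s t : sect U) :
  stalk_add (germ Ux s) (germ Ux t) = germ Ux (s + t).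
Proof. by apply: germ_op => R S f y z; rewrite rmorphD. Qed.

Lemma germM U (Ux : oset U x) (s t : sect U) :
  stalk_mul (germ Ux s) (germ Ux t) = germ Ux (s * t).
Proof. by apply: germ_op => R S f y z; rewrite rmorphM. Qed.

Lemma germ0 U (Ux : oset U x) : germ Ux 0 = stalk0.
Proof. by rewrite /stalk0 -(germ_restr (@subopensT _ U) _ Ux) rmorph0. Qed.

Lemma germ1 U (Ux : oset U x) : germ Ux 1 = stalk1.
Proof. by rewrite /stalk1 -(germ_restr (@subopensT _ U) _ Ux) rmorph1. Qed.

Lemma germN U (Ux : oset U x) (s : sect U) :
  stalk_opp (germ Ux s) = germ Ux (- s).
Proof.
rewrite /stalk_opp.
have : germ (gdomP (repr (germ Ux s))) (gsec (repr (germ Ux s))) = germ Ux s.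
  rewrite -[RHS]reprK /germ.
  by case: (repr _).
move=> /germP[W [h [h' [Wx e]]]]; apply/germP; exists W, h, h'; split=> //=.
by rewrite !rmorphN e.
Qed.

Lemma stalk_addA : associative stalk_add.
Proof.
move=> a b c; have [U [Ux [s [t [u [-> -> ->]]]]]] := germ_surj3 a b c.
by rewrite !germD addrA.
Qed.

Lemma stalk_addC : commutative stalk_add.
Proof.
move=> a b; have [U [Ux [s [t [-> ->]]]]] := germ_surj2 a b.
by rewrite !germD addrC.
Qed.

Lemma stalk_add0 : left_id stalk0 stalk_add.
Proof.
by move=> a; have [U [Ux [s ->]]] := germ_surj a; rewrite -(germ0 Ux) germD add0r.
Qed.

Lemma stalk_addN : left_inverse stalk0 stalk_opp stalk_add.
Proof.
move=> a; have [U [Ux [s ->]]] := germ_surj a.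
by rewrite germN germD addNr germ0.
Qed.

HB.instance Definition _ :=
  GRing.isZmodule.Build stalk stalk_addA stalk_addC stalk_add0 stalk_addN.

Lemma stalk_mulA : associative stalk_mul.
Proof.
move=> a b c; have [U [Ux [s [t [u [-> -> ->]]]]]] := germ_surj3 a b c.
by rewrite !germM mulrA.
Qed.

Lemma stalk_mulC : commutative stalk_mul.
Proof.
move=> a b; have [U [Ux [s [t [-> ->]]]]] := germ_surj2 a b.
by rewrite !germM mulrC.
Qed.

Lemma stalk_mul1 : left_id stalk1 stalk_mul.
Proof.
by move=> a; have [U [Ux [s ->]]] := germ_surj a; rewrite -(germ1 Ux) germM mul1r.
Qed.

Lemma stalk_mulDl : left_distributive stalk_mul +%R.
Proof.
move=> a b c; have [U [Ux [s [t [u [-> -> ->]]]]]] := germ_surj3 a b c.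
rewrite /GRing.add /=.
by rewrite !(germM, germD) mulrDl.
Qed.

HB.instance Definition _ := GRing.Zmodule_isComPzRing.Build stalk
  stalk_mulA stalk_mulC stalk_mul1 stalk_mulDl.

End Stalk.

(* The data (phi, theta) is an isomorphism of the open subspace U with Spec A:
   phi identifies U with the set of primes of A, compatibly with the Zariski
   topology (closed sets V(E)), and identifies the sheaf with the structure
   sheaf of Spec A, the sheaf whose ring over the basic open set D(f) is A[1/f]. *)
Definition is_spectrum (X : ringedSpace) (U : opens X) (A : comPzRingType)
    (phi : X -> set A) (theta : {rmorphism A -> sect U}) :=
  [/\ set_bij U (@is_prime_ideal A) phi,
      (forall W : set X, W `<=` U ->
         (open W <-> exists E : set A, W = [set y | oset U y /\ ~ E `<=` phi y])) &
      (forall (f : A) (D : opens X) (h : D `<=` U),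
         oset D = [set y | oset U y /\ ~ phi y f] ->
         is_localization f (fun a => restr h (theta a)))].

Definition affine (X : ringedSpace) (U : opens X) :=
  exists (A : comPzRingType) (phi : X -> set A) (theta : {rmorphism A -> sect U}),
    is_spectrum phi theta.

(* A morphism from a scheme to Spec k amounts to a ring morphism from k to the
   ring of global sections. *)
Record scheme_over (k : fieldType) := SchemeOver {
  space :> ringedSpace;
  affine_nbhd : forall x : space, exists2 U : opens space, oset U x & affine U;
  structural : {rmorphism k -> sect (opensT space)}
}.

Section SchemeOver.
Variables (k : fieldType) (X : scheme_over k).

Definition sect_alg (U : opens X) : {rmorphism k -> sect U} :=
  restr (@subopensT _ U) \o structural X.

Definition finite_type :=
  exists (n : nat) (U : 'I_n -> opens X),
    (forall x : X, exists i, oset (U i) x) /\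
    (forall i, affine (U i) /\ finitely_generated_algebra (sect_alg (U i))).

Definition regular_scheme := forall x : X, regular_local (stalk x).

Definition smooth_open (U : opens X) :=
  forall x, oset U x -> exists V : opens X,
    [/\ oset V x, V `<=` U, affine V & smooth_algebra (sect_alg V)].

Definition generically_smooth := exists2 U : opens X, dense U & smooth_open U.

(* L is the residue field k(x) = O_{X,x} / m_x, as an extension of k. *)
Definition is_residue_field (x : X) (L : fieldExtType k) :=
  exists ev : {rmorphism stalk x -> L},
    [/\ (forall l, exists a, ev a = l),
        (forall a, ev a = 0 <-> nonunits a) &
        (forall U (Ux : oset U x) c, ev (germ Ux (sect_alg U c)) = c%:A)].

(* Residue fields of closed points of schemes of finite type over k are finite
   over k, so every closed point contributes to [closed_point_degrees]. *)
Definition closed_point_degrees : set nat :=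
  [set n | exists (x : X) (L : fieldExtType k),
     [/\ closed [set x], is_residue_field x L & \dim {:L} = n]].

Definition separable_point_degrees : set nat :=
  [set n | exists (x : X) (L : fieldExtType k),
     [/\ closed [set x], is_residue_field x L, separable 1 {:L} & \dim {:L} = n]].

End SchemeOver.

Definition is_gcd (D : set nat) (d : nat) :=
  (forall n, D n -> (d %| n)%N) /\
  (forall e, (forall n, D n -> (e %| n)%N) -> (e %| d)%N).

Lemma is_gcd_exists (D : set nat) : exists d, is_gcd D d.
Proof.
pose C := [set g | exists s : seq nat,
  (forall n, n \in s -> D n) /\ g = \big[gcdn/0%N]_(n <- s) n].
have [[n [Dn n0]]|D0] := pselect (exists n, D n /\ (0 < n)%N); last first.
  exists 0%N; split=> [n Dn|e _]; last exact: dvdn0.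
  by case: n Dn => // n Dn; case: D0; exists n.+1.
have exC : exists g, `[< C g >] && (0 < g)%N.
  exists n; rewrite n0 andbT; apply/asboolP; exists [:: n].
  by split=> [m|]; rewrite ?inE ?big_seq1 // => /eqP->.
case: (ex_minnP exC) => g /andP[/asboolP[s [sD eg]] g0] gmin.
exists g; split=> [m Dm|e eD]; last first.
  rewrite eg big_seq; apply: (big_ind (fun z => e %| z)%N) => //.
  - by move=> a b ea eb; rewrite dvdn_gcd ea.
  - by move=> m /sD/eD.
have : (g <= gcdn m g)%N.
  apply: gmin; rewrite gcdn_gt0 g0 orbT andbT; apply/asboolP; exists (m :: s).
  by split=> [p|]; rewrite ?big_cons -?eg // inE => /predU1P[->|/sD].
move=> gle; have -> : g = gcdn m g; last exact: dvdn_gcdl.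
by apply/eqP; rewrite eqn_leq gle dvdn_leq // dvdn_gcdr.
Qed.

Definition gcd_set (D : set nat) : nat := projT1 (cid (is_gcd_exists D)).

Lemma gcd_setP (D : set nat) : is_gcd D (gcd_set D).
Proof. exact: projT2 (cid (is_gcd_exists D)). Qed.

Definition scheme_index (k : fieldType) (X : scheme_over k) : nat :=
  gcd_set (closed_point_degrees X).

Definition separable_index (k : fieldType) (X : scheme_over k) : nat :=
  gcd_set (separable_point_degrees X).

(* Main.v *)
(* If [k] is perfect there is nothing to prove, so let [k] be infinite of characteristic
   [p], and let [N] divide the degrees of all separable closed points. Near a closed point
   the scheme is the spectrum of a domain [C], with a maximal ideal [m] at which [C] is
   regular of dimension [d]. Smoothness is used only in the following form: some [h <> 0]
   in [C] is such that every derivation [D] of [k] lifts to a derivation [E] of [C] with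
   [E(c) = h^n D(c)]. By Mac Lane's criterion this makes [C] separable over [k].

   The property passes to hypersurface sections: let [a], [e] belong to a regular system of
   parameters at [m] and let [delta] be a [k]-derivation of [C] with [delta(a) <> 0]. Then
   [g = a + c e^p] satisfies [delta(g) = delta(a)], and [delta(g) E - E(g) delta] kills [g];
   it lifts [D] to the component of [g = 0] through [m] when [c] is chosen such that
   [delta(a) h] does not vanish there. Induction on [d] leaves the cases [d = 0], where the
   residue field at [m] is itself separable, and [d = 1].

   For [d = 1], a uniformizer at [m] is modified into a function [g] such that [C] is free
   of finite rank over [k[g]] and such that the points of the fibre [g = t], for a general
   scalar [t], and the points other than [m] of the fibre [g = 0], are separable. Both
   fibres have the same length and [m] has multiplicity one in the second, so [N] divides
   the degree of [m]. *)
Require Import Defs.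
From HB Require Import structures.
From Stdlib Require List.
From mathcomp Require Import all_boot all_order all_algebra all_field.
From mathcomp Require Import generic_quotient ring.
From mathcomp Require Import -(notations) mpoly.
From mathcomp Require Import boolp classical_sets functions topology.

Set Implicit Arguments.
Unset Strict Implicit.
Unset Printing Implicit Defensive.

Import GRing.Theory.

Local Open Scope classical_set_scope.
Local Open Scope ring_scope.
Local Open Scope quotient_scope.

(** * Ideals and Noetherian rings *)

(** The obstacle is that a regular closed point may have an inseparable residue field, so [h] may
    vanish at [m] and no smooth neighbourhood of [m] is available: what the induction carries is
    regularity at [m] together with the lifting of derivations, which is only a generic condition.
    The term [c e^p] is chosen because every [k]-derivation kills it: [delta(g)] does not depend on
    [c], while varying [c] still moves the hypersurface off the zeros of a given function. Enough
    scalars exist because Frobenius is injective but not onto, which forces [k] to be infinite. A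
    derivation [delta] with [delta(a) <> 0] exists after multiplying [a] by a unit at [m], since
    otherwise [C] would be algebraic over [k] and [a] invertible.

    Local rings of [C] are never formed: an ideal of the local ring at a prime [P] is represented by
    its contraction [sat P I], and the component of [g = 0] through [m] is [sat m (gens [:: g])], a
    prime ideal by regularity. Lengths of fibres are dimensions over [k] of quotients of [C], which
    prime filtrations reduce to degrees of closed points. *)

Section IdealTheory.
Variable A : comPzRingType.
Implicit Types (I J P Q : set A) (a b r x y z : A) (s t : seq A).

Section Closure.
Variables (I : set A) (idI : is_ideal I).

Lemma ideal0 : I 0. Proof. by case: idI. Qed.
Lemma idealD x y : I x -> I y -> I (x + y). Proof. by case: idI => _ h _; apply: h. Qed.
Lemma idealM r x : I x -> I (r * x). Proof. by case: idI => _ _; apply. Qed.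
Lemma idealMr r x : I x -> I (x * r). Proof. by rewrite mulrC; apply: idealM. Qed.
Lemma idealN x : I x -> I (- x). Proof. by rewrite -mulN1r; apply: idealM. Qed.
Lemma idealB x y : I x -> I y -> I (x - y).
Proof. by move=> Ix Iy; apply: idealD => //; apply: idealN. Qed.
Lemma idealDl x y : I x -> I (x + y) -> I y.
Proof. by move=> Ix Ixy; rewrite -(addKr x y) addrC; apply: idealB. Qed.
Lemma idealDr x y : I y -> I (x + y) -> I x.
Proof. by rewrite addrC; apply: idealDl. Qed.
Lemma ideal_sum (T : Type) (l : seq T) (p : pred T) (F : T -> A) :
  (forall i, p i -> I (F i)) -> I (\sum_(i <- l | p i) F i).
Proof. by move=> h; apply: big_ind => //; [exact: ideal0 | exact: idealD]. Qed.
Lemma ideal1 x : I 1 -> I x.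
Proof. by move=> I1; rewrite -[x]mulr1; apply: idealM. Qed.

End Closure.

Lemma prime_ideal P : is_prime_ideal P -> is_ideal P. Proof. by case. Qed.

Lemma primeM P x y : is_prime_ideal P -> P (x * y) -> ~ P x -> P y.
Proof. by case=> _ _ h /h[]. Qed.

Lemma primeNM P x y : is_prime_ideal P -> ~ P x -> ~ P y -> ~ P (x * y).
Proof. by move=> pP nx ny /(primeM pP)/(_ nx). Qed.

Lemma primeX P x n : is_prime_ideal P -> ~ P x -> ~ P (x ^+ n).
Proof.
move=> pP nx; elim: n => [|n IH]; first by rewrite expr0; case: pP.
by rewrite exprS; apply: primeNM.
Qed.

Lemma ideal_set0 : is_ideal [set (0 : A)].
Proof. by split=> [//|a b -> ->|a b ->]; rewrite /= ?addr0 ?mulr0. Qed.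

Definition idadd I g : set A := [set x | exists r y, I y /\ x = r * g + y].

Lemma idadd_ideal I g : is_ideal I -> is_ideal (idadd I g).
Proof.
move=> idI; split.
- by exists 0, 0; split; [exact: ideal0 | rewrite mul0r addr0].
- move=> _ _ [r [y [Iy ->]]] [r' [y' [Iy' ->]]]; exists (r + r'), (y + y').
  by split; [exact: idealD | rewrite mulrDl addrACA].
- move=> a _ [r [y [Iy ->]]]; exists (a * r), (a * y).
  by split; [exact: idealM | rewrite mulrDr mulrA].
Qed.

Lemma idadd_sub I g : I `<=` idadd I g.
Proof. by move=> x Ix; exists 0, x; rewrite mul0r add0r. Qed.

Lemma idadd_gen I g : is_ideal I -> idadd I g g.
Proof. by move=> idI; exists 1, 0; rewrite mul1r addr0; split=> //; exact: ideal0. Qed.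

Lemma idadd_min I J g : is_ideal J -> I `<=` J -> J g -> idadd I g `<=` J.
Proof.
by move=> idJ IJ Jg _ [r [y [Iy ->]]]; apply: idealD => //; [exact: idealM | exact: IJ].
Qed.

Lemma idadd_mono I J g : I `<=` J -> idadd I g `<=` idadd J g.
Proof. by move=> IJ _ [r [y [Iy ->]]]; exists r, y; split=> //; apply: IJ. Qed.

(** One generator is added at a time, so that statements about [I + (s)] go by induction on the
    list; [gens s] is the case where [I] is zero. *)
Fixpoint adds I s : set A := if s is g :: s' then adds (idadd I g) s' else I.

Lemma adds_ideal I s : is_ideal I -> is_ideal (adds I s).
Proof. by elim: s I => //= g s IH I idI; apply: IH; apply: idadd_ideal. Qed.

Lemma adds_cat I s t : adds I (s ++ t) = adds (adds I s) t.
Proof. by elim: s I => //=. Qed.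

Lemma adds_sub I s : I `<=` adds I s.
Proof.
elim: s I => [I x //|g s IH I /=]; apply: subset_trans (IH _); exact: idadd_sub.
Qed.

Lemma adds_gen I s g : is_ideal I -> g \in s -> adds I s g.
Proof.
elim: s I => [//|h s IH] I idI /=; rewrite inE => /predU1P[->|gs].
  by apply: adds_sub; apply: idadd_gen.
by apply: IH => //; apply: idadd_ideal.
Qed.

Lemma adds_min I J s : is_ideal J -> I `<=` J -> (forall g, g \in s -> J g) ->
  adds I s `<=` J.
Proof.
elim: s I => [//|g s IH] I idJ IJ sJ /=; apply: IH => //.
  by apply: idadd_min => //; apply: sJ; rewrite mem_head.
by move=> h hs; apply: sJ; rewrite inE hs orbT.
Qed.

Lemma adds_mono I J s : I `<=` J -> adds I s `<=` adds J s.
Proof. by elim: s I J => [//|g s IH] I J IJ /=; apply: IH; apply: idadd_mono. Qed.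

Notation gens := (adds [set (0 : A)]).

Lemma gens_ideal s : is_ideal (gens s).
Proof. exact: adds_ideal ideal_set0. Qed.

Lemma gens_min J s : is_ideal J -> (forall g, g \in s -> J g) -> gens s `<=` J.
Proof. by move=> idJ sJ; apply: adds_min => // _ ->; apply: ideal0. Qed.

Lemma gens_sub s t : {subset s <= t} -> gens s `<=` gens t.
Proof.
move=> st; apply: gens_min (gens_ideal t) _ => g /st; exact: adds_gen ideal_set0.
Qed.

Lemma addsP I s x : adds I s x <-> exists2 y, I y & gens s (x - y).
Proof.
elim: s x I => [|g s IH] x I /=.
  by split=> [Ix|[y Iy /eqP]]; [exists x => //; rewrite subrr | rewrite subr_eq0 => /eqP->].
split.
  move=> /IH[_ [r [y [Iy ->]]] h]; exists y => //; apply/IH.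
  by exists (r * g); [exists r, 0; rewrite addr0 | rewrite -addrA -opprD (addrC y)].
case=> y Iy /IH[_ [r [_ [-> ->]]] h]; apply/IH; exists (r * g + y).
  by exists r, y.
by move: h; rewrite addr0 opprD addrA addrAC.
Qed.

Lemma gens_cons g s x : gens (g :: s) x <-> exists r, gens s (x - r * g).
Proof.
rewrite /= addsP; split=> [[_ [r [_ [-> ->]]]]|[r h]].
  by rewrite addr0; exists r.
by exists (r * g) => //; exists r, 0; rewrite addr0.
Qed.

Lemma adds_cons I g s z :
  adds I (g :: s) z <-> exists r, adds I s (z - r * g).
Proof.
split=> [/addsP[y Iy /gens_cons[r h]]|[r /addsP[y Iy h]]].
  by exists r; apply/addsP; exists y => //; rewrite addrAC.
by apply/addsP; exists y => //; apply/gens_cons; exists r; rewrite addrAC.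
Qed.

Lemma gens1 g x : gens [:: g] x <-> exists r, x = r * g.
Proof.
split=> [[r [_ [-> ->]]]|[r ->]]; first by exists r; rewrite addr0.
by exists r, 0; rewrite addr0.
Qed.

Lemma ideal_genE n (a : 'I_n -> A) : ideal_gen a = gens [seq a i | i <- enum 'I_n].
Proof.
apply/seteqP; split.
  move=> _ [c ->]; have idg := gens_ideal [seq a i | i <- enum 'I_n].
  apply: (ideal_sum idg) => i _; apply: (idealM idg).
  by apply: adds_gen ideal_set0 _; apply: map_f; rewrite mem_enum.
apply: gens_min.
  split.
  - by exists (fun=> 0); rewrite big1 // => i _; rewrite mul0r.
  - move=> _ _ [c ->] [d ->]; exists (fun i => c i + d i).
    by rewrite -big_split /=; apply: eq_bigr => i _; rewrite mulrDl.
  - move=> r _ [c ->]; exists (fun i => r * c i).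
    by rewrite mulr_sumr; apply: eq_bigr => i _; rewrite mulrA.
move=> _ /mapP[i _ ->]; exists (fun j => (j == i)%:R).
by rewrite (bigD1 i) //= eqxx mul1r big1 ?addr0 // => j /negbTE->; rewrite mul0r.
Qed.

Lemma noetherianP :
  noetherian A <-> (forall I, is_ideal I -> exists s, I = gens s).
Proof.
split=> h I idI.
  by have [n [a ->]] := h I idI; rewrite ideal_genE; eexists.
have [s ->] := h I idI; exists (size s), (fun i => nth 0 s i).
rewrite ideal_genE; congr (gens _).
by rewrite -[RHS]/(map (nth 0 s \o val) _) map_comp val_enum_ord map_nth_iota0 ?take_size.
Qed.

Hypothesis noethA : noetherian A.

Lemma noeth_chain (I : nat -> set A) : (forall n, is_ideal (I n)) ->
  (forall n, I n `<=` I n.+1) -> exists n, forall m, I m `<=` I n.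
Proof.
move=> idI incI.
have mono m n : (m <= n)%N -> I m `<=` I n.
  move=> /subnK<-; elim: (n - m)%N => //= d IH x /IH; rewrite addSn; exact: incI.
pose U : set A := [set x | exists n, I n x].
have idU : is_ideal U.
  split; first by exists 0%N; apply: ideal0.
    move=> a b [m Ia] [n Ib]; exists (maxn m n); apply: idealD => //.
      by apply: mono Ia; rewrite leq_maxl.
    by apply: mono Ib; rewrite leq_maxr.
  by move=> a b [m Ib]; exists m; apply: idealM.
have [s eU] := (noetherianP.1 noethA) U idU.
have sU g : g \in s -> U g by rewrite eU; apply: adds_gen ideal_set0.
have [n In] : exists n, forall g, g \in s -> I n g.
  elim: s sU {eU} => [|g s IH] sU; first by exists 0%N.
  have [m Im] := IH (fun h hs => sU h (@mem_behead _ (g :: s) h hs)).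
  have [n Ig] := sU g (mem_head _ _).
  exists (maxn m n) => h; rewrite inE => /predU1P[->|/Im].
    by apply: mono Ig; rewrite leq_maxr.
  by apply: mono; rewrite leq_maxl.
exists n => m x Ix; have : U x by exists m.
by rewrite eU; apply: gens_min.
Qed.

Lemma noeth_max (F : set (set A)) I0 : (forall I, F I -> is_ideal I) -> F I0 ->
  exists2 I, F I & forall J, F J -> I `<=` J -> J `<=` I.
Proof.
move=> Fid FI0; apply: contrapT => nmax.
have step (I : {I | F I}) : {J : {J | F J} | sval I `<` sval J}.
  apply: cid; apply: contrapT => h; apply: nmax; exists (sval I); first exact: svalP.
  move=> J FJ IJ; apply: contrapT => nJI; apply: h; exists (exist _ J FJ).
  by split=> //= JI; apply: nJI.
pose f n := iter n (fun I : {I | F I} => sval (step I)) (exist F I0 FI0).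
have [n] := @noeth_chain (fun n => sval (f n)) (fun n => Fid _ (svalP (f n)))
  (fun n => properW (svalP (step (f n)))).
by move=> /(_ n.+1); have [_] := svalP (step (f n)).
Qed.

(** Noetherian induction: a maximal ideal without such a list is not prime; if it contains [a * b],
    every prime above it contains [a] or [b], and the lists for the two larger ideals are
    concatenated. The list may be redundant. *)
Lemma minimal_primes I : is_ideal I -> exists l : seq (set A),
  (forall Q, List.In Q l -> is_prime_ideal Q /\ I `<=` Q) /\
  (forall P, is_prime_ideal P -> I `<=` P -> exists2 Q, List.In Q l & Q `<=` P).
Proof.
move=> idI; apply: contrapT => nI.
pose F : set (set A) := [set I | is_ideal I /\ ~ (exists l : seq (set A),
  (forall Q, List.In Q l -> is_prime_ideal Q /\ I `<=` Q) /\
  (forall P, is_prime_ideal P -> I `<=` P -> exists2 Q, List.In Q l & Q `<=` P))].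
have [J [idJ nJ] maxJ] := @noeth_max F I (fun _ => @proj1 _ _) (conj idI nI).
apply: nJ; have [J1|nJ1] := pselect (J 1).
  by exists [::]; split=> // P [_ nP1 _] /(_ _ J1).
have [pJ|npJ] := pselect (is_prime_ideal J).
  by exists [:: J]; split=> [Q [<-|//]|P pP JP]; [split | exists J => //; left].
have [a [b [Jab [nJa nJb]]]] : exists a b, J (a * b) /\ ~ J a /\ ~ J b.
  apply: contrapT => h; apply: npJ; split=> // a b Jab.
  have [Ja|nJa] := pselect (J a); [by left | right].
  by apply: contrapT => nJb; apply: h; exists a, b.
have ex c : ~ J c -> exists l : seq (set A),
  (forall Q, List.In Q l -> is_prime_ideal Q /\ idadd J c `<=` Q) /\
  (forall P, is_prime_ideal P -> idadd J c `<=` P -> exists2 Q, List.In Q l & Q `<=` P).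
  move=> nJc; apply: contrapT => nl; apply: nJc; apply: (maxJ (idadd J c)).
  - by split=> //; apply: idadd_ideal.
  - exact: idadd_sub.
  - exact: idadd_gen.
have [[la [la1 la2]] [lb [lb1 lb2]]] := (ex a nJa, ex b nJb).
exists (la ++ lb); split=> [Q|P pP JP].
  have JJ c : idadd J c `<=` Q -> J `<=` Q.
    by move=> h; apply: subset_trans h; apply: idadd_sub.
  by move=> /(@List.in_app_or _ la lb)[/la1|/lb1] [pQ /JJ].
have idP := prime_ideal pP.
have [Pa|nPa] := pselect (P a).
  have [|Q Ql QP] := la2 P pP; first exact: idadd_min.
  by exists Q => //; apply: (@List.in_or_app _ la lb); left.
have Pb := primeM pP (JP _ Jab) nPa.
have [|Q Ql QP] := lb2 P pP; first exact: idadd_min.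
by exists Q => //; apply: (@List.in_or_app _ la lb); right.
Qed.

End IdealTheory.

Notation gens := (adds [set 0]).
Arguments ideal_set0 {A}.

Lemma noetherian_image (A B : comPzRingType) (f : {rmorphism A -> B}) :
  (forall b, exists a, f a = b) -> noetherian A -> noetherian B.
Proof.
move=> fsurj /noetherianP nA; apply/noetherianP => I idI.
have [|s es] := nA [set a | I (f a)].
  split; rewrite /=; first by rewrite rmorph0; apply: ideal0.
    by move=> a b; rewrite rmorphD; apply: idealD.
  by move=> a b; rewrite rmorphM; apply: idealM.
exists (map f s); apply/seteqP; split; last first.
  apply: gens_min => // _ /mapP[a sa ->].
  by have : [set a | I (f a)] a by rewrite es; apply: adds_gen sa; apply: ideal_set0.
move=> b; have [a <-] := fsurj b => Ifa.
have : gens s a by rewrite -es.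
elim: s a {es Ifa} => [|g s IH] a; first by move=> ->; rewrite rmorph0.
by move=> /gens_cons[r /IH]; rewrite rmorphB rmorphM => h; apply/gens_cons; exists (f r).
Qed.

(** * Hilbert's basis theorem *)

Section Hilbert.
Variable R : comNzRingType.
Hypothesis noethR : noetherian R.

(** The ideals [L n] of coefficients of ['X^n] in members of [I] of degree at most [n] increase,
    hence stabilize at some [N]. Lifts of generators of [L 0], ..., [L N] generate [I]: in degree
    above [N] a lift from [L N] is shifted by a power of ['X]. *)
Lemma poly_noetherian : noetherian {poly R}.
Proof.
apply/noetherianP => I idI.
pose L n : set R := [set c | exists p : {poly R}, [/\ I p, (size p <= n.+1)%N & p`_n = c]].
have idL n : is_ideal (L n).
  split.
  - by exists 0; rewrite size_poly0 coef0; split=> //; apply: ideal0.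
  - move=> _ _ [p [Ip sp <-]] [q [Iq sq <-]]; exists (p + q).
    split; [exact: idealD | | by rewrite coefD].
    by rewrite (leq_trans (size_polyD _ _)) // geq_max sp.
  - move=> a _ [p [Ip sp <-]]; exists (a%:P * p).
    split; [exact: idealM | | by rewrite coefCM].
    by rewrite mul_polyC (leq_trans (size_scale_leq _ _)).
have incL n : L n `<=` L n.+1.
  move=> _ [p [Ip sp <-]]; exists (p * 'X); split.
  - exact: idealMr.
  - apply: leq_trans (size_polyMleq _ _) _; by rewrite size_polyX addn2.
  - by rewrite coefMX.
have [N stabN] := noeth_chain noethR idL incL.
have ex n : {s : seq {poly R} | (forall g, g \in s -> I g) /\
   forall p, I p -> (size p <= n.+1)%N ->
     exists q, [/\ gens s q, (size q <= n.+1)%N & q`_n = p`_n]}.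
  apply: cid; have [t et] := (noetherianP _).1 noethR _ (idL n).
  have : forall g, g \in t -> L n g.
    by rewrite et => g gt; apply: adds_gen gt; apply: ideal_set0.
  have : forall p, I p -> (size p <= n.+1)%N -> gens t p`_n.
    by move=> p Ip sp; rewrite -et; exists p.
  move=> tP tL.
  suff [s [sI sP]] : exists s : seq {poly R}, (forall g, g \in s -> I g) /\
     forall c, gens t c -> exists q, [/\ gens s q, (size q <= n.+1)%N & q`_n = c].
    by exists s; split=> // p Ip sp; apply: sP; apply: tP.
  elim: t tL {tP et} => [|c t IH] tL.
    exists [::]; split=> // _ ->; exists 0; split=> //; rewrite ?size_poly0 ?coef0 //.
  have [s [sI sP]] := IH (fun g gt => tL g (@mem_behead _ (c :: t) g gt)).
  have [p [Ip sp ep]] := tL c (mem_head _ _).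
  exists (p :: s); split=> [g|d /gens_cons[r /sP[q [gq sq eq]]]].
    by rewrite inE => /predU1P[->//|/sI].
  exists (r%:P * p + q); split.
  - by apply/gens_cons; exists r%:P; rewrite addrAC subrr add0r.
  - rewrite (leq_trans (size_polyD _ _)) // geq_max sq andbT mul_polyC.
    exact: leq_trans (size_scale_leq _ _) sp.
  - by rewrite coefD coefCM ep eq addrC subrK.
pose s := flatten [seq sval (ex n) | n <- iota 0 N.+1].
have sub n : (n <= N)%N -> gens (sval (ex n)) `<=` gens s.
  move=> nN; apply: gens_sub => g gs; apply/flattenP; exists (sval (ex n)) => //.
  by apply: map_f; rewrite mem_iota.
have sI : forall g, g \in s -> I g.
  by move=> g /flattenP[_ /mapP[n _ ->]]; apply: (svalP (ex n)).1.
have ids := gens_ideal s.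
exists s; apply/seteqP; split; last exact: gens_min.
have step n (p q : {poly R}) : (size p <= n.+1)%N -> (size q <= n.+1)%N -> q`_n = p`_n ->
    (size (p - q)%R <= n)%N.
  move=> sp sq e; apply/leq_sizeP => j; rewrite leq_eqVlt => /predU1P[<-|nj].
    by rewrite coefB e subrr.
  by rewrite coefB !nth_default ?subrr // ?(leq_trans sq) ?(leq_trans sp).
suff key n : forall p, I p -> (size p <= n)%N -> gens s p by move=> p Ip; apply: (key (size p)).
elim: n => [|n IH] p Ip sp.
  by move: sp; rewrite leqn0 size_poly_eq0 => /eqP->; apply: ideal0.
suff [q [gq sq eq]] : exists q, [/\ gens s q, (size q <= n.+1)%N & q`_n = p`_n].
  rewrite -(subrK q p); apply: idealD => //; apply: IH; last exact: step.
  by apply: idealB => //; move: gq; apply: gens_min.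
have [nN|Nn] := leqP n N.
  have [q [gq sq eq]] := (svalP (ex n)).2 p Ip sp.
  by exists q; split=> //; apply: sub gq.
have [p' [Ip' sp' ep']] : L N p`_n by apply: (stabN n); exists p.
have [q [gq sq eq]] := (svalP (ex N)).2 p' Ip' sp'.
exists (q * 'X^(n - N)); split.
- by apply: idealMr => //; apply: sub gq.
- apply: leq_trans (size_polyMleq _ _) _; rewrite size_polyXn addnS /=.
  by apply: (@leq_trans (N.+1 + (n - N))); rewrite ?leq_add2r // addSn subnKC // ltnW.
- by rewrite coefMXn ltnNge leq_subr /= subKn ?(ltnW Nn) // eq.
Qed.

End Hilbert.

Lemma field_noetherian (k : fieldType) : noetherian k.
Proof.
apply/noetherianP => I idI; have [[c [Ic c0]]|h] := pselect (exists c, I c /\ c != 0).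
  exists [:: 1]; apply/seteqP; split=> [x _|x _]; first by apply/gens1; exists x; rewrite mulr1.
  by rewrite -[x](divfK c0); apply: idealM.
exists [::]; apply/seteqP; split=> [x Ix|_ ->]; last exact: ideal0.
by apply: contrapT => /eqP x0; apply: h; exists x.
Qed.

(** [A] is the image of an iterated polynomial ring, built one generator at a time so that the
    one-variable basis theorem suffices. *)
Lemma fg_noetherian (k : fieldType) (A : comNzRingType) (iota : {rmorphism k -> A}) :
  finitely_generated_algebra iota -> noetherian A.
Proof.
move=> [n [a afg]].
suff [B [f [nB kB aB]]] : exists (B : comNzRingType) (f : {rmorphism B -> A}),
    [/\ noetherian B, forall c, exists b, f b = iota c & forall i, exists b, f b = a i].
  apply: (noetherian_image (f := f)) nB => y.
  have h : [set x | exists b, f b = x] = setT.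
    apply: afg => //.
    - by move=> _ _ [b <-] [c <-]; exists (b + c); rewrite rmorphD.
    - by move=> _ _ [b <-] [c <-]; exists (b * c); rewrite rmorphM.
  by have : [set: A] y by []; rewrite -h.
elim: n a {afg} => [|n IH] a.
  exists k, iota; split=> [|c|[]//]; [exact: field_noetherian | by exists c].
have [B [f [nB kB aB]]] := IH (fun i => a (lift ord0 i)).
pose cfu : commr_rmorph f (a ord0) := fun x => mulrC _ _.
exists {poly B}, (horner_morph cfu); split; first exact: poly_noetherian.
  by move=> c; have [b <-] := kB c; exists b%:P; rewrite /= horner_morphC.
move=> i; have [j ->|->] := unliftP ord0 i.
  by have [b <-] := aB j; exists b%:P; rewrite /= horner_morphC.
by exists 'X; rewrite /= horner_morphX.
Qed.

(** * Regular local rings *)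

Section Saturation.
Variable A : comPzRingType.
Implicit Types (I J P Q : set A) (a b r x y z : A).

(** For a prime [P], this is the contraction to [A] of the extension of [I] to the localization at
    [P]. *)
Definition sat P I : set A := [set x | exists s, ~ P s /\ I (s * x)].

Lemma sat_ideal P I : is_prime_ideal P -> is_ideal I -> is_ideal (sat P I).
Proof.
move=> pP idI; split.
- by exists 1; split; [case: pP | rewrite mulr0; apply: ideal0].
- move=> a b [s [ns Ia]] [t [nt Ib]]; exists (s * t); split; first exact: primeNM.
  rewrite mulrDr; apply: idealD => //; last by rewrite -mulrA; apply: idealM.
  by rewrite mulrAC; apply: idealMr.
- by move=> a b [s [ns Ib]]; exists s; split=> //; rewrite mulrCA; apply: idealM.
Qed.

Lemma sub_sat P I : is_prime_ideal P -> I `<=` sat P I.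
Proof. by move=> [_ n1 _] x Ix; exists 1; rewrite mul1r. Qed.

Lemma sat_min P I J : I `<=` J -> is_prime_ideal J -> J `<=` P -> sat P I `<=` J.
Proof. by move=> IJ pJ JP x [s [ns /IJ/(primeM pJ)]]; apply=> /JP. Qed.

Definition saturated P I := forall s x, ~ P s -> I (s * x) -> I x.

Lemma sat_saturated P I : is_prime_ideal P -> saturated P (sat P I).
Proof.
move=> pP s x ns [t [nt h]]; exists (t * s); split; first exact: primeNM.
by rewrite -mulrA.
Qed.

(** For ideals [I] and [P] this is [I + P (s)], the ideal in the hypothesis of Nakayama's lemma. *)
Fixpoint pcomb I P (s : seq A) : set A :=
  if s is g :: s' then [set x | exists2 p, P p & pcomb I P s' (x - p * g)] else I.

Lemma pcomb_ideal I P s : is_ideal I -> is_ideal P -> is_ideal (pcomb I P s).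
Proof.
move=> idI idP; elim: s => [//|g s IH]; split.
- by exists 0; [exact: ideal0 | rewrite mul0r subr0; apply: ideal0].
- move=> a b [p Pp h] [q Pq h']; exists (p + q); first exact: idealD.
  by rewrite mulrDl opprD addrACA; apply: idealD.
- move=> a b [p Pp h]; exists (a * p); first exact: idealM.
  by rewrite -mulrA -mulrBr; apply: idealM.
Qed.

Lemma pcomb_sub I P s : is_ideal P -> I `<=` pcomb I P s.
Proof.
move=> idP; elim: s => [//|g s IH] x /IH h.
by exists 0; [exact: ideal0 | rewrite mul0r subr0].
Qed.

Lemma pcomb_mul I P s p x : is_ideal I -> is_ideal P -> P p -> gens s x ->
  pcomb I P s (p * x).
Proof.
move=> idI idP Pp; elim: s x => [|g s IH] x.
  by move=> ->; rewrite mulr0; apply: ideal0.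
move=> /gens_cons[r /IH h]; exists (p * r); first exact: idealMr.
by rewrite -mulrA -mulrBr.
Qed.

(** Nakayama's lemma at [P] by elimination: [t g = p g + ...] with [p] in [P] expresses [(t - p) g]
    by the remaining generators, and [t - p] is outside [P]. Removing the generators one by one
    multiplies these factors into a single [u]. *)
Lemma local_nakayama I P s : is_ideal I -> is_prime_ideal P ->
    (forall g, g \in s -> sat P (pcomb I P s) g) ->
  exists2 u, ~ P u & forall x, gens s x -> I (u * x).
Proof.
move=> idI pP; have idP := prime_ideal pP.
elim: s => [|g s IH] h.
  by exists 1; [case: pP | move=> x ->; rewrite mulr0; apply: ideal0].
have [t [nt [p Pp hg]]] := h g (mem_head _ _).
have ntp : ~ P (t - p) by move=> h'; apply: nt; rewrite -(subrK p t); apply: idealD.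
have idC := pcomb_ideal s idI idP.
have hg' : pcomb I P s ((t - p) * g) by rewrite mulrBl.
have [|u nu hu] := IH.
  move=> g' g's; have [|t' [nt' [p' Pp' hg'']]] := h g'; first by rewrite inE g's orbT.
  exists ((t - p) * t'); split; first exact: primeNM.
  rewrite -mulrA -(subrK (p' * g) (t' * g')) mulrDr; apply: idealD => //.
    exact: idealM.
  by rewrite mulrCA; apply: idealM.
exists (u * (t - p)); first exact: primeNM.
have hu' x : pcomb I P s x -> I (u * x).
  elim: s hu {IH h hg hg' idC} x => [|c s IH] hu x; first exact: idealM.
  case=> q Pq hx; rewrite -(subrK (q * c) x) mulrDr; apply: idealD => //.
    apply: IH hx => y hy; apply: hu; apply: gens_sub hy => z zs.
    by rewrite inE zs orbT.
  rewrite mulrCA; apply: idealM => //; apply: hu; apply: (@adds_gen _ _ (c :: s)) ideal_set0 _.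
  exact: mem_head.
move=> x /gens_cons[r hx]; rewrite -(subrK (r * g) x) mulrDr; apply: idealD => //.
  by rewrite mulrAC; apply: idealMr => //; apply: hu.
by rewrite mulrCA; apply: idealM => //; rewrite -mulrA; apply: hu'.
Qed.

Definition colon I b : set A := [set r | I (r * b)].

Lemma colon_ideal I b : is_ideal I -> is_ideal (colon I b).
Proof.
move=> idI; split; rewrite /colon /=.
- by rewrite mul0r; apply: ideal0.
- by move=> x y Ix Iy; rewrite mulrDl; apply: idealD.
- by move=> x y Iy; rewrite -mulrA; apply: idealM.
Qed.

Hypothesis noethA : noetherian A.

(** The quotient of the local ring at [P] by [I0] is Artinian when [P] is minimal above [I0].
    Noetherian induction on the lower bound [I]: if [I] contains [b * b'] but neither factor, a
    chain [J] above [I] is controlled by the chains [sat P (idadd (J n) b)] and [colon (J n) b],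
    whose lower bounds [idadd I b] and [colon I b] are strictly larger. *)
Lemma saturated_dcc P I0 : is_prime_ideal P -> is_ideal I0 ->
    (forall Q, is_prime_ideal Q -> I0 `<=` Q -> Q `<=` P -> P `<=` Q) ->
  forall J : nat -> set A, (forall n, is_ideal (J n)) -> (forall n, saturated P (J n)) ->
    (forall n, I0 `<=` J n) -> (forall n, J n.+1 `<=` J n) ->
  exists n, forall m, (n <= m)%N -> J n `<=` J m.
Proof.
move=> pP idI0 minP.
pose DCC I := forall J : nat -> set A, (forall n, is_ideal (J n)) ->
    (forall n, saturated P (J n)) ->
    (forall n, I `<=` J n) -> (forall n, J n.+1 `<=` J n) ->
  exists n, forall m, (n <= m)%N -> J n `<=` J m.
suff : DCC I0 by [].
apply: contrapT => nI0.
pose F : set (set A) := [set I | [/\ is_ideal I, I0 `<=` I & ~ DCC I]].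
have FI0 : F I0 by split.
have [I [idI I0I nI] maxI] := @noeth_max _ noethA F I0 (fun I h => let: And3 x _ _ := h in x) FI0.
apply: nI => J idJ satJ IJ decJ.
have all_of n s x : J n s -> ~ P s -> J n x.
  by move=> Js ns; apply: (satJ _ s) => //; apply: idealMr.
have mono m n : (m <= n)%N -> J n `<=` J m.
  by move=> /subnK<-; elim: (n - m)%N => [//|d IH] x /decJ/IH.
have [[s [Is ns]]|nIP] := pselect (exists s, I s /\ ~ P s).
  by exists 0%N => m _ x _; apply: (all_of m s) => //; apply: IJ.
have IP : I `<=` P by move=> x Ix; apply: contrapT => nx; apply: nIP; exists x.
have [pI|npI] := pselect (is_prime_ideal I).
  have PI := minP I pI I0I IP.
  have [[n nJn]|h] := pselect (exists n, ~ (exists2 s, J n s & ~ P s)).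
    exists n => m _ x Jx; apply: IJ; apply: PI; apply: contrapT => nPx.
    by apply: nJn; exists x.
  exists 0%N => m _ x _; apply: contrapT => nx; apply: h; exists m => -[s Js ns].
  exact/nx/(all_of m s).
have [b [b' [Ibb [nIb nIb']]]] : exists a b, I (a * b) /\ ~ I a /\ ~ I b.
  apply: contrapT => h; apply: npI; split=> //; first by move=> /IP; case: pP.
  move=> a b Iab; have [Ia|nIa] := pselect (I a); [by left | right].
  by apply: contrapT => nIb; apply: h; exists a, b.
have dcc1 : DCC (idadd I b).
  apply: contrapT => h; apply: nIb; apply: (maxI (idadd I b)); last exact: idadd_gen.
    by split=> //; [exact: idadd_ideal | exact: subset_trans (idadd_sub _)].
  exact: idadd_sub.
have Icol : I `<=` colon I b by move=> x Ix; apply: idealMr.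
have dcc2 : DCC (colon I b).
  apply: contrapT => h; apply: nIb'; apply: (maxI (colon I b)) => //.
    by split=> //; [exact: colon_ideal | exact: subset_trans Icol].
  by rewrite /colon /= mulrC.
have [n1 h1] := dcc1 (fun n => sat P (idadd (J n) b))
  (fun n => sat_ideal pP (idadd_ideal b (idJ n))) (fun n => sat_saturated pP)
  (fun n => subset_trans (idadd_mono (IJ n)) (sub_sat pP))
  (fun n x '(ex_intro s (conj ns h)) => ex_intro _ s (conj ns (idadd_mono (decJ n) h))).
have [n2 h2] := dcc2 (fun n => colon (J n) b) (fun n => colon_ideal b (idJ n))
  (fun n s x ns h => satJ n s _ ns (eq_ind_r (J n) h (mulrA s x b)))
  (fun n x => IJ n _) (fun n x => decJ n _).
exists (maxn n1 n2) => m; rewrite geq_max => /andP[n1m n2m] x Jx.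
have [|s [ns [r [y [Jy e]]]]] := h1 m n1m x.
  apply: sub_sat => //; apply: idadd_sub; apply: mono Jx; exact: leq_maxl.
have Jrb : J n2 (r * b).
  rewrite -[r * b](addrK y) -e; apply: idealB => //; last exact: mono Jy.
  by apply: idealM => //; apply: mono Jx; apply: leq_maxr.
apply: (satJ m s) => //; rewrite e; apply: idealD => //.
exact: (h2 m n2m).
Qed.

(* Relative form of Krull's principal ideal theorem: [Q0] plays the role of [0],
   and [T n] is the n-th symbolic power of [Q] modulo [Q0]. *)
Lemma krull_pit P Q0 a : is_prime_ideal P -> is_prime_ideal Q0 -> Q0 `<=` P -> P a ->
    (forall Q, is_prime_ideal Q -> Q0 `<=` Q -> Q a -> Q `<=` P -> P `<=` Q) ->
  forall Q, is_prime_ideal Q -> Q0 `<=` Q -> Q `<=` P -> ~ P `<=` Q -> Q `<=` Q0.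
Proof.
move=> pP pQ0 Q0P Pa minP Q pQ Q0Q QP nPQ q Qq.
have idP := prime_ideal pP; have idQ := prime_ideal pQ; have idQ0 := prime_ideal pQ0.
have nQa : ~ Q a by move=> Qa; apply: nPQ; apply: minP.
pose QT (T : set A) : set A := [set x | forall J, is_ideal J -> Q0 `<=` J ->
  (forall q t, Q q -> T t -> J (q * t)) -> J x].
have idQT T : is_ideal (QT T).
  split=> [J idJ _ _|x y hx hy J idJ h1 h2|x y hy J idJ h1 h2]; first exact: ideal0.
    by apply: idealD => //; [exact: hx | exact: hy].
  by apply: idealM => //; apply: hy.
pose T n := iter n (fun T => sat Q (QT T)) setT.
have TS n : T n.+1 = sat Q (QT (T n)) by [].
have idT n : is_ideal (T n).
  by case: n => [|n]; [split | rewrite TS; apply: sat_ideal].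
have satT n : saturated Q (T n).
  by case: n => [//|n]; rewrite TS; apply: sat_saturated.
have Q0T n : Q0 `<=` T n.
  case: n => [//|n] x Qx; rewrite TS; apply: sub_sat => // J _ h _; exact: h.
have decT n : T n.+1 `<=` T n.
  elim: n => [//|n IH] x; rewrite !TS => -[s [ns h]]; exists s; split=> // J idJ h1 h2.
  by apply: h => // q' t Qq' /IH; apply: h2.
have qT n : T n (q ^+ n).
  elim: n => [//|n IH]; rewrite TS; apply: sub_sat => // J _ _ h.
  by rewrite exprS; apply: h.
pose Ta n := sat P (idadd (T n) a).
(* [P] is minimal above [Q0] and [a], so the symbolic powers stabilize modulo [a], locally at
   [P]. *)
have [|||||n] := @saturated_dcc P (idadd Q0 a) pP (idadd_ideal a idQ0) _ Ta.
- move=> Q' pQ' h; apply: minP => //; first exact: subset_trans (idadd_sub _) h.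
  by apply: h; apply: idadd_gen.
- by move=> n; apply: sat_ideal => //; apply: idadd_ideal.
- by move=> n; apply: sat_saturated.
- by move=> n; apply: subset_trans (sub_sat pP); apply: idadd_mono.
- move=> n x [s [ns h]]; exists s; split=> //; exact: idadd_mono h.
move=> /(_ n.+1 (leqnSn n)) TaS.
have [s es] := (noetherianP A).1 noethA (T n) (idT n).
(* In [t g = r a + y] the coefficient [r] lies in [T n], since [a] is outside [Q] and [T n] is
   saturated. So [T n] is contained in [T n.+1 + P (T n)] locally at [P], and Nakayama at [P]
   removes the second term. *)
have TnS : T n `<=` T n.+1.
  have [g gs|u nu hu] := @local_nakayama (T n.+1) P s (idT _) pP.
    have Tg : T n g by rewrite es; apply: adds_gen gs; apply: ideal_set0.
    have [|t [nt [r [y [Ty e]]]]] := TaS g.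
      by apply: sub_sat => //; apply: idadd_sub.
    exists t; split=> //; rewrite e; apply: idealD.
    + exact: pcomb_ideal.
    + rewrite mulrC; apply: pcomb_mul => //; rewrite -es.
      apply: (satT n a) => //; rewrite mulrC -[r * a](addrK y) -e.
      by apply: idealB => //; [exact: idealM | exact: decT].
    + exact: pcomb_sub.
  move=> x Tx; apply: (satT n.+1 u); first by move=> /QP.
  by apply: hu; rewrite -es.
(* By the equality just obtained, [T n] is [Q] times itself modulo [Q0], locally at [Q]; Nakayama at
   [Q] kills it, and [q ^+ n] with it. *)
have [g gs|u nu hu] := @local_nakayama Q0 Q s idQ0 pQ.
  have /TnS : T n g by rewrite es; apply: adds_gen gs; apply: ideal_set0.
  rewrite TS => -[t [nt h]]; exists t; split=> //; apply: h.
  - exact: pcomb_ideal.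
  - exact: pcomb_sub.
  - by move=> q' t' Qq' Tt'; apply: pcomb_mul => //; rewrite -es.
have : Q0 (q ^+ n).
  have : Q0 (u * q ^+ n) by apply: hu; rewrite -es.
  by move/(primeM pQ0); apply=> /Q0Q.
by move=> h; apply: contrapT => /(primeX (n := n) pQ0).
Qed.

Lemma min_prime I P : is_ideal I -> is_prime_ideal P -> I `<=` P ->
  exists Q, [/\ is_prime_ideal Q, I `<=` Q, Q `<=` P &
    forall Q', is_prime_ideal Q' -> I `<=` Q' -> Q' `<=` Q -> Q `<=` Q'].
Proof.
move=> idI pP IP; have [l [l1 l2]] := minimal_primes noethA idI.
have [Q0 Q0l Q0P] := l2 P pP IP.
have [Q Ql [QP Qmin]] : exists2 Q, List.In Q l & Q `<=` Q0 /\
    forall Q', List.In Q' l -> Q' `<=` Q -> Q `<=` Q'.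
  elim: l Q0 Q0l {l1 l2 Q0P} => [//|c l IH] Q0 Q0l.
  have aux Q1 : List.In Q1 l -> Q1 `<=` Q0 -> exists2 Q, List.In Q (c :: l) & Q `<=` Q0 /\
      forall Q', List.In Q' (c :: l) -> Q' `<=` Q -> Q `<=` Q'.
    move=> Q1l Q10; have [Q Ql [QQ1 Qmin]] := IH Q1 Q1l.
    have [cQ|ncQ] := pselect (c `<=` Q).
      exists c; first by left.
      split; first by apply: subset_trans Q10; apply: subset_trans QQ1.
      move=> Q' [<- //|Q'l] Q'c; apply: (subset_trans cQ); apply: Qmin => //.
      exact: subset_trans Q'c cQ.
    exists Q; first by right.
    by split; [exact: subset_trans QQ1 Q10 | move=> Q' [<-//|]; apply: Qmin].
  have [e|Q0l'] : c = Q0 \/ List.In Q0 l := Q0l; last exact: (aux Q0 Q0l' (@subset_refl _ _)).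
  have [[Q1 [Q1l Q1c]]|h] := pselect (exists Q1, List.In Q1 l /\ Q1 `<=` c).
    by apply: (aux Q1 Q1l); rewrite -e.
  exists c; first by left.
  split; first by rewrite e.
  by move=> Q' [<- //|Q'l] Q'c; case: h; exists Q'.
exists Q; have [pQ IQ] := l1 Q Ql; split=> //; first exact: subset_trans QP Q0P.
move=> Q' pQ' IQ' Q'Q; have [Q'' Q''l Q''Q'] := l2 Q' pQ' IQ'.
apply: (subset_trans _ Q''Q'); apply: Qmin => //; exact: (subset_trans Q''Q' Q'Q).
Qed.

Lemma prime_chain_rcons d (C : nat -> set A) P : prime_chain d C -> is_prime_ideal P ->
  C d `<` P -> prime_chain d.+1 (fun i => if (i <= d)%N then C i else P).
Proof.
move=> [C1 C2] pP CP; split=> i; first by case: (leqP i d) => // id _; apply: C1.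
rewrite ltnS => id; rewrite id; case: (leqP i.+1 d) => [id'|di]; first exact: C2.
by have -> : i = d by apply/eqP; rewrite eqn_leq id.
Qed.

(** Dividing by one element shortens a chain of primes by at most one. The element is pushed down
    the chain: if [a] is not yet in the prime below the top, that prime is replaced by a prime [Q]
    minimal above [a] and the next lower prime. By the principal ideal theorem [Q] is not the top,
    because the replaced prime lies strictly between. *)
Lemma chain_drop d (C : nat -> set A) a : prime_chain d.+1 C -> C d.+1 a ->
  exists C', [/\ prime_chain d C', C' d = C d.+1, C' 0%N a & C 0%N `<=` C' 0%N].
Proof.
elim: d C => [|d IH] C [C1 C2] Ca.
  exists (fun=> C 1%N); split=> //; last exact: properW (C2 0%N _).
  by split=> // i _; apply: C1.
have chain e : (e <= d.+2)%N -> prime_chain e C.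
  by move=> ed; split=> i ie; [apply: C1 | apply: C2]; apply: leq_trans ed.
have [Cda|nCda] := pselect (C d.+1 a).
  have [C' [cC' eC' C'a C'0]] := IH C (chain _ (leqnSn _)) Cda.
  exists (fun i => if (i <= d)%N then C' i else C d.+2); split=> //; last by rewrite ltnn.
  by apply: prime_chain_rcons => //; [exact: C1 | rewrite eC'; apply: C2].
have pd : is_prime_ideal (C d) by apply: C1; rewrite -addn2 leq_addr.
have pd2 : is_prime_ideal (C d.+2) by apply: C1.
have [s1 n1] := C2 d (leqnSn d.+1); have [s2 n2] := C2 d.+1 (leqnn _).
have idI := idadd_ideal a (prime_ideal pd).
have [|Q [pQ IQ QP Qmin]] := @min_prime (idadd (C d) a) (C d.+2) idI pd2.
  by apply: idadd_min => //; [exact: prime_ideal | exact: subset_trans s2].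
have CdQ : C d `<=` Q by apply: subset_trans IQ; apply: idadd_sub.
have Qa : Q a by apply: IQ; apply: idadd_gen; apply: prime_ideal.
have nPQ : ~ C d.+2 `<=` Q.
  move=> PQ; apply: n1.
  apply: (@krull_pit (C d.+2) (C d) a) => //; [exact: subset_trans s2 | | exact: C1].
  move=> Q' pQ' dQ' Q'a Q'P; apply: (subset_trans PQ); apply: Qmin => //.
    by apply: idadd_min => //; apply: prime_ideal.
  exact: subset_trans Q'P PQ.
have ltdQ : C d `<` Q by split=> // Qd; apply/nCda/s1/Qd.
have [||C' [cC' + C'a C'0]] := IH (fun i => if (i <= d)%N then C i else Q).
- by apply: prime_chain_rcons => //; apply: chain; rewrite -addn2 leq_addr.
- by rewrite ltnn.
rewrite ltnn => eC'.
exists (fun i => if (i <= d)%N then C' i else C d.+2); split=> //; last by rewrite ltnn.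
by apply: prime_chain_rcons => //; rewrite eC'; split.
Qed.

End Saturation.

(** * Generic choices over an infinite field *)

Definition infinite_ring (k : pzRingType) := forall s : seq k, exists c, c \notin s.

Section Generic.
Variables (k : fieldType) (A : comPzRingType) (iota : {rmorphism k -> A}).
Hypothesis kinf : infinite_ring k.

Lemma prime_scalar (P : set A) (c : k) x : is_ideal P -> c != 0 -> P (iota c * x) -> P x.
Proof.
by move=> idP c0 /(idealM idP (iota c^-1)); rewrite mulrA -rmorphM mulVf // rmorph1 mul1r.
Qed.

(** Each ideal excludes at most one scalar: two values [u + iota c * v] in [Q] would put [v], and
    then [u], into [Q]. *)
Lemma generic_scalar (l : seq (set A)) (s : seq k) u v :
    (forall Q, List.In Q l -> is_ideal Q) ->
  exists2 c, c \notin s &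
    forall Q, List.In Q l -> ~ (Q u /\ Q v) -> ~ Q (u + iota c * v).
Proof.
elim: l s => [|Q l IH] s idl; first by have [c cs] := kinf s; exists c.
have idQ : is_ideal Q by apply: idl; left.
have idl' Q' : List.In Q' l -> is_ideal Q' by move=> h; apply: idl; right.
have [[c0 Qc0]|h] := pselect (exists c0, Q (u + iota c0 * v)); last first.
  have [c cs hc] := IH s idl'; exists c => // Q' [<- _ Qc|]; last exact: hc.
  by apply: h; exists c.
have [c] := IH (c0 :: s) idl'; rewrite inE negb_or => /andP[cc0 cs] hc.
exists c => // Q' [<- nQ Qc|]; last exact: hc.
have Qv : Q v.
  apply: (@prime_scalar _ (c - c0)) => //; first by rewrite subr_eq0.
  have := idealB idQ Qc Qc0.
  by rewrite opprD addrACA subrr add0r rmorphB mulrBl.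
apply: nQ; split=> //; apply: idealDr Qc => //; exact: idealM.
Qed.

End Generic.

(** * Regular sequences in a regular local ring *)

Section RegularLocal.
Variables (k : fieldType) (R : comPzRingType) (iota : {rmorphism k -> R}).
Hypothesis kinf : infinite_ring k.
Hypotheses (noethR : noetherian R) (locR : is_local R).
Local Notation m := (@nonunits R).

Lemma nonunits_prime : is_prime_ideal m.
Proof.
split=> //; first by apply; exists 1; rewrite mulr1.
move=> a b; have [[c ac]|] := pselect (invertible a); last by left.
have [[d bd]|] := pselect (invertible b); last by right.
by case; exists (c * d); rewrite mulrACA ac bd mulr1.
Qed.

Lemma prime_nonunits P : is_prime_ideal P -> P `<=` m.
Proof.
move=> [idP nP1 _] x Px [y xy]; apply: nP1; rewrite -xy; exact: idealMr.
Qed.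

Definition has_chain_above e (I : set R) := exists2 C, prime_chain e C & I `<=` C 0%N.

Lemma has_chain_drop e I g : is_ideal I -> m g -> has_chain_above e.+1 I ->
  has_chain_above e (idadd I g).
Proof.
move=> idI mg [C [C1 C2] IC].
have CE : forall i, (i <= e)%N ->
    (if (i <= e)%N then C i else m) = C i by move=> i ->.
(* The top of the chain is replaced by [m], which contains [g], so that [chain_drop] applies. *)
have cC : prime_chain e.+1 (fun i => if (i <= e)%N then C i else m).
  apply: prime_chain_rcons.
  - by split=> i ie; [apply: C1 | apply: C2]; apply: leq_trans ie _.
  - exact: nonunits_prime.
  - have [s1 n1] := C2 e (leqnn _).
    have sm := prime_nonunits (C1 e.+1 (leqnn _)).
    by split; [exact: subset_trans sm | move=> h; apply: n1; apply: subset_trans sm h].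
have [|C' [cC' _ C'g C'0]] := chain_drop noethR (a := g) cC; first by rewrite ltnn.
exists C' => //; apply: idadd_min => //; first exact: prime_ideal (cC'.1 0%N _).
exact: subset_trans C'0.
Qed.

Lemma has_chain_adds e I s : is_ideal I -> (forall g, g \in s -> m g) ->
  has_chain_above (size s + e) I -> has_chain_above e (adds I s).
Proof.
elim: s I => [//|g s IH] I idI sm /= h; apply: IH; first exact: idadd_ideal.
  by move=> h' hs; apply: sm; rewrite inE hs orbT.
by apply: has_chain_drop => //; apply: sm; rewrite mem_head.
Qed.

(** Avoidance by generic scalar coefficients, one generator of [s] at a time; since scalars are
    plentiful, arbitrary ideals can be avoided and not only primes. *)
Lemma avoid_primes (l : seq (set R)) g s : (forall Q, List.In Q l -> is_ideal Q) ->
  exists2 g', gens s (g' - g) &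
    forall Q, List.In Q l -> ~ (Q g /\ forall r, r \in s -> Q r) -> ~ Q g'.
Proof.
move=> idl; elim: s g => [|r s IH] g.
  by exists g; [rewrite subrr | move=> Q _ nQ Qg; apply: nQ].
have [c _ hc] := generic_scalar iota kinf [::] g r idl.
have [g' gg' hg'] := IH (g + iota c * r); exists g'.
  by apply/gens_cons; exists (iota c); rewrite -addrA -opprD.
move=> Q Ql nQ; apply: hg' => // -[Qg Qs]; apply: (hc Q Ql) Qg => -[Qg Qr].
by apply: nQ; split=> // r'; rewrite inE => /predU1P[->//|/Qs].
Qed.

(** Regular local rings are domains, relative to [I]. The element [g] is moved modulo [s] to a [g']
    outside every listed prime above [I] that does not contain [m]. By induction [idadd I g'] is
    prime, and it contains one of those primes [Q]. As [g'] is not in [Q], every element of [Q] lies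
    in [I + m Q], and Nakayama gives [Q = I]. *)
Lemma regular_prime I s : is_ideal I -> m = adds I s -> has_chain_above (size s) I ->
  is_prime_ideal I.
Proof.
have pm := nonunits_prime; have idm := prime_ideal pm.
elim: s I => [|g s IH] I idI em hI; first by rewrite -[I]em.
have Im : I `<=` m by rewrite em; apply: adds_sub.
have sm r : r \in g :: s -> m r by rewrite em; apply: adds_gen.
have [l [l1 l2]] := minimal_primes noethR idI.
pose l' := [seq Q <- l | ~~ `[< m `<=` Q >]].
have l'P Q : List.In Q l' <-> List.In Q l /\ ~ m `<=` Q.
  rewrite (List.filter_In _ Q l); split=> -[h1 h2]; split=> //; first exact/asboolPn.
  exact/asboolPn.
have [Q /l'P[/l1[/prime_ideal]]//|g' gg' hg'] := @avoid_primes l' g s.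
have idg' := idadd_ideal g' idI.
have idadds := adds_ideal s idg'.
have em' : m = adds (idadd I g') s.
  have g'm : adds (idadd I g') s g'.
    by apply: adds_sub; apply: idadd_gen.
  have gens_m : gens s `<=` adds (idadd I g') s.
    by apply: gens_min => // r; apply: adds_gen.
  apply/seteqP; split.
    rewrite em /=; apply: adds_min => //; last by move=> r; apply: adds_gen.
    apply: idadd_min => //; first by apply: subset_trans (adds_sub _); apply: idadd_sub.
    by rewrite -(subKr g' g); apply: idealB => //; apply: gens_m.
  apply: adds_min => //; last by move=> r rs; apply: sm; rewrite inE rs orbT.
  apply: idadd_min => //; rewrite -(subrK g g'); apply: idealD => //.
    by apply: gens_min gg' => // r rs; apply: sm; rewrite inE rs orbT.
  by apply: sm; rewrite mem_head.
have mg' : m g' by rewrite em'; apply: adds_sub; apply: idadd_gen.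
have pI' := IH _ idg' em' (has_chain_drop idI mg' hI).
(* The chain above [I] has length at least one, so its bottom is not [m]; this supplies [Q] even
   when [idadd I g'] is already [m]. *)
have [Q [Ql nmQ QI']] : exists Q, [/\ List.In Q l, ~ m `<=` Q & Q `<=` idadd I g'].
  have [C [C1 C2] IC] := hI.
  have [Q Ql QC] := l2 _ (C1 0%N isT) IC.
  have nmC : ~ m `<=` C 0%N.
    have [s1 n1] := C2 0%N isT; move=> h; apply: n1; apply: subset_trans h.
    exact: prime_nonunits (C1 1%N _).
  have [mI'|nmI'] := pselect (m `<=` idadd I g').
    exists Q; split=> //; first by move=> h; apply: nmC; apply: subset_trans h QC.
    by apply: subset_trans mI'; apply: prime_nonunits (l1 _ Ql).1.
  have [Q' Q'l Q'I] := l2 _ pI' (idadd_sub _).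
  by exists Q'; split=> // h; apply: nmI'; apply: subset_trans h Q'I.
have [pQ IQ] := l1 Q Ql.
have nQg' : ~ Q g'.
  apply: hg'; first exact/l'P.
  move=> [Qg Qs]; apply: nmQ; rewrite em; apply: adds_min => //; first exact: prime_ideal.
  by move=> r; rewrite inE => /predU1P[->|/Qs].
suff QI : Q `<=` I by rewrite (_ : I = Q) //; apply/seteqP.
have [t et] := (noetherianP R).1 noethR Q (prime_ideal pQ).
have [r rt|u nu hu] := @local_nakayama R I m t idI pm.
  have Qr : Q r by rewrite et; apply: adds_gen rt; apply: ideal_set0.
  have [c [y [Iy er]]] := QI' r Qr.
  apply: sub_sat => //; rewrite er addrC; apply: idealD; first exact: pcomb_ideal.
    exact: pcomb_sub.
  rewrite mulrC; apply: pcomb_mul => //; rewrite -et.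
  have : Q (g' * c) by rewrite mulrC -[_ * _](addrK y) -er; apply: (idealB (prime_ideal pQ)) => //; apply: IQ.
  by move/(primeM pQ); apply.
move=> x; rewrite et => /hu; have [[v uv]|] := pselect (invertible u); last by move/nu.
by move=> /(idealM idI v); rewrite mulrA [v * u]mulrC uv mul1r.
Qed.

(** After division by [s1] a chain of length [size s2] remains, so [regular_prime] applies to
    [gens s1]. If [g] were redundant, division by [s1] and [s2] alone would leave a chain of length
    one above [m]. *)
Theorem regular_sequence s : m = gens s -> has_chain_above (size s) [set 0] ->
  (forall s1 s2, s = s1 ++ s2 -> is_prime_ideal (gens s1)) /\
  (forall s1 g s2, s = s1 ++ g :: s2 -> ~ gens s1 g).
Proof.
move=> em hs.
have sm g : g \in s -> m g by rewrite em; apply: adds_gen ideal_set0.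
have aux s1 s2 : s = s1 ++ s2 -> has_chain_above (size s2) (gens s1).
  move=> es; apply: has_chain_adds; first exact: ideal_set0.
    by move=> g gs; apply: sm; rewrite es mem_cat gs.
  by rewrite -size_cat -es.
split=> [s1 s2 es|s1 g s2 es s1g].
  by apply: (@regular_prime _ s2); [exact: gens_ideal | rewrite -adds_cat -es | exact: aux].
have := aux s1 (g :: s2) es; rewrite /= -[(size s2).+1]addn1.
move=> /has_chain_adds[||C [C1 C2] h].
- exact: gens_ideal.
- by move=> r rs; apply: sm; rewrite es mem_cat inE rs !orbT.
have [s01 n10] := C2 0%N isT.
apply: n10; apply: subset_trans h; apply: (@subset_trans _ m).
  exact: prime_nonunits (C1 1%N _).
rewrite em es; apply: gens_min; first exact: adds_ideal (gens_ideal _).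
move=> r; rewrite mem_cat inE => /or3P[rs|/eqP->|rs].
- by apply: adds_sub; apply: adds_gen rs; apply: ideal_set0.
- exact: adds_sub.
- by apply: adds_gen rs; apply: gens_ideal.
Qed.

End RegularLocal.

(** * Derivations along towers *)

Section Subrings.
Variable C : idomainType.
Implicit Types (S : set C) (x y c : C) (p q f g : {poly C}).

Definition subring S :=
  [/\ S 1, forall x y, S x -> S y -> S (x - y) & forall x y, S x -> S y -> S (x * y)].

Lemma subring0 S : subring S -> S 0.
Proof. by case=> S1 SB _; rewrite -(subrr 1); apply: SB. Qed.

Lemma subringD S x y : subring S -> S x -> S y -> S (x + y).
Proof.
move=> sS Sx Sy; have [_ SB _] := sS; rewrite -[y]opprK; apply: (SB) => //.
by rewrite -sub0r; apply: SB => //; apply: subring0.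
Qed.

Lemma subring_sum S (T : Type) (l : seq T) (P : pred T) (F : T -> C) : subring S ->
  (forall i, P i -> S (F i)) -> S (\sum_(i <- l | P i) F i).
Proof.
move=> sS h; apply: big_ind => //; first exact: subring0.
by move=> x y; apply: subringD.
Qed.

Lemma subringX S x n : subring S -> S x -> S (x ^+ n).
Proof.
move=> sS Sx; have [S1 _ SM] := sS.
by elim: n => [|n IH]; rewrite ?expr0 ?exprS //; apply: SM.
Qed.

Definition polyS S p := forall i, S p`_i.

Section Poly.
Variables (S : set C) (sS : subring S).

Lemma polySC c : S c -> polyS S c%:P.
Proof. by move=> Sc i; rewrite coefC; case: ifP => // _; apply: subring0. Qed.
Lemma polyS0 : polyS S 0. Proof. by apply: polySC; apply: subring0. Qed.
Lemma polySX : polyS S 'X.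
Proof. by move=> i; rewrite coefX; case: eqP => _; [case: sS | apply: subring0]. Qed.
Lemma polySD p q : polyS S p -> polyS S q -> polyS S (p + q).
Proof. by move=> Sp Sq i; rewrite coefD; apply: subringD. Qed.
Lemma polySB p q : polyS S p -> polyS S q -> polyS S (p - q).
Proof. by move=> Sp Sq i; rewrite coefB; case: sS => _ h _; apply: h. Qed.
Lemma polySM p q : polyS S p -> polyS S q -> polyS S (p * q).
Proof.
move=> Sp Sq i; rewrite coefM; apply: subring_sum => // j _.
by case: sS => _ _; apply.
Qed.
Lemma polySXn n : polyS S 'X^n.
Proof.
by elim: n => [|n IH]; [apply: polySC; case: sS | rewrite exprS; apply: polySM => //; apply: polySX].
Qed.
Lemma polySZ c p : S c -> polyS S p -> polyS S (c *: p).
Proof. by move=> Sc Sp; rewrite -mul_polyC; apply: polySM => //; apply: polySC. Qed.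
Lemma polyS_lead p : polyS S p -> S (lead_coef p). Proof. by apply. Qed.

Lemma polyS_cons p c : polyS S (p * 'X + c%:P) -> polyS S p /\ S c.
Proof.
move=> h; split=> [i|]; first by have := h i.+1; rewrite coefD coefMX coefC addr0.
by have := h 0%N; rewrite coefD coefMX coefC add0r.
Qed.

Lemma polyS_horner p x : S x -> polyS S p -> S p.[x].
Proof.
move=> Sx Sp; rewrite horner_coef; apply: subring_sum => // i _.
by case: (sS) => _ _; apply=> //; apply: subringX.
Qed.

(** Quotient and remainder stay over [S], and the multiplier is an explicit power of the leading
    coefficient, so that it is 1 for a monic divisor. *)
Lemma pseudo_divisionX g f : polyS S g -> g != 0 -> polyS S f ->
  exists n q r, [/\ polyS S q, polyS S r, lead_coef g ^+ n *: f = q * g + r &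
    (size r < size g)%N].
Proof.
move=> Sg g0; have lg0 : lead_coef g != 0 by rewrite lead_coef_eq0.
have [n] := ubnP (size f); elim: n f => // n IH f; rewrite ltnS => fn Sf.
have [fg|gf] := ltnP (size f) (size g).
  by exists 0%N, 0, f; rewrite expr0 scale1r mul0r add0r; split=> //; exact: polyS0.
set d := (size f - size g)%N.
pose t := lead_coef f *: 'X^d.
have St : polyS S t by apply: polySZ; [exact: polyS_lead | exact: polySXn].
pose f1 := lead_coef g *: f - t * g.
have Sf1 : polyS S f1.
  by apply: polySB; [apply: polySZ => //; exact: polyS_lead | exact: polySM].
have [|c [q [r [Sq Sr e sr]]]] := IH f1 _ Sf1.
  apply: leq_trans _ fn; case: (posnP (size f)) => [f0|f0].
    by move: gf; rewrite f0 leqn0 size_poly_eq0 (negPf g0).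
  rewrite -(prednK f0) ltnS; apply/leq_sizeP => j hj.
  rewrite coefB coefZ -scalerAl coefZ coefXnM.
  have [jd|dj] := ltnP j d.
    move: jd; rewrite ltnNge; case/negP.
    apply: leq_trans hj; rewrite -subn1; apply: leq_sub2l.
    by rewrite size_poly_gt0.
  move: hj; rewrite leq_eqVlt => /predU1P[<-|hj].
    have -> : ((size f).-1 - d = (size g).-1)%N.
      have gp : (0 < size g)%N by rewrite size_poly_gt0.
      by rewrite -!subn1 subnAC /d subKn.
    by rewrite -!lead_coefE mulrC subrr.
  rewrite !nth_default ?mulr0 ?subrr //; last by rewrite -(prednK f0).
  rewrite leq_subRL // /d subnK //; by rewrite -(prednK f0).
exists c.+1, (q + lead_coef g ^+ c *: t), r; split=> //.
  apply: polySD => //; apply: polySZ => //; apply: subringX => //; exact: polyS_lead.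
rewrite exprSr -scalerA -(subrK (t * g) (lead_coef g *: f)) scalerDr e mulrDl scalerAl.
by rewrite addrAC.
Qed.

Lemma pseudo_division g f : polyS S g -> g != 0 -> polyS S f ->
  exists c q r, [/\ S c, c != 0, polyS S q, polyS S r &
    c *: f = q * g + r /\ (size r < size g)%N].
Proof.
move=> Sg g0 Sf; have [n [q [r [Sq Sr e sr]]]] := pseudo_divisionX Sg g0 Sf.
exists (lead_coef g ^+ n), q, r; split=> //; last by rewrite expf_neq0 ?lead_coef_eq0.
by apply: subringX => //; exact: polyS_lead.
Qed.

End Poly.

Definition adj S x : set C := [set y | exists2 p, polyS S p & y = p.[x]].

Lemma adj_subring S x : subring S -> subring (adj S x).
Proof.
move=> sS; split.
- by exists 1%:P; [apply: polySC; case: sS | rewrite hornerC].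
- by move=> _ _ [p Sp ->] [q Sq ->]; exists (p - q); [exact: polySB | rewrite !hornerE].
- by move=> _ _ [p Sp ->] [q Sq ->]; exists (p * q); [exact: polySM | rewrite hornerM].
Qed.

Lemma adj_sub S x : subring S -> S `<=` adj S x.
Proof. by move=> sS y Sy; exists y%:P; [exact: polySC | rewrite hornerC]. Qed.

Lemma adj_gen S x : subring S -> adj S x x.
Proof. by move=> sS; exists 'X; [exact: polySX | rewrite hornerX]. Qed.

Lemma adj_min S T x : subring T -> S `<=` T -> T x -> adj S x `<=` T.
Proof.
by move=> sT ST Tx _ [p Sp ->]; apply: polyS_horner => // i; apply: ST.
Qed.

Definition adjs S (l : seq C) := foldl adj S l.

Lemma adjs_subring S l : subring S -> subring (adjs S l).
Proof. by elim: l S => //= x l IH S sS; apply: IH; apply: adj_subring. Qed.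

Lemma adjs_sub S l : subring S -> S `<=` adjs S l.
Proof.
elim: l S => [S _ x //|x l IH S sS /=].
exact: (subset_trans (adj_sub x sS) (IH _ (adj_subring x sS))).
Qed.

Lemma adjs_gen S l x : subring S -> x \in l -> adjs S l x.
Proof.
elim: l S => [//|y l IH] S sS; rewrite inE => /predU1P[->|xl] /=.
  by apply: adjs_sub; [exact: adj_subring | exact: adj_gen].
by apply: IH => //; apply: adj_subring.
Qed.

Lemma adjs_min S T l : subring T -> S `<=` T -> (forall x, x \in l -> T x) ->
  adjs S l `<=` T.
Proof.
move=> sT; elim: l S => [S ST _ x /ST //|y l IH S ST lT /=]; apply: IH.
  by apply: adj_min => //; apply: lT; rewrite mem_head.
by move=> x xl; apply: lT; rewrite inE xl orbT.
Qed.

(** [S] need not be a field: a non-zero relation of least degree replaces the minimal polynomial,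
    and pseudo-division replaces division by it. *)
Lemma min_root S x :
  (forall f, polyS S f -> f.[x] = 0 -> f = 0) \/
  exists f, [/\ polyS S f, f.[x] = 0, f != 0 &
    forall g, polyS S g -> g.[x] = 0 -> (size g < size f)%N -> g = 0].
Proof.
have [[f [Sf fx f0]]|h] := pselect (exists f, [/\ polyS S f, f.[x] = 0 & f != 0]); last first.
  by left=> f Sf fx; apply/eqP; apply: contrapT => /negP f0; apply: h; exists f.
right; pose P n := `[< exists f, [/\ polyS S f, f.[x] = 0, f != 0 & size f = n] >].
have exP : exists n, P n by exists (size f); apply/asboolP; exists f.
case: (ex_minnP exP) => n /asboolP[g [Sg gx g0 <-]] gmin; exists g; split=> // q Sq qx.
rewrite ltnNge; apply: contraNeq => q0; apply: gmin; apply/asboolP; by exists q.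
Qed.

End Subrings.

Section Derivations.
Variables (C F : idomainType) (phi : {rmorphism C -> F}).
Implicit Types (S : set C) (x y c : C) (p q f g : {poly C}) (d : C -> F).

(** A derivation of the subring [S] along [phi], encoded as a function on all of [C] whose values
    outside [S] are unconstrained; this makes extending it a matter of enlarging [S]. *)
Definition deriv_on S d :=
  (forall x y, S x -> S y -> d (x + y) = d x + d y) /\
  (forall x y, S x -> S y -> d (x * y) = phi x * d y + phi y * d x).

Section Basic.
Variables (S : set C) (d : C -> F).
Hypotheses (sS : subring S) (dd : deriv_on S d).

Lemma deriv_on0 : d 0 = 0.
Proof.
have [dD _] := dd; have S0 := subring0 sS.
by apply: (addrI (d 0)); rewrite -dD // !addr0.
Qed.

Lemma deriv_on1 : d 1 = 0.
Proof.
have [_ dM] := dd; have [S1 _ _] := sS.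
by apply: (addrI (d 1)); rewrite addr0 -[RHS](congr1 d (mulr1 1)) dM // rmorph1 mul1r.
Qed.

Lemma deriv_onB x y : S x -> S y -> d (x - y) = d x - d y.
Proof.
move=> Sx Sy; have [dD _] := dd; have [_ SB _] := sS.
by apply: (addIr (d y)); rewrite -dD ?subrK //; apply: SB.
Qed.

Lemma deriv_onX x n : S x -> d (x ^+ n) = (phi x ^+ n.-1 * d x) *+ n.
Proof.
move=> Sx; have [_ dM] := dd; elim: n => [|n IH]; first by rewrite expr0 deriv_on1 mulr0n.
rewrite exprS dM //; last exact: subringX.
rewrite IH /= rmorphXn mulrS addrC; congr (_ + _).
by case: n {IH} => [|n]; rewrite ?mulr0n ?mulr0 //= mulrnAr mulrA -exprS.
Qed.

Lemma deriv_on_sum (T : Type) (l : seq T) (P : pred T) (G : T -> C) :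
  (forall i, P i -> S (G i)) -> d (\sum_(i <- l | P i) G i) = \sum_(i <- l | P i) d (G i).
Proof.
move=> SG; elim: l => [|a l IH]; first by rewrite !big_nil deriv_on0.
rewrite !big_cons; case: ifP => // Pa; rewrite dd.1 ?IH //; first exact: SG.
exact: subring_sum.
Qed.

Variables (x : C) (w : F).

(* The value forced on [p.[x]] by extending [d] with [x |-> w]. *)
Definition tot p := (map_poly d p).[phi x] + phi p^`().[x] * w.

Lemma map_derivD p q : polyS S p -> polyS S q ->
  map_poly d (p + q) = map_poly d p + map_poly d q.
Proof.
move=> Sp Sq; apply/polyP => i.
by rewrite coefD !coef_map_id0 ?deriv_on0 // coefD dd.1.
Qed.

Lemma totD p q : polyS S p -> polyS S q -> tot (p + q) = tot p + tot q.
Proof.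
move=> Sp Sq; rewrite /tot map_derivD // derivD !hornerD rmorphD mulrDl.
by rewrite addrACA.
Qed.

Lemma totC c : tot c%:P = d c.
Proof. rewrite /tot (_ : map_poly d c%:P = (d c)%:P).
  by rewrite hornerC derivC horner0 rmorph0 mul0r addr0.
by apply/polyP => i; rewrite coef_map_id0 ?deriv_on0 // !coefC; case: ifP; rewrite ?deriv_on0.
Qed.

Lemma totMX p : polyS S p -> tot (p * 'X) = phi x * tot p + phi p.[x] * w.
Proof.
move=> Sp; rewrite /tot.
have -> : map_poly d (p * 'X) = map_poly d p * 'X.
  apply/polyP => i; rewrite coefMX !coef_map_id0 ?deriv_on0 // coefMX.
  by case: eqP => _; rewrite ?deriv_on0.
rewrite derivM derivX mulr1 !hornerE rmorphD rmorphM /=; ring.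
Qed.

Lemma totCM c p : S c -> polyS S p -> tot (c%:P * p) = phi c * tot p + phi p.[x] * d c.
Proof.
move=> Sc; elim/poly_ind: p => [|p e IH].
  by move=> _; rewrite mulr0 totC deriv_on0 horner0 rmorph0 mul0r mulr0 addr0.
move=> /polyS_cons[Sp Se]; have SpX : polyS S (p * 'X) by apply: polySM => //; apply: polySX.
rewrite mulrDr -polyCM mulrA !totD //.
- rewrite !totC !totMX ?IH //; last by apply: polySM => //; apply: polySC.
  rewrite dd.2 // !hornerE !rmorphD !rmorphM /=; ring.
- exact: polySC.
- by rewrite -mulrA; apply: polySM => //; apply: polySC.
- by apply: polySC => //; case: sS => _ _; apply.
Qed.

Lemma totM p q : polyS S p -> polyS S q ->
  tot (p * q) = phi p.[x] * tot q + phi q.[x] * tot p.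
Proof.
move=> Sp0 Sq; elim/poly_ind: p Sp0 => [|p e IH].
  move=> _; rewrite mul0r totC deriv_on0 horner0 rmorph0 mul0r mulr0.
  by rewrite addr0.
move=> /polyS_cons[Sp Se]; have SpX : polyS S (p * 'X) by apply: polySM => //; apply: polySX.
rewrite mulrDl mulrAC !totD //.
- rewrite totC totCM // !totMX ?IH //; last exact: polySM.
  rewrite !hornerE !rmorphD !rmorphM /=; ring.
- exact: polySC.
- by apply: polySM => //; [exact: polySM | exact: polySX].
- by apply: polySM => //; apply: polySC.
Qed.

(** The value at [p.[x]] is [tot p], and the hypothesis says exactly that it does not depend on the
    choice of [p]. *)
Lemma ext_deriv : (forall p, polyS S p -> p.[x] = 0 -> tot p = 0) ->
  exists d', [/\ deriv_on (adj S x) d', forall y, S y -> d' y = d y & d' x = w].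
Proof.
move=> wd.
pose d' y := tot (xget 0 [set p | polyS S p /\ y = p.[x]]).
have d'E p : polyS S p -> d' p.[x] = tot p.
  move=> Sp; rewrite /d'; case: xgetP => [q _ [Sq e]|/(_ p)[]//].
  rewrite -[q](subrK p) totD //; last exact: polySB.
  by rewrite wd ?add0r //; [exact: polySB | rewrite !hornerE e subrr].
exists d'; split; first split.
- by move=> _ _ [p Sp ->] [q Sq ->]; rewrite -hornerD !d'E // ?totD //; apply: polySD.
- by move=> _ _ [p Sp ->] [q Sq ->]; rewrite -hornerM !d'E // ?totM //; apply: polySM.
- by move=> y Sy; rewrite -[y in LHS](hornerC y x) d'E ?totC //; apply: polySC.
rewrite -[x in LHS](hornerX x) d'E; last exact: polySX.
rewrite -[X in tot X]mul1r totMX; last by apply: polySC; case: sS.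
by rewrite totC deriv_on1 mulr0 add0r hornerC rmorph1 mul1r.
Qed.

(** Only the least relation has to be checked: pseudo-division gives [c p = q f], and applying [tot]
    leaves [phi c * tot p = 0], where [phi c] is non-zero. *)
Lemma tot_min_root f : polyS S f -> f.[x] = 0 -> f != 0 ->
    (forall g, polyS S g -> g.[x] = 0 -> (size g < size f)%N -> g = 0) ->
    injective phi -> tot f = 0 -> forall p, polyS S p -> p.[x] = 0 -> tot p = 0.
Proof.
move=> Sf fx f0 fmin phi_inj tf p Sp px.
have [c [q [r [Sc c0 Sq Sr [e sr]]]]] := pseudo_division sS Sf f0 Sp.
have r0 : r = 0.
  apply: fmin => //; have := congr1 (horner^~ x) e.
  by rewrite /= hornerZ px mulr0 hornerD hornerM fx mulr0 add0r => <-.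
have := congr1 tot e; rewrite r0 addr0 -mul_polyC totCM // totM // tf fx px.
rewrite rmorph0 !mul0r mulr0 !addr0 => /eqP; rewrite mulf_eq0 => /orP[|/eqP//].
by rewrite -(rmorph0 phi) (inj_eq phi_inj) (negPf c0).
Qed.

End Basic.

Lemma deriv_horner S d x p : subring S -> deriv_on S d -> S x -> polyS S p ->
  d p.[x] = tot d x (d x) p.
Proof.
move=> sS dd Sx; elim/poly_ind: p => [|p c IH].
  by move=> _; rewrite (totC sS dd) horner0.
move=> /polyS_cons[Sp Sc]; have Spx := polyS_horner sS Sx Sp.
rewrite hornerD hornerM hornerX hornerC dd.1 ?dd.2 //; last by case: sS => _ _; apply.
rewrite (totD sS dd) ?(totMX sS dd) ?(totC sS dd) //; last exact: polySC.
  by rewrite IH //; ring.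
by apply: polySM => //; apply: polySX.
Qed.

Lemma deriv_on_sub S T d : S `<=` T -> deriv_on T d -> deriv_on S d.
Proof. by move=> ST [dD dM]; split=> x y /ST Tx /ST Ty; [apply: dD | apply: dM]. Qed.

End Derivations.

Section Tower.
Variables (C : idomainType) (K : fieldType) (j : {rmorphism C -> K}).
Hypothesis j_inj : injective j.
Implicit Types (S : set C) (x y c : C).

(** Separable algebraicity over [S], generically: the second clause says that relative differentials
    vanish where [h] does not, and the third that every element of the tower is algebraic over
    [S]. *)
Definition adjs_separable S (l : seq C) := exists h, [/\ h != 0,
    (forall (F : fieldType) (phi : {rmorphism C -> F}) (d : C -> F),
      deriv_on phi setT d -> (forall y, S y -> d y = 0) -> phi h != 0 ->
      forall y, adjs S l y -> d y = 0) &
    (forall y, adjs S l y -> y != 0 -> exists z, S (y * z) /\ y * z != 0)].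

(* Either some generator is not separable over the previous ones, which gives a
   derivation, or the product [h] of the derivatives of their minimal polynomials
   kills all differentials. *)
Lemma separable_tower S (l : seq C) : subring S ->
  (exists d : C -> K, [/\ deriv_on j (adjs S l) d, forall y, S y -> d y = 0 &
    exists2 y, adjs S l y & d y != 0]) \/ adjs_separable S l.
Proof.
move=> sS; elim/last_ind: l => [|l x IH].
  right; exists 1; split; first exact: oner_neq0.
    by move=> F phi d _ dS _ y; apply: dS.
  by move=> y Sy y0; exists 1; rewrite mulr1.
have adjsE : adjs S (rcons l x) = adj (adjs S l) x by rewrite /adjs foldl_rcons.
set T := adjs S l in IH *; have sT : subring T by apply: adjs_subring.
have ST : S `<=` T by apply: adjs_sub.
have d0 : deriv_on j T (fun=> 0) by split=> *; rewrite ?mulr0 ?addr0.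
have map0 (p : {poly C}) : map_poly (fun=> 0 : K) p = 0.
  by apply/polyP => i; rewrite coef_map_id0 // coef0.
have left1 : (forall p, polyS T p -> p.[x] = 0 -> tot j (fun=> 0) x 1 p = 0) ->
    exists d : C -> K, [/\ deriv_on j (adjs S (rcons l x)) d, forall y, S y -> d y = 0 &
    exists2 y, adjs S (rcons l x) y & d y != 0].
  move=> /(ext_deriv sT d0)[d [dd dT dx]]; exists d; rewrite adjsE; split=> //.
    by move=> y /ST/dT.
  by exists x; [exact: adj_gen | rewrite dx oner_neq0].
have [fmin|[f [Tf fx f0 fmin]]] := min_root T x.
  by left; apply: left1 => p Tp /fmin->//; rewrite (totC sT d0).
have [f'0|f'0] := eqVneq f^`().[x] 0.
  left; apply: left1; apply: tot_min_root fmin _ _ => //.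
  by rewrite /tot map0 horner0 f'0 rmorph0 mul0r addr0.
have jf'0 : j f^`().[x] != 0 by rewrite -(rmorph0 j) (inj_eq j_inj).
case: IH => [[d [dd dS [y Ty dy]]]|[h [h0 hF hS]]].
  (* The derivation extends from [T] with the one value at [x] that the separable relation [f]
     allows. *)
  left; pose w := - (map_poly d f).[j x] / j f^`().[x].
  have tf : tot j d x w f = 0 by rewrite /tot /w mulrC divfK // subrr.
  have [d' [dd' d'T _]] := ext_deriv sT dd (tot_min_root sT dd Tf fx f0 fmin j_inj tf).
  exists d'; rewrite adjsE; split=> //; first by move=> z Sz; rewrite d'T ?dS //; apply: ST.
  by exists y; [exact: adj_sub | rewrite d'T].
right; exists (h * f^`().[x]); split; first by rewrite mulf_neq0.
  move=> F phi d dd dS; rewrite rmorphM mulf_eq0 negb_or => /andP[h0' f'0'] y.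
  have dT := hF F phi d dd dS h0'.
  have sTT : subring (@setT C) by split.
  have map_d0 p : polyS T p -> (map_poly d p).[phi x] = 0.
    move=> Tp; suff -> : map_poly d p = 0 by rewrite horner0.
    by apply/polyP => i; rewrite coef_map_id0 ?(deriv_on0 sTT dd) // coef0 (dT _ (Tp i)).
  have dx : d x = 0.
    have := deriv_horner (p := f) sTT dd (I : setT x) (fun=> I).
    rewrite fx (deriv_on0 sTT dd) /tot map_d0 // add0r => /esym/eqP.
    by rewrite mulf_eq0 (negPf f'0') => /eqP.
  rewrite adjsE => -[p Tp ->].
  by rewrite (deriv_horner (p := p) sTT dd (I : setT x) (fun=> I)) /tot map_d0 // dx mulr0 addr0.
rewrite adjsE => _ [p Tp ->] p0.
suff [z [Tz z0]] : exists z, T (p.[x] * z) /\ p.[x] * z != 0.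
  by have [z' []] := hS _ Tz z0; rewrite -mulrA; exists (z * z').
(* Among the polynomials over [T] whose value at [x] is a non-zero multiple of [p.[x]], one of least
   degree is constant. Otherwise dividing [f] by it gives [c f = a q], with [a.[x] = 0] and [a] of
   smaller degree than [f]. *)
pose Q n := `[< exists q, [/\ polyS T q, size q = n, q.[x] != 0 & exists z, q.[x] = p.[x] * z] >].
have exQ : exists n, Q n.
  by exists (size p); apply/asboolP; exists p; split=> //; exists 1; rewrite mulr1.
case: (ex_minnP exQ) => n /asboolP[q [Tq <- qx [z ez]]] qmin.
have q0 : q != 0 by apply: contraNneq qx => ->; rewrite horner0.
have [/size1_polyC e|sq] := leqP (size q) 1.
  by exists z; rewrite -ez; split=> //; rewrite e hornerC; apply: Tq.
have [c [a [r [Tc c0 Ta Tr [e sr]]]]] := pseudo_division sT Tq q0 Tf.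
have ex' : r.[x] = - a.[x] * q.[x].
  have := congr1 (horner^~ x) e; rewrite /= hornerZ fx mulr0 hornerD hornerM.
  by move/esym/eqP; rewrite addrC addr_eq0 mulNr => /eqP.
have rx : r.[x] = 0.
  apply: contrapT => /eqP rx; have : (size q <= size r)%N.
    apply: qmin; apply/asboolP; exists r; split=> //.
    by exists (- a.[x] * z); rewrite ex' ez mulrCA.
  by rewrite leqNgt sr.
have sqf : (size q < size f)%N.
  have [c' [a' [r' [Tc' c'0 Ta' Tr' [e' sr']]]]] := pseudo_division sT Tf f0 Tq.
  apply: leq_ltn_trans sr'; apply: qmin; apply/asboolP; exists r'.
  have er' : r'.[x] = c' * q.[x].
    have := congr1 (horner^~ x) e'; rewrite /= hornerZ => ->.
    by rewrite hornerD hornerM fx mulr0 add0r.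
  split=> //; first by rewrite er' mulf_neq0.
  by exists (c' * z); rewrite er' ez mulrCA.
have r0 : r = 0 by apply: fmin => //; apply: ltn_trans sr sqf.
have ax : a.[x] = 0.
  by apply/eqP; move: ex' => /esym/eqP; rewrite rx mulf_eq0 oppr_eq0 (negPf qx) orbF.
move: e; rewrite r0 addr0 => e.
have a0 : a != 0.
  apply: contraNneq f0 => a0; have /eqP := congr1 lead_coef e.
  by rewrite a0 mul0r lead_coefZ lead_coef0 mulf_eq0 (negPf c0) lead_coef_eq0.
case/eqP: (a0); apply: fmin => //.
have := congr1 (fun p : {poly C} => size p) e; rewrite /= size_scale // size_mul // => ->.
by rewrite -subn1 -addnBA ?(ltnW sq) // -[X in (X < _)%N]addn0 ltn_add2l subn_gt0.
Qed.

End Tower.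

(** * Separability and derivations of the base field *)

Lemma exprpB (R : comNzRingType) p (pR : p \in [pchar R]) (x y : R) :
  (x - y) ^+ p = x ^+ p - y ^+ p.
Proof. exact: (pFrobenius_autB_comm pR (mulrC x y)). Qed.

Lemma exprpD (R : comNzRingType) p (pR : p \in [pchar R]) (x y : R) :
  (x + y) ^+ p = x ^+ p + y ^+ p.
Proof. exact: (pFrobenius_autD_comm pR (mulrC x y)). Qed.

Lemma subring_setT (C : idomainType) : subring [set: C].
Proof. by split. Qed.

Lemma subring_range (k C : idomainType) (f : {rmorphism k -> C}) : subring (range f).
Proof.
split; first by exists 1 => //; exact: rmorph1.
  by move=> _ _ [c _ <-] [d _ <-]; exists (c - d) => //; rewrite rmorphB.
by move=> _ _ [c _ <-] [d _ <-]; exists (c * d) => //; rewrite rmorphM.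
Qed.

(** * Derivations of an imperfect field *)

Section FrobeniusDerivations.
Variables (k : fieldType) (p : nat).
Hypothesis pk : p \in [pchar k].

Let p_pr : prime p := pcharf_prime pk.

Definition pth_powers : set k := [set y | exists x, y = x ^+ p].

Lemma pth_powers_subring : subring pth_powers.
Proof.
split; first by exists 1; rewrite expr1n.
  by move=> _ _ [x ->] [y ->]; exists (x - y); rewrite (exprpB pk).
by move=> _ _ [x ->] [y ->]; exists (x * y); rewrite exprMn.
Qed.

Definition partial_deriv (S : set k) (d : k -> k) :=
  [/\ subring S, pth_powers `<=` S, deriv_on idfun S d & forall x, pth_powers x -> d x = 0].

(** A least relation divides [('X - x%:P) ^+ p] if it is smaller, so it is a scalar times
    [('X - x%:P) ^+ n] with [0 < n < p]. For [n > 1] its derivative is a smaller non-zero relation.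
    For [n = 1], [x] is a quotient of elements of [S]; then [S] contains [x], because a subring
    containing the p-th powers is closed under inverses. *)
Lemma minroot_pth (S : set k) x : subring S -> pth_powers `<=` S -> ~ S x ->
  forall g, polyS S g -> g.[x] = 0 -> (size g < size ('X^p - (x ^+ p)%:P)%R)%N -> g = 0.
Proof.
move=> sS pS nSx; set f := _ - _; have f0 : f != 0 by rewrite -size_poly_gt0 /f size_XnsubC ?(prime_gt0 p_pr).
have Sf : polyS S f.
  by apply: polySB => //; [exact: polySXn | apply: polySC => //; apply: pS; exists x].
have fE : f = ('X - x%:P) ^+ p.
  have pP : p \in [pchar {poly k}] by rewrite pchar_poly.
  by rewrite /f (exprpB pP) polyC_exp.
have [all0|[h [Sh hx h0 hmin]]] := min_root S x; first by move=> g Sg gx _; apply: all0.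
have [fh|hf] := leqP (size f) (size h).
  by move=> g Sg gx sg; apply: hmin => //; apply: leq_trans sg fh.
case: nSx; have [c [q [r [Sc c0 Sq Sr [e sr]]]]] := pseudo_division sS Sh h0 Sf.
have fx : f.[x] = 0 by rewrite /f !hornerE subrr.
have r0 : r = 0.
  apply: hmin => //; have := congr1 (horner^~ x) e.
  by rewrite /= hornerZ fx mulr0 hornerD hornerM hx mulr0 add0r => <-.
have hdvd : h %| ('X - x%:P) ^+ p.
  rewrite -fE -(dvdpZr _ _ c0) e r0 addr0; exact: dvdp_mull.
have [n np /eqpP[[u v] /= /andP[u0 v0] euv]] := dvdp_exp_XsubCP hdvd.
have {}np : (n < p)%N.
  move: hf; rewrite /f size_XnsubC ?(prime_gt0 p_pr) // ltnS.
  have := congr1 (fun q : {poly k} => size q) euv; rewrite /= !size_scale // => ->.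
  by rewrite size_exp_XsubC.
have n0 : (0 < n)%N.
  case: n euv {np} => // /(congr1 (horner^~ x)); rewrite /= !hornerZ hx mulr0 expr0 hornerC mulr1.
  by move=> e0; rewrite -e0 eqxx in v0.
have n1 : n = 1%N.
  apply/eqP; rewrite eqn_leq n0 andbT leqNgt; apply/negP => n2.
  have := congr1 (fun q : {poly k} => q^`()) euv.
  rewrite /= !derivZ deriv_exp derivXsubC mul1r.
  have -> : h^`() = 0.
    apply: hmin; last by rewrite lt_size_deriv.
      by move=> i; rewrite coef_deriv -mulr_natr; case: (sS) => S1 _ SM; apply: SM => //;
         elim: (i.+1) => [|m IH]; rewrite ?mulrS ?mulr0n; [exact: subring0 | exact: subringD].
    have := congr1 (fun q : {poly k} => q^`().[x]) euv.
    rewrite /= !derivZ !hornerZ deriv_exp derivXsubC mul1r hornerMn horner_exp.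
    rewrite hornerXsubC subrr expr0n -subn1 subn_eq0 leqNgt n2 mul0rn mulr0 => /eqP.
    by rewrite mulf_eq0 (negPf u0) => /eqP.
  rewrite scaler0 => /esym/eqP; rewrite -mulr_natl -size_poly_eq0 size_scale //.
  rewrite -polyC_natr mul_polyC size_scale ?size_exp_XsubC //.
  by rewrite -(dvdn_pcharf pk) gtnNdvd.
move: euv; rewrite n1 expr1 => euv.
have h1 : h`_1 = v / u.
  have := congr1 (fun q : {poly k} => q`_1) euv; rewrite /= !coefZ coefB coefX coefC subr0 mulr1.
  by move=> <-; rewrite mulrC mulKf.
have h00 : h`_0 = - x * (v / u).
  have := congr1 (fun q : {poly k} => q`_0) euv; rewrite /= !coefZ coefB coefX coefC sub0r => e0.
  by apply: (mulfI u0); rewrite e0; field.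
have w0 : v / u != 0 by rewrite mulf_neq0 ?invr_eq0.
have Sw : S (v / u) by rewrite -h1.
have -> : x = - (h`_0 * ((v / u) ^+ p.-1 * (v / u)^-1 ^+ p)).
  rewrite h00 -{2}(prednK (prime_gt0 p_pr)) exprSr [_ ^+ _ * (_ * _)]mulrA -exprMn.
  by rewrite divff // expr1n mul1r -mulrA divff // mulr1 opprK.
have [_ SB SM] := sS; rewrite -sub0r; apply: (SB); first exact: subring0.
apply: (SM) => //; apply: (SM); first exact: subringX.
by apply: pS; exists (v / u)^-1.
Qed.

(** The least relation ['X^p - x ^+ p] has derivative zero and a constant term killed by [d], so the
    value at [x] is free. *)
Lemma partial_deriv_ext S d x w : partial_deriv S d -> ~ S x ->
  exists d', [/\ partial_deriv (adj S x) d', forall y, S y -> d' y = d y & d' x = w].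
Proof.
move=> [sS pS dd dp] nSx.
set f := 'X^p - (x ^+ p)%:P; have f0 : f != 0 by rewrite -size_poly_gt0 /f size_XnsubC ?(prime_gt0 p_pr).
have Sxp : S (x ^+ p) by apply: pS; exists x.
have Sf : polyS S f by apply: polySB => //; [exact: polySXn | exact: polySC].
have fx : f.[x] = 0 by rewrite /f !hornerE subrr.
have tf : tot idfun d x w f = 0.
  rewrite /tot /f derivB derivXn derivC subr0 hornerMn (mulrn_pchar pk) rmorph0 mul0r addr0.
  rewrite (_ : map_poly d _ = 0) ?horner0 //; apply/polyP => i.
  rewrite coef_map_id0 ?(deriv_on0 sS dd) // coefB coefXn coefC coef0.
  rewrite (deriv_onB sS dd); last by case: ifP => // _; apply: subring0.
    have -> : d (i == p)%:R = 0.
      by case: eqP => _; rewrite ?(deriv_on1 sS dd) ?(deriv_on0 sS dd).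
    by case: ifP => _; rewrite ?(deriv_on0 sS dd) ?subr0 // dp ?subr0 //; exists x.
  by case: eqP => _; [case: sS | exact: subring0].
have [d' [dd' d'S d'x]] := ext_deriv sS dd
  (tot_min_root sS dd Sf fx f0 (minroot_pth sS pS nSx) (@inj_id k) tf).
exists d'; split=> //; split=> //.
- exact: adj_subring.
- by apply: subset_trans pS _; apply: adj_sub.
- by move=> y py; rewrite d'S ?dp //; apply: pS.
Qed.

(** Zorn's lemma on partial derivations with value 1 at [lam], ordered by extension; by
    [partial_deriv_ext] a maximal one is defined everywhere. *)
Lemma pth_power_deriv lam : ~ pth_powers lam ->
  exists2 D : k -> k, deriv_on idfun setT D & D lam != 0.
Proof.
move=> nlam; have p0 : partial_deriv pth_powers (fun=> 0).
  split=> //; first exact: pth_powers_subring.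
  by split=> *; rewrite ?mulr0 ?addr0.
have [d0 [pd0 _ d0lam]] := partial_deriv_ext 1 p0 nlam.
set S0 := adj _ _ in pd0.
have S0lam : S0 lam by apply: adj_gen; apply: pth_powers_subring.
pose T := {z : set k * (k -> k) | partial_deriv z.1 z.2 /\ (z.1 lam /\ z.2 lam = 1)}.
pose t0 : T := exist _ (S0, d0) (conj pd0 (conj S0lam d0lam)).
pose R (s t : T) : bool := `[< (sval s).1 `<=` (sval t).1 /\
   forall x, (sval s).1 x -> (sval t).2 x = (sval s).2 x >].
have [|r s t /asboolP[h1 h2] /asboolP[h3 h4]|A totA|[[S d] [pd [Slam dlam]]] /= maxS] :=
    @ZL_preorder T t0 R.
- by move=> t; apply/asboolP; split.
- apply/asboolP; split; first exact: subset_trans h3.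
  by move=> x rx; rewrite h4 ?h2 //; apply: h1.
- have [[a0 Aa0]|nA] := pselect (exists a, A a); last first.
    by exists t0 => s As; case: nA; exists s.
  pose U : set k := [set x | exists2 a, A a & (sval a).1 x].
  have ex x : exists y, forall a, A a -> (sval a).1 x -> (sval a).2 x = y.
    have [[a Aa ax]|nx] := pselect (U x); last first.
      by exists 0 => a Aa ax; case: nx; exists a.
    exists ((sval a).2 x) => b Ab bx.
    by have [/asboolP[_ ->]|/asboolP[_ ->]] := totA _ _ Aa Ab.
  pose d x := sval (cid (ex x)).
  have dE a x : A a -> (sval a).1 x -> d x = (sval a).2 x.
    by move=> Aa ax; rewrite /d; case: cid => y /= /(_ a Aa ax).
  have two x y : U x -> U y -> exists2 a, A a & (sval a).1 x /\ (sval a).1 y.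
    move=> [a Aa ax] [b Ab bye].
    have [/asboolP[ab _]|/asboolP[ba _]] := totA _ _ Aa Ab.
      by exists b => //; split=> //; apply: ab.
    by exists a => //; split=> //; apply: ba.
  have sU : subring U.
    split.
    - by exists a0 => //; have [[[]]] := svalP a0.
    - move=> x y Ux Uy; have [a Aa [ax ay]] := two x y Ux Uy; exists a => //.
      by have [[[_ SB _]] _ _ _ _] := svalP a; apply: SB.
    - move=> x y Ux Uy; have [a Aa [ax ay]] := two x y Ux Uy; exists a => //.
      by have [[[_ _ SM]] _ _ _ _] := svalP a; apply: SM.
  have pU : pth_powers `<=` U.
    by move=> x px; exists a0 => //; have [[_ pS _ _] _] := svalP a0; apply: pS.
  have pd : partial_deriv U d.
    split=> //; first split.
    - move=> x y Ux Uy; have [a Aa [ax ay]] := two x y Ux Uy.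
      have [[sS _ [dD _] _] _] := svalP a.
      by rewrite !(dE a) //; [rewrite dD | exact: subringD].
    - move=> x y Ux Uy; have [a Aa [ax ay]] := two x y Ux Uy.
      have [[sS _ [_ dM] _] _] := svalP a.
      by rewrite !(dE a) //; [rewrite dM | case: sS => _ _; apply].
    - move=> x px; have [[_ pS _ dp] _] := svalP a0.
      by rewrite (dE a0) ?dp //; apply: pS.
  have [_ [a0lam d0l]] := svalP a0.
  have Ul : U lam /\ d lam = 1 by split; [exists a0 | rewrite (dE a0)].
  exists (exist _ (U, d) (conj pd Ul)) => s As; apply/asboolP; split=> /=.
    by move=> x sx; exists s.
  by move=> x sx; rewrite (dE s).
have ST : S = setT.
  apply/seteqP; split=> // x _; apply: contrapT => nSx.
  have [d' [pd' d'S _]] := partial_deriv_ext 0 pd nSx.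
  have [sS _ _ _] := pd.
  have S'lam : adj S x lam /\ d' lam = 1 by split; [exact: adj_sub | rewrite d'S].
  pose t : T := exist _ (adj S x, d') (conj pd' S'lam).
  have /maxS/asboolP[/= h _] : R (exist _ (S, d) (conj pd (conj Slam dlam))) t.
    by apply/asboolP; split=> //=; exact: adj_sub.
  by apply/nSx/h; apply: adj_gen.
exists d; first by have [_ _ + _] := pd; rewrite ST.
by move: (dlam) => /= ->; rewrite oner_neq0.
Qed.

End FrobeniusDerivations.

(** * Mac Lane's criterion and separable extensions *)

Section FrobeniusIndependence.
Variables (k : fieldType) (p : nat).
Hypothesis pk : p \in [pchar k].

(* Mac Lane's criterion for separability. *)
Definition frobenius_free (C : idomainType) (iota : {rmorphism k -> C}) :=
  forall (I : finType) (e : I -> C) (lam : I -> k),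
    \sum_i iota (lam i) * e i ^+ p = 0 -> (exists i, lam i != 0) ->
  exists mu : I -> k, [/\ exists i, mu i != 0, forall i, mu i != 0 -> lam i != 0 &
    \sum_i iota (mu i) * e i = 0].

Lemma pchar_eq0F : (p == 0)%N = false.
Proof. by rewrite gtn_eqF // prime_gt0 // (pcharf_prime pk). Qed.

Lemma pchar_alg (C : nzRingType) (iota : {rmorphism k -> C}) : p \in [pchar C].
Proof. exact: rmorph_pchar iota _ pk. Qed.

(** With p-th roots of its coefficients, the relation is a p-th power in a domain. *)
Lemma perfect_frobenius_free (C : idomainType) (iota : {rmorphism k -> C}) :
  (forall c : k, pth_powers p c) -> frobenius_free iota.
Proof.
move=> perf I e lam e0 [i0 li0]; pose mu i := sval (cid (perf (lam i))).
have muE i : lam i = mu i ^+ p by rewrite /mu; case: cid.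
exists mu; split.
- by exists i0; move: li0; rewrite muE; apply: contraNneq => ->; rewrite expr0n pchar_eq0F eqxx.
- by move=> i; apply: contraNneq; rewrite muE => /eqP; rewrite expf_eq0 => /andP[_].
have pC := pchar_alg iota.
suff : (\sum_i iota (mu i) * e i) ^+ p = 0.
  by move/eqP; rewrite expf_eq0 => /andP[_ /eqP].
rewrite -[RHS]e0.
have sumX (l : seq I) : (\sum_(i <- l) iota (mu i) * e i) ^+ p = \sum_(i <- l) (iota (mu i) * e i) ^+ p.
  elim: l => [|i l IH]; last by rewrite !big_cons (exprpD pC) IH.
  by rewrite !big_nil expr0n pchar_eq0F.
by rewrite sumX; apply: eq_bigr => i _; rewrite exprMn -rmorphXn -muE.
Qed.

(** The power of [h] absorbs denominators. [h] is fixed while [N] may depend on [D], which lets one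
    [h] serve all derivations after passing from an open subset to [C]. *)
Definition derivations_lift (C : idomainType) (iota : {rmorphism k -> C}) (h : C) :=
  h != 0 /\ forall D : k -> k, deriv_on idfun setT D ->
    exists N (E : C -> C), deriv_on idfun setT E /\ forall c, E (iota c) = h ^+ N * iota (D c).

Lemma deriv_pth (C F : idomainType) (phi : {rmorphism C -> F}) (d : C -> F) x :
  p \in [pchar F] -> deriv_on phi setT d -> d (x ^+ p) = 0.
Proof.
by move=> pF dd; rewrite (deriv_onX (subring_setT C) dd) // -mulr_natl (pcharf0 pF) mul0r.
Qed.

(** Induction on the support of [lam], scaled to have a coefficient 1. If all coefficients are p-th
    powers, a p-th root is taken. Otherwise some [D] is non-zero on one of them; its lift kills
    every [e i ^+ p], so the [D (lam i)] form a non-trivial relation, of smaller support since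
    [D 1 = 0]. *)
Lemma lift_frobenius_free (C : idomainType) (iota : {rmorphism k -> C}) h :
  derivations_lift iota h -> frobenius_free iota.
Proof.
move=> [h0 lift] I e lam; have pC := pchar_alg iota.
have [n] := ubnP #|[pred i | lam i != 0]|; elim: n lam => // n IH lam; rewrite ltnS => cardn.
move=> e0 [i0 li0]; pose lam' i := lam i / lam i0.
have lam'0 i : (lam' i != 0) = (lam i != 0) by rewrite mulf_eq0 invr_eq0 (negPf li0) orbF.
have e0' : \sum_i iota (lam' i) * e i ^+ p = 0.
  apply: (@mulfI _ (iota (lam i0))); first by rewrite fmorph_eq0.
  rewrite mulr0 -[RHS]e0 mulr_sumr; apply: eq_bigr => i _.
  by rewrite /lam' mulrA -rmorphM [_ * (_ / _)]mulrC divfK.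
have [perf|nperf] := pselect (forall i, pth_powers p (lam' i)).
  pose mu i := sval (cid (perf i)); have muE i : lam' i = mu i ^+ p by rewrite /mu; case: cid.
  exists mu; split.
  - exists i0; move: li0; rewrite -lam'0 muE; apply: contraNneq => ->.
    by rewrite expr0n pchar_eq0F.
  - move=> i; rewrite -lam'0 muE; apply: contraNneq => /eqP.
    by rewrite expf_eq0 => /andP[_].
  suff : (\sum_i iota (mu i) * e i) ^+ p = 0.
    by move/eqP; rewrite expf_eq0 => /andP[_ /eqP].
  rewrite -[RHS]e0'.
  have sumX (l : seq I) : (\sum_(i <- l) iota (mu i) * e i) ^+ p =
      \sum_(i <- l) (iota (mu i) * e i) ^+ p.
    elim: l => [|i l IHl]; last by rewrite !big_cons (exprpD pC) IHl.
    by rewrite !big_nil expr0n pchar_eq0F.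
  by rewrite sumX; apply: eq_bigr => i _; rewrite exprMn -rmorphXn -muE.
have [i1 ni1] : exists i, ~ pth_powers p (lam' i).
  by apply: contrapT => h'; apply: nperf => i; apply: contrapT => ni; apply: h'; exists i.
have [D dD Di1] := pth_power_deriv pk ni1.
have [N [E [dE Ec]]] := lift D dD.
have eD : \sum_i iota (D (lam' i)) * e i ^+ p = 0.
  apply: (@mulfI _ (h ^+ N)); first by rewrite expf_neq0.
  have := congr1 E e0'; rewrite (deriv_on_sum (subring_setT C) dE) //.
  rewrite (deriv_on0 (subring_setT C) dE) => eE.
  rewrite mulr0 mulr_sumr -[RHS]eE; apply: eq_bigr => i _.
  by rewrite dE.2 // (deriv_pth _ pC dE) Ec /= mulr0 add0r mulrA mulrC.
have Dsupp i : D (lam' i) != 0 -> (lam i != 0) && (i != i0).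
  move=> Di; rewrite -lam'0; apply/andP; split; apply: contraNneq Di => ->.
    by rewrite (deriv_on0 (subring_setT k) dD).
  by rewrite /lam' divff // (deriv_on1 (subring_setT k) dD).
have [||mu [mu0 mus muE]] := IH (fun i => D (lam' i)) _ eD.
- apply: leq_trans cardn; apply: proper_card; apply/properP; split.
    by apply/fintype.subsetP => i; rewrite !inE => /Dsupp/andP[].
  by exists i0; rewrite !inE //; apply/negP => /Dsupp; rewrite eqxx andbF.
- by exists i1.
by exists mu; split=> // i /mus/Dsupp/andP[].
Qed.

End FrobeniusIndependence.

Section SeparableFields.
Variables (k : fieldType) (L : fieldExtType k).

(** Let [N] be an intermediate field of largest degree over which [L] is not separable. Some
    inseparable [y] carries a non-zero derivation of [N(y)] over [N]. As [L] is separable over the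
    larger field [N(y)], this derivation extends to [L], against the hypothesis. *)
Lemma separable_no_derivation :
  (forall D : 'End(L), Derivation fullv D -> (1%VS <= lker D)%VS -> D = 0%R) ->
  separable 1 {:L}.
Proof.
move=> noD; apply: contrapT => nsep.
pose bad n := `[< exists2 N : {subfield L}, ~~ separable N {:L} & \dim N = n >].
have exbad : exists n, bad n.
  by exists (\dim (1%AS : {subfield L})); apply/asboolP; exists 1%AS => //; apply/negP.
have bd n : bad n -> (n <= \dim {:L})%N.
  by move=> /asboolP[N _ <-]; apply: dimvS; apply: subvf.
case: (ex_maxnP exbad bd) => n /asboolP[N nsepN <-] Nmax.
have [y _ ny] : exists2 y, y \in {:L}%VS & ~~ separable_element N y.
  apply: contrapT => h; move/negP: nsepN; apply; apply/separableP => y yL.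
  by apply: contrapT => /negP ny; apply: h; exists y.
have [D [dD [ND nD]]] : exists D : 'End(L), Derivation <<N; y>> D /\
    (N <= lker D)%VS /\ ~~ (<<N; y>> <= lker D)%VS.
  apply: contrapT => h; move/negP: ny; apply; apply/Derivation_separableP => D dD ND.
  by apply: contrapT => /negP nD; apply: h; exists D.
have yN : y \notin N by apply: contra ny; exact: base_separable.
have ltN : (\dim N < \dim <<N; y>>)%N.
  rewrite ltn_neqAle dimvS ?subv_adjoin // andbT; apply: contra yN => /eqP dNy.
  have /eqP -> : N == <<N; y>>%VS :> {vspace L} by rewrite eqEdim subv_adjoin dNy leqnn.
  exact: memv_adjoin.
have sepNy : separable <<N; y>>%AS {:L}.
  apply: contrapT => /negP h; have : bad (\dim <<N; y>>%AS) by apply/asboolP; exists <<N; y>>%AS.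
  by move/Nmax; rewrite leqNgt ltN.
have eL := eq_adjoin_separable_generator sepNy (subvf _).
set t := separable_generator _ _ in eL.
have st : separable_element <<N; y>>%AS t by apply: separable_generatorP.
have dD' := extendDerivationP dD st.
case/negP: nD; apply/subvP => z zNy; rewrite memv_ker.
rewrite -(extendDerivation_id t D zNy) (noD (extendDerivation t D <<N; y>>%AS)) ?lfunE //.
  by rewrite eL.
apply/subvP => u u1; have uN : u \in N by apply: subvP u1; apply: sub1v.
rewrite memv_ker extendDerivation_id; last by apply: subvP uN; apply: subv_adjoin.
by rewrite -memv_ker; apply: subvP uN.
Qed.

(** The p-th powers of a basis of [L] are free, hence a basis, and every derivation over [k] kills
    them. *)
Lemma frobenius_free_separable p : p \in [pchar k] ->
  frobenius_free p (in_alg L) -> separable 1 {:L}.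
Proof.
move=> pk frob; apply: separable_no_derivation => D dD kD.
have pL : p \in [pchar L] := pchar_alg pk (in_alg L).
pose b := vbasis {:L}; pose bp := [tuple tnth b i ^+ p | i < \dim {:L}].
have bpE i : bp`_i = b`_i ^+ p.
  have [iL|Li] := ltnP i (\dim {:L}).
    by rewrite -[i]/(val (Ordinal iL)) -!tnth_nth tnth_mktuple.
  by rewrite !nth_default ?size_tuple // expr0n (pchar_eq0F pk).
have freeb : free b := basis_free (vbasisP _).
have freebp : free bp.
  apply/freeP => lam e0 i; apply/eqP; apply: contrapT => /negP li.
  have [||mu [[i1 mu1] _ muE]] := frob _ (fun i : 'I_(\dim {:L}) => b`_i) lam.
  - by rewrite -[RHS]e0; apply: eq_bigr => j _; rewrite bpE /= mulr_algl.
  - by exists i.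
  move/freeP: freeb => /(_ mu) h; move: mu1; rewrite h ?eqxx // -[RHS]muE.
  by apply: eq_bigr => j _; rewrite /= mulr_algl.
have spanbp : <<bp>>%VS = fullv.
  by apply/eqP; rewrite eqEdim subvf /= (eqP freebp) size_tuple.
apply/lfunP => z; have : z \in <<bp>>%VS by rewrite spanbp memvf.
move/coord_span->; rewrite linear_sum lfunE /= big1 // => i _.
rewrite linearZ /= bpE (Derivation_exp dD) ?memvf // -mulr_natl (pcharf0 pL).
by rewrite !mul0r scaler0.
Qed.

End SeparableFields.

Section FractionDerivations.
Variables (k : fieldType) (C : idomainType) (iota : {rmorphism k -> C}).
Local Notation K := {fraction C}.

Lemma tofrac_inj : injective (@tofrac C).
Proof. by move=> x y /eqP; rewrite tofrac_eq => /eqP. Qed.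

Lemma fractionP (z : K) : exists n d : C, d != 0 /\ tofrac d * z = tofrac n.
Proof.
elim/quotW: z => x; exists (frac x).1, (frac x).2; split; first exact: denom_ratioP.
have x2 := denom_ratioP x.
rewrite -[_ * _]/(FracField.mul _ _) !piE /FracField.mulf; apply/eqmodP.
rewrite /= FracField.equivfE !numden_Ratio ?oner_neq0 ?mulf_neq0 ?oner_neq0 //=.
by rewrite mul1r mulr1 mulrC.
Qed.

End FractionDerivations.

(** * Derivations and codimension in finitely generated algebras *)

Section FinitelyGenerated.
Variables (k : fieldType) (C : idomainType) (iota : {rmorphism k -> C}).
Hypothesis fgC : finitely_generated_algebra iota.

Lemma fg_adjs : exists l, forall y, adjs (range iota) l y.
Proof.
have [n [a afg]] := fgC; exists [seq a i | i <- enum 'I_n].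
have sS := adjs_subring [seq a i | i <- enum 'I_n] (subring_range iota).
have hT : adjs (range iota) [seq a i | i <- enum 'I_n] = setT.
  apply: afg.
  - by move=> c; apply: adjs_sub; [exact: subring_range | exists c].
  - move=> i; apply: adjs_gen; first exact: subring_range.
    by apply: map_f; rewrite mem_enum.
  - by move=> b c; apply: subringD.
  - by case: sS.
by move=> y; rewrite hT.
Qed.

(** By the Leibniz rule, a common denominator of the values at the generators works on all of
    [C]. *)
Lemma clear_denominators (d : C -> {fraction C}) :
    deriv_on (@tofrac C) setT d -> (forall c, d (iota c) = 0) ->
  exists (v : C) (E : C -> C), [/\ v != 0, deriv_on idfun setT E, forall c, E (iota c) = 0 &
    forall x, tofrac (E x) = tofrac v * d x].
Proof.
move=> dd dk; have sT := subring_setT C.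
have [v v0 hv] : exists2 v : C, v != 0 & forall x, exists u, tofrac v * d x = tofrac u.
  have [n [a afg]] := fgC.
  have [v v0 hv] : exists2 v : C, v != 0 & forall i, exists u, tofrac v * d (a i) = tofrac u.
    have ex i : exists w : C, w != 0 /\ exists u, tofrac w * d (a i) = tofrac u.
      by have [u [w [w0 e]]] := fractionP (d (a i)); exists w; split=> //; exists u.
    pose w i := sval (cid (ex i)).
    have w0 i : w i != 0 by rewrite /w; case: cid => ? [].
    have wP i : exists u, tofrac (w i) * d (a i) = tofrac u by rewrite /w; case: cid => ? [].
    exists (\prod_i w i); first by apply/prodf_neq0.
    move=> i; have [u e] := wP i; exists (u * \prod_(i' | i' != i) w i').
    by rewrite (bigD1 i) //= mulrC !tofracM -e; ring.
  exists v => // x; pose S : set C := [set x | exists u, tofrac v * d x = tofrac u].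
  have hS : S = setT.
    apply: afg => //.
    - by move=> c; exists 0; rewrite dk mulr0 tofrac0.
    - by move=> b c [u e] [u' e']; exists (u + u'); rewrite dd.1 // mulrDr e e' tofracD.
    - move=> b c [u e] [u' e']; exists (b * u' + c * u); rewrite dd.2 //.
      by rewrite tofracD !tofracM -e -e'; ring.
  by have : [set: C] x by []; rewrite -hS.
exists v; pose E x := sval (cid (hv x)).
have EP x : tofrac (E x) = tofrac v * d x by rewrite /E; case: cid => u /= ->.
exists E; split=> //; first split.
- by move=> x y _ _; apply: tofrac_inj; rewrite EP dd.1 // mulrDr tofracD !EP.
- move=> x y _ _; apply: tofrac_inj; rewrite EP dd.2 // tofracD !tofracM !EP /=; ring.
- by move=> c; apply: tofrac_inj; rewrite EP dk mulr0 tofrac0.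
Qed.

Lemma range_alg_unit (y : C) : range iota y -> y != 0 -> invertible y.
Proof.
move=> [c _ <-] c0; exists (iota c^-1); rewrite -rmorphM divff ?rmorph1 //.
by apply: contraNneq c0 => ->; rewrite rmorph0.
Qed.

(** If there were none, [C] would be algebraic over the field [k] by [separable_tower], and [a]
    would divide a non-zero scalar. *)
Lemma exists_derivation (a : C) : a != 0 -> ~ invertible a ->
  exists E : C -> C, [/\ deriv_on idfun setT E, forall c, E (iota c) = 0 & exists y, E y != 0].
Proof.
move=> a0 na; have [l hl] := fg_adjs.
have [[d [dd dS [y _ dy]]]|[h [h0 _ hS]]] := separable_tower (@tofrac_inj C) l (subring_range iota).
  have {}dd : deriv_on (@tofrac C) setT d by apply: deriv_on_sub dd => x _.
  have dk c : d (iota c) = 0 by apply: dS; exists c.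
  have [v [E [v0 dE Ek EP]]] := clear_denominators dd dk.
  exists E; split=> //; exists y; rewrite -tofrac_eq0 EP mulf_neq0 // tofrac_eq0 //.
have [z [az az0]] := hS a (hl a) a0.
have [w azw] := range_alg_unit az az0.
by case: na; exists (z * w); rewrite mulrA.
Qed.

End FinitelyGenerated.

(** * Dimensions of quotients and residue fields *)

Section Codimension.
Variables (k : fieldType) (C : idomainType) (iota : {rmorphism k -> C}).
Implicit Types (I Q : set C).

Definition spans_mod I (J : finType) (e : J -> C) :=
  forall x, exists c : J -> k, I (x - \sum_j iota (c j) * e j).
Definition indep_mod I (J : finType) (e : J -> C) :=
  forall c : J -> k, I (\sum_j iota (c j) * e j) -> forall j, c j = 0.
(** The dimension over [k] of the quotient of [C] by [I], expressed through lifts of a basis so that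
    no quotient has to be built. *)
Definition codim I n := exists (J : finType) (e : J -> C),
  [/\ #|J| = n, spans_mod I e & indep_mod I e].

Lemma spans_sub I I' (J : finType) (e : J -> C) : I `<=` I' -> spans_mod I e -> spans_mod I' e.
Proof. by move=> II' h x; have [c /II'] := h x; exists c. Qed.

Lemma codim_spanned I (J : finType) (e : J -> C) : is_ideal I -> spans_mod I e ->
  exists n, codim I n.
Proof.
move=> idI sp.
pose P n := `[< exists e : 'I_n -> C, spans_mod I e >].
have exP : exists n, P n.
  exists #|J|; apply/asboolP; exists (e \o enum_val) => x; have [c Ic] := sp x.
  exists (c \o enum_val); move: Ic; congr (I (_ - _)).
  rewrite (reindex (@enum_val J predT)) //=.
  exact: (onW_bij _ (enum_val_bij J)).
case: (ex_minnP exP) => -[|n] /asboolP[f spf] minn.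
  by exists 0%N, 'I_0, f; split=> //; [rewrite card_ord | move=> c _ []].
exists n.+1, 'I_n.+1, f; split=> //; first by rewrite card_ord.
move=> c Ic j; apply/eqP; apply: contrapT => /negP cj.
suff : (n < n)%N by rewrite ltnn.
apply: minn; apply/asboolP; exists (fun i => f (lift j i)) => x.
have [b Ib] := spf x; exists (fun i => b (lift j i) - b j / c j * c (lift j i)).
have -> : x - \sum_i iota (b (lift j i) - b j / c j * c (lift j i)) * f (lift j i) =
    (x - \sum_i iota (b i) * f i) + iota (b j / c j) * (\sum_i iota (c i) * f i).
  rewrite -addrA; congr (_ + _).
  rewrite (bigD1_ord j) //= [in X in _ + X](bigD1_ord j) //= mulrDr mulrA -rmorphM divfK //.
  rewrite opprD addrACA addNr add0r mulr_sumr -sumrN -sumrN -big_split /=.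
  by apply: eq_bigr => i _; rewrite rmorphB rmorphM; ring.
by apply: idealD => //; apply: idealM.
Qed.

Lemma indep_card_le I (J J' : finType) (e : J -> C) (e' : J' -> C) : is_ideal I ->
  (forall i, exists c : J -> k, I (e' i - \sum_j iota (c j) * e j)) ->
  indep_mod I e' -> (#|J'| <= #|J|)%N.
Proof.
move=> idI sp ind; rewrite leqNgt; apply/negP => lt.
pose M : 'M[k]_(#|J'|, #|J|) :=
  \matrix_(i, j) sval (cid (sp (enum_val i))) (enum_val j).
have MP i : I (e' (enum_val i) - \sum_j iota (M i (enum_rank j)) * e j).
  have := svalP (cid (sp (enum_val i))); congr (I (_ - _)).
  by apply: eq_bigr => j _; rewrite mxE enum_rankK.
have nfree : ~~ row_free M.
  by rewrite /row_free neq_ltn (leq_ltn_trans (rank_leq_col _)).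
have /rowV0Pn[v vker v0] : kermx M != 0 by rewrite kermx_eq0.
case/rV0Pn: v0 => i; apply/negP; rewrite negbK; apply/eqP.
rewrite -[i]enum_valK; apply: (ind (fun j => v 0 (enum_rank j))).
have vM : v *m M = 0 by apply/sub_kermxP.
rewrite (reindex (@enum_val J' predT)) /=; last exact: (onW_bij _ (enum_val_bij J')).
have -> : \sum_(j < #|J'|) iota (v 0 (enum_rank (enum_val j))) * e' (enum_val j) =
   \sum_(j < #|J'|) iota (v 0 j) * (e' (enum_val j) - \sum_l iota (M j (enum_rank l)) * e l).
  under [RHS]eq_bigr do rewrite mulrBr.
  rewrite sumrB; under eq_bigr do rewrite enum_valK.
  rewrite [X in _ - X](_ : _ = 0) ?subr0 //.
  under eq_bigr do rewrite mulr_sumr.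
  rewrite exchange_big big1 //= => l _.
  have := congr1 (fun A : 'M_(1, _) => iota (A 0 (enum_rank l))) vM.
  rewrite !mxE rmorph0 rmorph_sum -[X in X = 0 -> _]mulr1 => h.
  transitivity ((\sum_(i0 < #|J'|) iota (v 0 i0 * M i0 (enum_rank l))) * e l).
    by rewrite mulr_suml; apply: eq_bigr => j _; rewrite rmorphM mulrA.
  by move: h; rewrite mulr1 => ->; rewrite mul0r.
by apply: ideal_sum => // j _; apply: idealM.
Qed.

Lemma codim_unique I n n' : is_ideal I -> codim I n -> codim I n' -> n = n'.
Proof.
move=> idI [J [e [<- sp ind]]] [J' [e' [<- sp' ind']]].
by apply/eqP; rewrite eqn_leq (indep_card_le idI (fun i => sp' (e i)) ind) (indep_card_le idI (fun i => sp (e' i)) ind').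
Qed.

(** Additivity along [0 -> C/(I : y) -> C/I -> C/(I + (y)) -> 0], whose first map is multiplication
    by [y]. *)
Lemma codim_colon I y n n' : is_ideal I -> codim (idadd I y) n -> codim (colon I y) n' ->
  codim I (n + n').
Proof.
move=> idI [J [e [<- sp ind]]] [J' [e' [<- sp' ind']]].
exists (J + J')%type, (fun j => match j with inl j => e j | inr j => e' j * y end).
split; first by rewrite card_sum.
  move=> x; have [c [r [z [Iz e0]]]] := sp x; have [c' Ic'] := sp' r.
  exists (fun j => match j with inl j => c j | inr j => c' j end).
  rewrite big_sumType /= opprD addrA e0 addrAC; apply: idealD => //.
  move: Ic'; rewrite /colon /= mulrBl mulr_suml; congr (I (_ - _)).
  by apply: eq_bigr => j _; rewrite mulrA.
move=> c; rewrite big_sumType /= => Ic.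
have e0 : \sum_j iota (c (inr j)) * (e' j * y) = (\sum_j iota (c (inr j)) * e' j) * y.
  by rewrite mulr_suml; apply: eq_bigr => j _; rewrite mulrA.
rewrite e0 in Ic.
have c0 : forall j, c (inl j) = 0.
  apply: (ind (fun j => c (inl j))).
  rewrite -[\sum_j _](addrK ((\sum_j iota (c (inr j)) * e' j) * y)).
  rewrite addrC -mulNr; exists (- \sum_j iota (c (inr j)) * e' j); eexists.
  by split; first exact: Ic.
case=> j; first exact: c0.
apply: (ind' (fun j => c (inr j))); rewrite /colon /=; move: Ic.
by rewrite big1 ?add0r // => i _; rewrite c0 rmorph0 mul0r.
Qed.

Lemma codim_gt0 Q n : is_ideal Q -> ~ Q 1 -> codim Q n -> (0 < n)%N.
Proof.
move=> idQ nQ1 [J [e [<- sp _]]]; rewrite lt0n; apply/eqP => J0; apply: nQ1.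
have [c] := sp 1; rewrite big1 ?subr0 // => j _.
by have := max_card (pred1 j); rewrite card1 J0.
Qed.

(** A prime filtration of the quotient: a maximal proper ideal of the form [colon I y] is prime, and
    [codim_colon] splits it off, leaving [idadd I y] of smaller codimension. *)
Lemma dvd_codim (N : nat) I n : noetherian C -> is_ideal I -> codim I n ->
    (forall Q n', is_prime_ideal Q -> I `<=` Q -> codim Q n' -> (N %| n')%N) -> (N %| n)%N.
Proof.
move=> nC; have [m] := ubnP n; elim: m n I => // m IH n I; rewrite ltnS => nm idI cI hQ.
have [I1|nI1] := pselect (I 1).
  have [J [e [<- _ ind]]] := cI; rewrite (_ : #|J| = 0%N) //.
  apply: eq_card0 => j; have := ind (fun i => (i == j)%:R) _ j; rewrite eqxx => h.
  by have /eqP := h (ideal1 idI _ I1); rewrite oner_eq0.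
pose F : set (set C) := [set T | exists2 y, ~ I y & T = colon I y].
have [||_ [y nIy ->] ymax] := @noeth_max _ nC F (colon I 1).
- by move=> _ [y _ ->]; apply: colon_ideal.
- by exists 1.
have idQ := colon_ideal y idI.
have pQ : is_prime_ideal (colon I y).
  split=> //; first by rewrite /colon /= mul1r.
  move=> a b Qab; have [Qa|nQa] := pselect (colon I y a); [by left | right].
  apply: (ymax (colon I (a * y))).
  - by exists (a * y).
  - by move=> r; rewrite /colon /= mulrCA; apply: idealM.
  - by move: Qab; rewrite /colon /= [a * b]mulrC mulrA.
have IQ : I `<=` colon I y by move=> x Ix; apply: idealMr.
have [J [e [_ sp _]]] := cI.
have [nQ cQ] := codim_spanned idQ (spans_sub IQ sp).
have idIy := idadd_ideal y idI.
have [n1 c1] := codim_spanned idIy (spans_sub (idadd_sub _) sp).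
have en : n = (n1 + nQ)%N by apply: (codim_unique idI cI (codim_colon idI c1 cQ)).
have nQ1 : ~ colon I y 1 by case: pQ.
have nQ0 := codim_gt0 idQ nQ1 cQ.
rewrite en dvdn_add //; last exact: hQ cQ.
apply: (IH _ (idadd I y)) => //; first by apply: leq_trans nm; rewrite en -addn1 leq_add2l.
move=> Q n' pQ' h; apply: hQ => //; apply: subset_trans h; exact: idadd_sub.
Qed.

(** The quotient is a domain of finite dimension over [k], hence a field. It is realized on row
    vectors of coordinates, which fixes its dimension from the start; [psi] sends coordinates to an
    element and [phi] goes back modulo [Q]. *)
Lemma residue_field Q n : is_prime_ideal Q -> codim Q n ->
  exists (L : fieldExtType k) (ev : {rmorphism C -> L}),
    [/\ forall z, exists x, ev x = z, forall x, ev x = 0 <-> Q x,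
        forall c, ev (iota c) = c%:A & \dim {:L} = n].
Proof.
move=> pQ [J [e [<- sp ind]]]; have idQ := prime_ideal pQ.
have spm x : exists v : 'rV[k]_#|J|, Q (x - \sum_j iota (v 0 (enum_rank j)) * e j).
  have [c Qc] := sp x; exists (\row_i c (enum_val i)); move: Qc; congr (Q (_ - _)).
  by apply: eq_bigr => j _; rewrite mxE enum_rankK.
pose psi (v : 'rV[k]_#|J|) : C := \sum_j iota (v 0 (enum_rank j)) * e j.
pose phi x : 'rV[k]_#|J| := sval (cid (spm x)).
have phiP x : Q (x - psi (phi x)) by rewrite /phi; case: cid.
have psiB u v : psi (u - v) = psi u - psi v.
  rewrite /psi -sumrB; apply: eq_bigr => j _; by rewrite !mxE rmorphB mulrBl.
have psi0 v : Q (psi v) -> v = 0.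
  by move=> /ind h; apply/rowP => i; rewrite mxE -[i]enum_valK h.
have phi_eq x v : Q (x - psi v) -> phi x = v.
  move=> Qx; apply/eqP; rewrite -subr_eq0; apply/eqP; apply: psi0; rewrite psiB.
  by have := idealB idQ Qx (phiP x); rewrite opprB addrC addrA subrK.
have phiE x y : Q (x - y) -> phi x = phi y.
  by move=> Qxy; apply: phi_eq; have := idealD idQ Qxy (phiP y); rewrite addrA subrK.
have phiK v : phi (psi v) = v by apply: phi_eq; rewrite subrr; apply: ideal0.
have phiD x y : phi (x + y) = phi x + phi y.
  apply: phi_eq; rewrite -[phi y]opprK psiB -[- phi y]sub0r psiB.
  have -> : psi 0 = 0 by rewrite /psi big1 // => j _; rewrite mxE rmorph0 mul0r.
  rewrite sub0r opprK opprD addrACA; apply: idealD; [exact: idQ | exact: phiP | exact: phiP].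
have phiZ c x : phi (iota c * x) = c *: phi x.
  apply: phi_eq; have -> : psi (c *: phi x) = iota c * psi (phi x).
    by rewrite /psi mulr_sumr; apply: eq_bigr => j _; rewrite !mxE rmorphM mulrA.
  by rewrite -mulrBr; apply: idealM.
pose mul u v := phi (psi u * psi v).
have psiphi x y : phi (psi (phi x) * y) = phi (x * y).
  by apply: phiE; rewrite -mulrBl; apply: idealMr => //; rewrite -opprB; apply: idealN.
have mulC : commutative mul by move=> u v; rewrite /mul mulrC.
have mulA : associative mul.
  by move=> u v w; rewrite /mul mulrC !psiphi mulrC mulrA.
have mul1 : left_id (phi 1) mul by move=> u; rewrite /mul psiphi mul1r phiK.
have mulD : left_distributive mul +%R.
  move=> u v w; rewrite /mul -phiD -mulrDl; congr (phi (_ * _)); rewrite /psi -big_split /=.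
  by apply: eq_bigr => j _; rewrite mxE rmorphD mulrDl.
have one0 : phi 1 != 0.
  apply/eqP => h; have := phiP 1; rewrite h /psi big1; last by move=> j _; rewrite mxE rmorph0 mul0r.
  by rewrite subr0; case: pQ.
pose R1 : comNzRingType := HB.pack 'rV[k]_#|J|
  (GRing.Zmodule_isComNzRing.Build 'rV[k]_#|J| mulA mulC mul1 mulD one0).
have phi0P x : phi x = 0 <-> Q x.
  have psi00 : psi 0 = 0 by rewrite /psi big1 // => j _; rewrite mxE rmorph0 mul0r.
  split=> [h|Qx]; first by have := phiP x; rewrite h psi00 subr0.
  by apply: phi_eq; rewrite psi00 subr0.
have phiM x y : phi (x * y) = mul (phi x) (phi y).
  by rewrite /mul psiphi [x * psi _]mulrC psiphi mulrC.
have domR (u v : R1) : u * v = 0 -> u = 0 \/ v = 0.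
  move=> /phi0P; case: pQ => _ _ h /h[Qu|Qv]; [left | right]; exact: psi0.
have scaleAl (c : k) (u v : 'rV[k]_#|J|) : c *: mul u v = mul (c *: u) v.
  rewrite -[u]phiK -[v]phiK -phiZ -!phiM -phiZ; congr phi; by rewrite mulrA.
(* Multiplication by [u] is an injective endomorphism of a finite-dimensional space, hence onto. *)
have invR (u : R1) : u != 0 -> exists v : R1, v * u = 1.
  move=> u0; pose M : 'M[k]_#|J| := lin1_mx (fun v : 'rV[k]_#|J| => mul v u).
  have lin : linear (fun v : 'rV[k]_#|J| => mul v u).
    by move=> c v w; rewrite mulD -scaleAl.
  pose f : {linear 'rV[k]_#|J| -> 'rV[k]_#|J|} := HB.pack (fun v : 'rV[k]_#|J| => mul v u)
    (GRing.isLinear.Build _ _ _ _ _ lin).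
  have fE v : v *m lin1_mx f = mul v u by rewrite mul_rV_lin1.
  have : row_free (lin1_mx f).
    rewrite -kermx_eq0; apply: contrapT => /negP/rowV0Pn[v /sub_kermxP].
    rewrite fE => /(domR v u)[->|u00]; first by rewrite eqxx.
    by rewrite u00 eqxx in u0.
  rewrite row_free_unit => fu; exists ((1 : R1) *m invmx (lin1_mx f)).
  by rewrite -[LHS]fE mulmxKV.
have exinv (u : R1) : exists v : R1, (u != 0 -> v * u = 1) /\ (u = 0 -> v = 0).
  have [->|/invR[v vu]] := eqVneq u 0; first by exists 0.
  by exists v; split=> // u0; move: vu; rewrite u0 mulr0 => /esym/eqP; rewrite oner_eq0.
pose inv u := sval (cid (exinv u)).
have mulV (u : R1) : u != 0 -> inv u * u = 1 by have [h _] := svalP (cid (exinv u)).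
have inv0 : inv 0 = 0 by have [_ h] := svalP (cid (exinv 0)); exact: h.
pose R2 : fieldType := HB.pack 'rV[k]_#|J| R1 (GRing.ComNzRing_isField.Build R1 mulV inv0).
pose R3 : lalgType k := HB.pack 'rV[k]_#|J| R1
  (GRing.Lmodule_isLalgebra.Build k R1 scaleAl).
have scaleAr : forall (c : k) (u v : R3), c *: (u * v) = u * (c *: v).
  by move=> c u v; rewrite [RHS](mulC u) -[RHS]scaleAl (mulC v).
pose R4 : algType k := HB.pack 'rV[k]_#|J| R3
  (GRing.Lalgebra_isAlgebra.Build k R3 scaleAr).
pose L : fieldExtType k := HB.pack 'rV[k]_#|J| R2 R4.
have phi_zmod : zmod_morphism (phi : C -> L).
  by move=> x y; apply: (addIr (phi y)); rewrite -phiD !subrK.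
have phi_mon : monoid_morphism (phi : C -> L) by split=> // x y; exact: phiM.
pose ev : {rmorphism C -> L} := HB.pack (phi : C -> L)
  (GRing.isZmodMorphism.Build C L phi phi_zmod) (GRing.isMonoidMorphism.Build C L phi phi_mon).
exists L, ev; split.
- by move=> z; exists (psi z); apply: phiK.
- exact: phi0P.
- by move=> c; rewrite -[iota c]mulr1; apply: phiZ.
- by rewrite dimvf /dim /= mul1n.
Qed.

End Codimension.

Section QuotientDomain.
Variables (A : comPzRingType) (P : set A).
Hypothesis pP : is_prime_ideal P.
Let idP : is_ideal P := prime_ideal pP.

Let eqm (x y : A) : bool := `[< P (x - y) >].

Lemma eqm_equiv : equiv_class_of eqm.
Proof.
split.
- by move=> x; apply/asboolP; rewrite subrr; apply: ideal0.
- by move=> x y; apply/asboolP/asboolP => h; rewrite -opprB; apply: idealN.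
- move=> y x z /asboolP h1 /asboolP h2; apply/asboolP.
  by have := idealD idP h1 h2; rewrite addrA subrK.
Qed.

(** Operations are computed on chosen representatives; invertibility is decided classically, as the
    unit ring structure of an [idomainType] requires. *)
Theorem quotient_domain : exists (D : idomainType) (q : {rmorphism A -> D}),
  (forall z, exists x, q x = z) /\ (forall x, q x = 0 <-> P x).
Proof.
pose E := EquivRelPack eqm_equiv; pose T : choiceType := {eq_quot E}.
pose psi (t : T) : A := repr (t : {eq_quot E}).
pose phi (x : A) : T := \pi_({eq_quot E}) x.
have phiK t : phi (psi t) = t by apply: reprK.
have phiE x y : phi x = phi y <-> P (x - y).
  split=> [/eqP|h]; first by rewrite eqmodE => /asboolP.
  by apply/eqP; rewrite eqmodE; apply/asboolP.
have phiP x : P (x - psi (phi x)) by apply/phiE; rewrite phiK.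
pose add u v := phi (psi u + psi v).
pose mul u v := phi (psi u * psi v).
pose opp u := phi (- psi u).
have phiD x y : phi (x + y) = add (phi x) (phi y).
  by apply/phiE; rewrite opprD addrACA; apply: idealD.
have phiM x y : phi (x * y) = mul (phi x) (phi y).
  apply/phiE; rewrite -[x * y](subrK (psi (phi x) * y)) -mulrBl -addrA -mulrBr.
  by apply: idealD => //; [exact: idealMr | exact: idealM].
have phiN x : phi (- x) = opp (phi x).
  by apply/phiE; rewrite -opprD; apply: idealN.
have addA : associative add.
  by move=> u v w; rewrite -[u]phiK -[v]phiK -[w]phiK -!phiD addrA.
have addC : commutative add by move=> u v; rewrite -[u]phiK -[v]phiK -!phiD addrC.
have add0 : left_id (phi 0) add by move=> u; rewrite -[u]phiK -phiD add0r.
have addN : left_inverse (phi 0) opp add by move=> u; rewrite -[u]phiK -phiN -phiD addNr.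
have mulA : associative mul.
  by move=> u v w; rewrite -[u]phiK -[v]phiK -[w]phiK -!phiM mulrA.
have mulC : commutative mul by move=> u v; rewrite -[u]phiK -[v]phiK -!phiM mulrC.
have mul1 : left_id (phi 1) mul by move=> u; rewrite -[u]phiK -phiM mul1r.
have mulD : left_distributive mul add.
  by move=> u v w; rewrite -[u]phiK -[v]phiK -[w]phiK -phiD -!phiM mulrDl phiD.
have phi0 x : phi x = phi 0 <-> P x by rewrite phiE subr0.
have one0 : phi 1 != phi 0 by apply/eqP => /phi0; case: pP.
pose Z : zmodType := HB.pack (T : Type) T (GRing.isZmodule.Build T addA addC add0 addN).
pose R1 : comNzRingType := HB.pack (T : Type) Z
  (GRing.Zmodule_isComNzRing.Build Z mulA mulC mul1 mulD one0).
pose unit (u : R1) : bool := `[< exists v : R1, v * u = 1 >].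
have exinv (u : R1) : exists v : R1, (unit u -> v * u = 1) /\ (~~ unit u -> v = u).
  have [/[dup] /asboolP[v vu]|_] := boolP (unit u); first by exists v.
  by exists u.
pose inv u := sval (cid (exinv u)).
have mulV : {in unit, left_inverse 1 inv *%R}.
  by move=> u uu; have [h _] := svalP (cid (exinv u)); apply: h.
have unitP (x y : R1) : y * x = 1 -> unit x by move=> yx; apply/asboolP; exists y.
have invout : {in [predC unit], inv =1 id}.
  by move=> u uu; have [_ h] := svalP (cid (exinv u)); apply: h.
pose R2 : comUnitRingType := HB.pack (T : Type) R1
  (GRing.ComNzRing_hasMulInverse.Build R1 mulV unitP invout).
have dom : GRing.integral_domain_axiom R2.
  move=> x y /eqP; rewrite -[x]phiK -[y]phiK => /eqP; rewrite -[_ * _]phiM => /phi0.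
  by case: pP => _ _ h /h[] /phi0 ->; rewrite eqxx ?orbT.
pose D : idomainType := HB.pack (T : Type) R2 (GRing.ComUnitRing_isIntegral.Build R2 dom).
have phi_zmod : zmod_morphism (phi : A -> D).
  move=> x y; exact: etrans (phiD x (- y)) (congr1 (add (phi x)) (phiN y)).
have phi_mon : monoid_morphism (phi : A -> D) by split=> // x y; exact: phiM.
pose q : {rmorphism A -> D} := HB.pack (phi : A -> D)
  (GRing.isZmodMorphism.Build A D phi phi_zmod) (GRing.isMonoidMorphism.Build A D phi phi_mon).
exists D, q; split; last exact: phi0.
by move=> z; exists (psi z); apply: phiK.
Qed.

End QuotientDomain.

(** * Finite extensions and Noether normalization *)

Section FiniteOver.
Variable C : idomainType.
Implicit Types (S T P : set C) (x y : C).

Definition fin_over S := exists n (e : 'I_n -> C), forall x,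
  exists2 c : 'I_n -> C, forall i, S (c i) & x = \sum_i c i * e i.

Lemma fin_over_sub S T : S `<=` T -> fin_over S -> fin_over T.
Proof.
by move=> ST [n [e h]]; exists n, e => x; have [c Sc ->] := h x; exists c => // i; apply: ST.
Qed.

Lemma fin_over_trans S T m (t : 'I_m -> C) : subring S ->
    (forall x, T x -> exists2 c : 'I_m -> C, forall i, S (c i) & x = \sum_i c i * t i) ->
  fin_over T -> fin_over S.
Proof.
move=> sS hT [n [e he]].
exists #|{: 'I_n * 'I_m}|, (fun i => e (enum_val i).1 * t (enum_val i).2) => x.
have [c Tc ->] := he x.
have ex i : exists c' : 'I_m -> C, (forall l, S (c' l)) /\ c i = \sum_l c' l * t l.
  by have [c' Sc' ->] := hT _ (Tc i); exists c'.
pose d i := sval (cid (ex i)).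
exists (fun i => d (enum_val i).1 (enum_val i).2).
  by move=> i; have [h _] := svalP (cid (ex (enum_val i).1)); apply: h.
rewrite -(reindex (@enum_val _ {: 'I_n * 'I_m}) (P := predT)
  (F := fun il => d il.1 il.2 * (e il.1 * t il.2))) /=; last first.
  exact: (onW_bij _ (enum_val_bij _)).
rewrite -(pair_bigA _ (fun i l => d i l * (e i * t l))) /=; apply: eq_bigr => i _.
have [_ ->] := svalP (cid (ex i)); rewrite mulr_suml; apply: eq_bigr => l _.
by rewrite -/(d i) -mulrA [t l * _]mulrC.
Qed.

Lemma monic_reduce S f y : subring S -> polyS S f -> f \is monic -> f.[y] = 0 ->
  forall x, adj S y x -> exists2 c : 'I_(size f).-1 -> C, forall i, S (c i) &
    x = \sum_i c i * y ^+ i.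
Proof.
move=> sS Sf fm fy _ [p Sp ->]; have f0 := monic_neq0 fm.
have [n [q [r [Sq Sr e sr]]]] := pseudo_divisionX sS Sf f0 Sp.
exists (fun i => r`_i) => [i|]; first exact: Sr.
move: e; rewrite (monicP fm) expr1n scale1r => ->.
rewrite hornerD hornerM fy mulr0 add0r (@horner_coef_wide _ (size f).-1) //.
by rewrite -ltnS prednK // size_poly_gt0.
Qed.

Lemma fin_over_adj S f y : subring S -> polyS S f -> f \is monic -> f.[y] = 0 ->
  fin_over (adj S y) -> fin_over S.
Proof. by move=> sS Sf fm fy; apply: fin_over_trans sS (monic_reduce sS Sf fm fy). Qed.

Lemma det_polyS S n (M : 'M[{poly C}]_n) : subring S ->
  (forall i l, polyS S (M i l)) -> polyS S (\det M).
Proof.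
move=> sS SM; rewrite /determinant.
have sum_polyS (I : finType) (F : I -> {poly C}) :
    (forall i, polyS S (F i)) -> polyS S (\sum_i F i).
  move=> SF; apply: (big_ind (polyS S)) => //; first exact: polyS0.
  by move=> p q; apply: polySD.
apply: sum_polyS => s; apply: polySM => //.
  move: (nat_of_bool _) => m; elim: m => [|m IH]; first by apply: polySC => //; case: sS.
  rewrite exprS mulN1r -sub0r; apply: polySB => //; exact: polyS0.
apply: (big_ind (polyS S)) => //; first by apply: polySC => //; case: sS.
by move=> p q; apply: polySM.
Qed.

(** The determinant trick: [M] is the matrix over [S] of multiplication by [x] on the module
    generators, and [char_poly M] at [x] kills each of them, hence also their combination 1. *)
Lemma fin_over_integral S x : subring S -> fin_over S ->
  exists f, [/\ polyS S f, f \is monic & f.[x] = 0].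
Proof.
move=> sS [n [e he]].
have ex i : exists c : 'I_n -> C, (forall l, S (c l)) /\ x * e i = \sum_l c l * e l.
  by have [c Sc ->] := he (x * e i); exists c.
pose M : 'M[C]_n := \matrix_(i, l) sval (cid (ex i)) l.
have SM i l : S (M i l) by rewrite mxE; have [h _] := svalP (cid (ex i)); apply: h.
pose E : 'cV[C]_n := \col_i e i.
have ME : (x%:M - M) *m E = 0.
  apply/colP => i; rewrite mulmxBl mul_scalar_mx !mxE; have [_ ->] := svalP (cid (ex i)).
  apply/eqP; rewrite subr_eq0; apply/eqP; apply: eq_bigr => l _; by rewrite !mxE.
exists (char_poly M); split; last 2 first.
- exact: char_poly_monic.
- have detE : (char_poly M).[x] = \det (x%:M - M).
    rewrite /char_poly -[LHS]/(horner_eval x _) -det_map_mx; congr (\det _).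
    apply/matrixP => i l; rewrite !mxE /= /horner_eval hornerD hornerN hornerC.
    by rewrite hornerMn hornerX.
  have key : \det (x%:M - M) *: E = 0.
    by rewrite -mul_scalar_mx -mul_adj_mx -mulmxA ME mulmx0.
  have [c _ e1] := he 1; rewrite detE -[LHS]mulr1 e1 mulr_sumr big1 // => i _.
  have := congr1 (fun A : 'cV[C]_n => A i 0) key; rewrite !mxE => h.
  by rewrite mulrCA h mulr0.
- apply: det_polyS => // i l; rewrite !mxE; apply: polySB => //; last first.
    by apply: polySC => //; have [h _] := svalP (cid (ex i)); apply: h.
  by case: (i == l); rewrite ?mulr1n ?mulr0n; [exact: polySX | exact: polyS0].
Qed.

(** The constant coefficient of a least relation is a multiple of [x], and it is non-zero, since
    otherwise dividing by ['X] would give a smaller relation. *)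
Lemma algebraic_multiple S f x : subring S -> polyS S f -> f != 0 -> f.[x] = 0 -> x != 0 ->
  exists z, S (x * z) /\ x * z != 0.
Proof.
move=> sS Sf f0 fx x0; have [h|[g [Sg gx g0 gmin]]] := min_root S x.
  by move: f0; rewrite (h f Sf fx) eqxx.
elim/poly_ind: g Sg gx g0 gmin => [|q c _] Sg gx g0 gmin; first by rewrite eqxx in g0.
have [Sq Sc] := polyS_cons Sg.
have e : x * - q.[x] = c.
  by move: gx; rewrite !hornerE => /eqP; rewrite addrC addr_eq0 => /eqP ->; rewrite mulrN mulrC.
exists (- q.[x]); rewrite e; split=> //; apply: contraNneq g0 => c0.
have q0 : q = 0.
  have qx : q.[x] = 0.
    by move: e; rewrite c0 => /eqP; rewrite mulf_eq0 (negPf x0) oppr_eq0 => /eqP.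
  have [->//|q0] := eqVneq q 0.
  by apply: gmin => //; rewrite c0 addr0 size_mulX.
by rewrite q0 c0 mul0r addr0.
Qed.

Section Span.
Variables (P : set C) (sP : subring P).

Fixpoint spanl (b : seq C) : set C :=
  if b is c :: b' then [set x | exists2 q, P q & spanl b' (x - q * c)] else [set 0].

Fixpoint freel (b : seq C) : Prop :=
  if b is c :: b' then freel b' /\ (forall q, P q -> spanl b' (q * c) -> q = 0) else True.

Lemma spanl0 b : spanl b 0.
Proof. by elim: b => //= c b IH; exists 0; [exact: subring0 | rewrite mul0r subr0]. Qed.

Lemma spanlB b x y : spanl b x -> spanl b y -> spanl b (x - y).
Proof.
elim: b x y => [x y -> ->|c b IH x y [q Pq hx] [r Pr hy]] /=; first by rewrite subrr.
exists (q - r); first by case: sP => _ h _; apply: h.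
have -> : x - y - (q - r) * c = (x - q * c) - (y - r * c) by ring.
exact: IH.
Qed.

Lemma spanlD b x y : spanl b x -> spanl b y -> spanl b (x + y).
Proof.
move=> hx hy; rewrite -[y]opprK; apply: spanlB => //; rewrite -sub0r.
by apply: spanlB => //; apply: spanl0.
Qed.

Lemma spanlM b r x : P r -> spanl b x -> spanl b (r * x).
Proof.
move=> Pr; elim: b x => [x ->|c b IH x [q Pq hx]] /=; first by rewrite mulr0.
exists (r * q); first by case: sP => _ _; apply.
by rewrite -mulrA -mulrBr; apply: IH.
Qed.

(** Greedy choice of a free subfamily: a rejected generator has a non-zero multiple in the span of
    those kept, and [f] collects the multipliers. *)
Lemma spanl_free_part (l : seq C) : exists b f, [/\ P f, f != 0, freel b &
  forall x, x \in l -> spanl b (f * x)].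
Proof.
elim: l => [|x l [b [f [Pf f0 fb hl]]]].
  by exists [::], 1; split=> //; [case: sP | rewrite oner_neq0].
have [[g [Pg g0 hg]]|h] := pselect (exists g, [/\ P g, g != 0 & spanl b (g * x)]).
  exists b, (f * g); split=> //; [by case: sP => _ _; apply | by rewrite mulf_neq0 |].
  move=> y; rewrite inE => /predU1P[->|yl]; first by rewrite -mulrA; apply: spanlM.
  by rewrite mulrAC mulrC; apply: spanlM => //; apply: hl.
exists (x :: b), f; split=> //=.
  by split=> // q Pq hq; apply/eqP; apply: contrapT => /negP q0; apply: h; exists q.
move=> y; rewrite inE => /predU1P[->|yl].
  by exists f => //; rewrite subrr; apply: spanl0.
by exists 0; [exact: subring0 | rewrite mul0r subr0; apply: hl].
Qed.

Lemma fin_over_free_part : fin_over P -> exists b f, [/\ P f, f != 0, freel b &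
  forall x, spanl b (f * x)].
Proof.
move=> [n [e he]]; have [b [f [Pf f0 fb hl]]] := spanl_free_part [seq e i | i <- enum 'I_n].
exists b, f; split=> // x; have [c Pc ->] := he x; rewrite mulr_sumr.
apply: (big_ind (spanl b)) => [|y z|i _]; [exact: spanl0 | exact: spanlD |].
by rewrite mulrCA; apply: spanlM => //; apply: hl; apply: map_f; rewrite mem_enum.
Qed.

(** Over a free family coordinates are unique, so a divisibility law for scalars holds coordinate by
    coordinate. *)
Lemma spanl_divide w W b x z : P w -> P W ->
    (forall p q, P p -> P q -> W * p = w * q -> exists2 p', P p' & p = w * p') ->
  freel b -> spanl b x -> spanl b z -> W * x = w * z -> exists2 x', spanl b x' & x = w * x'.
Proof.
move=> Pw PW div; elim: b x z => [|c b IH] x z.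
  by move=> _ -> _ _; exists 0; [exact: spanl0 | rewrite mulr0].
move=> [fb fc] [p Pp hx] [q Pq hz] e.
have PM := sP; case: PM => _ PB PM.
have e0 : W * p - w * q = 0.
  apply: fc; first by apply: PB; apply: PM.
  have -> : (W * p - w * q) * c = w * (z - q * c) - W * (x - p * c).
    by rewrite !mulrBr e; ring.
  by apply: spanlB; apply: spanlM.
have [p' Pp' ep] := div p q Pp Pq (subr0_eq e0).
have [|x' hx' ex] := IH (x - p * c) (z - q * c) fb hx hz.
  by rewrite !mulrBr e !mulrA (subr0_eq e0).
exists (p' * c + x'); first by exists p' => //; rewrite addrAC subrr add0r.
by rewrite mulrDr -ex mulrA -ep addrC subrK.
Qed.

End Span.

(** Locally at [m] each [y i] is a multiple of [y i.+1] by an element of [m], so their ideals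
    increase. Once they stabilize, cancelling [y] puts an element outside [m] into [m]. *)
Lemma noeth_no_descent (m : set C) (y : nat -> C) : noetherian C -> is_prime_ideal m ->
  (forall i, y i != 0) -> (forall i, exists s g, [/\ ~ m s, m g & s * y i = g * y i.+1]) -> False.
Proof.
move=> nC pm y0 hy; have idg i := gens_ideal [:: y i].
have [i|n hn] := noeth_chain nC (fun i => sat_ideal pm (idg i)).
  move=> x [s [ns /gens1[r e]]]; have [t [g [nt mg e']]] := hy i.
  exists (t * s); split; first exact: primeNM.
  apply/gens1; exists (r * g); rewrite mulrAC -mulrA [x * s]mulrC e.
  by rewrite mulrCA e' mulrA.
have [t [g [nt mg e]]] := hy n.
have [|s [ns /gens1[r e']]] := hn n.+1 (y n.+1).
  by apply: sub_sat => //; apply/gens1; exists 1; rewrite mul1r.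
suff : m (s * t) by apply: primeNM.
have -> : s * t = r * g.
  by apply: (mulIf (y0 n.+1)); rewrite -[r * g * _]mulrA -e mulrCA -e'; ring.
by apply: idealM => //; apply: prime_ideal.
Qed.

(** A scalar and a monic polynomial are coprime: comparing leading coefficients shows that the
    leading term of [p] is divisible by [u], and it is subtracted. *)
Lemma poly_scalar_divides T u (V p q : {poly C}) : subring T -> u != 0 ->
    V \is monic -> polyS T V -> polyS T p -> polyS T q -> V * p = u *: q ->
  exists2 p', polyS T p' & p = u *: p'.
Proof.
move=> sT u0 Vm TV; have [n] := ubnP (size p); elim: n p q => // n IH p q; rewrite ltnS => pn Tp Tq e.
have [->|p0] := eqVneq p 0; first by exists 0; [exact: polyS0 | rewrite scaler0].
have lp : lead_coef p = u * lead_coef q.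
  by have := congr1 lead_coef e; rewrite lead_coefM (monicP Vm) mul1r lead_coefZ.
set t := lead_coef q *: 'X^((size p).-1).
have Tt : polyS T t by apply: polySZ => //; [exact: polyS_lead | exact: polySXn].
have [||||p' Tp' ep'] := IH (p - u *: t) (q - t * V).
- apply: leq_trans _ pn; rewrite -[X in (_ < X)%N]prednK ?size_poly_gt0 // ltnS.
  apply/leq_sizeP => i; rewrite leq_eqVlt => /predU1P[<-|hi].
    by rewrite coefB !coefZ coefXn eqxx mulr1 -lp lead_coefE subrr.
  rewrite coefB !coefZ coefXn (gtn_eqF hi) !mulr0 subr0 nth_default //.
  by rewrite -[size p]prednK // size_poly_gt0.
- move=> i; rewrite coefB !coefZ mulrA -lp -coefZ -coefB.
  have h : polyS T (p - lead_coef p *: 'X^((size p).-1)).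
    by apply: polySB => //; apply: polySZ => //; [exact: polyS_lead | exact: polySXn].
  exact: h.
- by apply: polySB => //; apply: polySM.
- by rewrite mulrBr e scalerBr -scalerAr -scalerAl [V * _]mulrC scalerAl.
exists (p' + t); first exact: polySD.
by rewrite scalerDr -ep' subrK.
Qed.

Lemma adj_scalar_divides T y u V p q : subring T ->
    (forall f, polyS T f -> f.[y] = 0 -> f = 0) ->
    T u -> u != 0 -> V \is monic -> polyS T V -> adj T y p -> adj T y q ->
  V.[y] * p = u * q -> exists2 p', adj T y p' & p = u * p'.
Proof.
move=> sT tr Tu u0 Vm TV [f Tf ->] [g Tg ->] e.
have [] := poly_scalar_divides (p := f) (q := g) sT u0 Vm TV Tf Tg.
  apply/eqP; rewrite -subr_eq0; apply/eqP; apply: tr.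
    by apply: polySB => //; [exact: polySM | exact: polySZ].
  by rewrite hornerD hornerN hornerM hornerZ e subrr.
by move=> f' Tf' ->; exists f'.[y]; [exists f' | rewrite hornerZ].
Qed.

(* If [T] met [m], the coprime elements [u] of [T] and [V.[y]] would both be multiples
   of [a] at [m], and then [a ^+ i] would divide [f] at [m] for all [i]. *)
Lemma uniformizer_transversal T y m a : noetherian C -> is_prime_ideal m ->
    subring T -> (forall f, polyS T f -> f.[y] = 0 -> f = 0) -> fin_over (adj T y) ->
    a != 0 -> m a -> (forall x, m x -> sat m (gens [:: a]) x) ->
    (exists V, [/\ V \is monic, polyS T V & m V.[y]]) ->
  forall u, T u -> m u -> u = 0.
Proof.
move=> nC pm sT tr fin a0 ma ha [V [Vm TV mV]] u Tu mu; apply/eqP; apply: contrapT => /negP u0.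
have sP := adj_subring y sT; have Pu := adj_sub y sT Tu.
have PV : adj T y V.[y] by exists V.
have [b [f [Pf f0 fb hb]]] := fin_over_free_part sP fin.
have [s1 [ns1 /gens1[v e1]]] := ha _ mu; have [s2 [ns2 /gens1[w e2]]] := ha _ mV.
pose s := s1 * s2; have ns : ~ m s by apply: primeNM.
have e1' : s * u = a * (s2 * v) by rewrite /s mulrAC e1; ring.
have e2' : s * V.[y] = a * (s1 * w) by rewrite /s -mulrA e2; ring.
move: (s2 * v) (s1 * w) s ns e1' e2' => {e1 e2 v w} v' w' s ns e1' e2'.
(* After multiplication by [a ^+ i], both sides of [eq] become [f * (s * u * V.[y]) ^+ i].
   Coprimality of [u] and [V.[y]] then makes [u ^+ i] a factor of [f * v' ^+ i]; the factor [f]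
   brings everything into the span of the free family [b]. *)
have key i : exists z, f * s ^+ i = a ^+ i * z.
  have eq : V.[y] ^+ i * (f * v' ^+ i) = u ^+ i * (f * w' ^+ i).
    apply: (mulfI (expf_neq0 i a0)).
    have -> : a ^+ i * (V.[y] ^+ i * (f * v' ^+ i)) = f * V.[y] ^+ i * (a * v') ^+ i.
      by rewrite exprMn; ring.
    have -> : a ^+ i * (u ^+ i * (f * w' ^+ i)) = f * u ^+ i * (a * w') ^+ i.
      by rewrite exprMn; ring.
    by rewrite -e1' -e2' !exprMn; ring.
  have Pui : adj T y (u ^+ i) by apply: subringX.
  have PVi : adj T y (V.[y] ^+ i) by apply: subringX.
  have [|x' _ ex] := spanl_divide sP Pui PVi _ fb (hb _) (hb _) eq.
    move=> p q Pp Pq; rewrite -horner_exp.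
    apply: (adj_scalar_divides sT tr) => //.
    - exact: subringX.
    - by rewrite expf_neq0.
    - exact: monic_exp.
    - elim: i {eq Pui PVi} => [|i IH]; first by apply: polySC => //; case: sT.
      by rewrite exprS; apply: polySM.
  exists x'; apply: (mulfI (expf_neq0 i u0)).
  have -> : u ^+ i * (f * s ^+ i) = f * (s * u) ^+ i by rewrite exprMn; ring.
  by rewrite e1' exprMn mulrCA ex; ring.
pose z i := sval (cid (key i)); have zP i : f * s ^+ i = a ^+ i * z i by rewrite /z; case: cid.
have s0 : s != 0 by apply/eqP => s0; apply: ns; rewrite s0; apply: ideal0; apply: prime_ideal.
apply: (@noeth_no_descent m z nC pm) => i.
  have : a ^+ i * z i != 0 by rewrite -zP mulf_neq0 // expf_neq0.
  by rewrite mulf_eq0 negb_or => /andP[].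
exists s, a; split=> //; apply: (mulfI (expf_neq0 i a0)).
rewrite mulrCA -zP mulrA -exprSr -zP exprS; ring.
Qed.

End FiniteOver.

(** * Noether normalization by Nagata's substitution *)

Section NoetherNormalization.

Lemma digits_inj n e (a b : nat -> nat) : (forall i, (i < n)%N -> (a i < e)%N) ->
  (forall i, (i < n)%N -> (b i < e)%N) ->
  (\sum_(i < n) a i * e ^ i = \sum_(i < n) b i * e ^ i)%N -> forall i, (i < n)%N -> a i = b i.
Proof.
elim: n a b => [//|n IH] a b ae be; rewrite !big_ord_recl !expn0 !muln1 => eq.
have shift (c : nat -> nat) : ((\sum_(i < n) c (bump 0 i) * e ^ bump 0 i)%N =
    (\sum_(i < n) c i.+1 * e ^ i) * e)%N.
  by rewrite big_distrl; apply: eq_bigr => i _; rewrite /bump /= add1n expnSr mulnA.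
rewrite !shift in eq; have e0 : (0 < e)%N by apply: leq_ltn_trans (ae 0%N _).
have eq0 : a 0%N = b 0%N.
  have := congr1 (modn^~ e) eq; rewrite /= ![(_ + _ * e)%N]addnC !modnMDl.
  by rewrite !modn_small ?ae ?be.
case=> [//|i]; rewrite ltnS => lti; apply: (IH (fun i => a i.+1) (fun i => b i.+1)) => //.
- by move=> l ln; apply: ae.
- by move=> l ln; apply: be.
by move: eq; rewrite eq0 => /addnI/eqP; rewrite eqn_pmul2r // => /eqP.
Qed.

Variables (k : fieldType) (C : idomainType) (iota : {rmorphism k -> C}).
Local Notation kS := (range iota).

Lemma lead_sum_distinct (I : eqType) (s : seq I) (c : I -> C) (G : I -> {poly C}) (d : I -> nat) :
    s != [::] -> uniq s -> {in s &, injective d} ->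
    (forall i, i \in s -> [/\ c i != 0, G i \is monic & size (G i) = (d i).+1]) ->
  exists2 i, i \in s & lead_coef (\sum_(i <- s) c i *: G i) = c i /\
    size (\sum_(i <- s) c i *: G i) = (d i).+1.
Proof.
elim: s => [//|i s IH] _ /= /andP[nis us] dinj hs.
have [ci Gi di] := hs i (mem_head _ _).
have li : lead_coef (c i *: G i) = c i by rewrite lead_coefZ (monicP Gi) mulr1.
have si : size (c i *: G i) = (d i).+1 by rewrite size_scale.
rewrite big_cons; have [->|s0] := eqVneq s [::].
  by exists i; rewrite ?mem_head // big_nil addr0.
have [||l ls [e1 e2]] := IH s0 us.
- by move=> x y xs ys; apply: dinj; rewrite inE ?xs ?ys orbT.
- by move=> x xs; apply: hs; rewrite inE xs orbT.
have ldi : d l != d i.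
  apply: contraNneq nis => /dinj <-; rewrite ?mem_head ?inE ?ls ?orbT //.
move: ldi; rewrite neq_ltn => /orP[h|h].
  exists i; first exact: mem_head.
  by rewrite lead_coefDl ?size_polyDl ?e2 ?si ?li.
exists l; first by rewrite inE ls orbT.
by rewrite addrC lead_coefDl ?size_polyDl ?e2 ?si ?e1.
Qed.

Lemma mpoly_values n (z : 'I_n -> C) x : adjs kS [seq z i | i <- enum 'I_n] x ->
  exists F : mpoly n k, x = mmap iota z F.
Proof.
have addF := mmap_is_additive z iota; have [mulF oneF] := mmap_is_multiplicative z iota.
apply: (@adjs_min _ _ [set x | exists F : mpoly n k, x = mmap iota z F]).
- split.
  + by exists 1; rewrite oneF.
  + by move=> _ _ [F ->] [G ->]; exists (F - G); rewrite addF.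
  + by move=> _ _ [F ->] [G ->]; exists (F * G); rewrite mulF.
- by move=> _ [c _ <-]; exists (mpolyC n c); rewrite mmapC.
- move=> _ /mapP[i _ ->]; exists (mpolyX k (mnm1 i)).
  by rewrite mmapX mmap1U.
Qed.

Definition monic_of_size (p : {poly C}) d := p \is monic /\ size p = d.+1.

Lemma monic_of_sizeM p q d d' : monic_of_size p d -> monic_of_size q d' ->
  monic_of_size (p * q) (d + d').
Proof.
move=> [pm sp] [qm sq]; split; first by rewrite monicMr.
by rewrite size_mul ?monic_neq0 // sp sq addnS.
Qed.

Lemma monic_of_sizeX p d n : monic_of_size p d -> monic_of_size (p ^+ n) (n * d).
Proof.
move=> hp; elim: n => [|n IH]; last by rewrite exprS mulSn; apply: monic_of_sizeM.
by rewrite expr0; split; [exact: monic1 | rewrite size_poly1].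
Qed.

Lemma monic_of_size_prod (I : Type) (r : seq I) (p : I -> {poly C}) (d : I -> nat) :
  (forall i, monic_of_size (p i) (d i)) ->
  monic_of_size (\prod_(i <- r) p i) (\sum_(i <- r) d i).
Proof.
move=> hp; elim: r => [|i r IH]; last by rewrite !big_cons; apply: monic_of_sizeM.
by rewrite !big_nil; split; [exact: monic1 | rewrite size_poly1].
Qed.

(** Each [z i] is replaced by [z i - y ^+ w i] with [w i = e ^ i.+1]. By uniqueness of expansions in
    base [e], the monomials of the relation acquire distinct degrees in [y]. So the leading
    coefficient of the new relation is a scalar, and [y] is integral over the new elements. *)
Lemma nagata (l : seq C) y P : polyS (adjs kS l) P -> P != 0 -> P.[y] = 0 ->
    fin_over (adj (adjs kS l) y) ->
  exists2 l', size l' = size l & fin_over (adjs kS l').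
Proof.
move=> TP P0 Py fin; set n := size l; pose z (i : 'I_n) := l`_i.
have sk := subring_range iota.
have lE : l = [seq z i | i <- enum 'I_n].
  by rewrite -[RHS]/(map (nth 0 l \o val) _) map_comp val_enum_ord map_nth_iota0 ?take_size.
have exF j : exists F : mpoly n k, P`_j = mmap iota z F.
  by apply: mpoly_values; rewrite -lE.
pose F j := sval (cid (exF j)).
have FE j : P`_j = mmap iota z (F j) by rewrite /F; case: cid.
pose s : seq (nat * multinom n) :=
  [seq (j, m) | j <- seq.iota 0 (size P), m <- msupp (F j)].
have us : uniq s.
  apply: allpairs_uniq_dep; first exact: iota_uniq.
    by move=> j _; exact: msupp_uniq.
  by move=> [j m] [j' m'] _ _ /= [-> ->].
pose e := (\max_(t <- s) (t.1 + \sum_(i < n) t.2 i)).+1%N.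
have te t : t \in s -> (t.1 + \sum_(i < n) t.2 i < e)%N.
  by move=> ts; rewrite ltnS (bigD1_seq t ts us) leq_maxl.
pose w (i : 'I_n) := (e ^ i.+1)%N.
pose z' i := z i - y ^+ w i; pose l' := [seq z' i | i <- enum 'I_n].
exists l'; first by rewrite size_map size_enum_ord.
set S' := adjs kS l'; have sS' : subring S' by apply: adjs_subring.
have S'z i : S' (z' i) by apply: adjs_gen => //; apply: map_f; rewrite mem_enum.
pose B i := (z' i)%:P + 'X^(w i).
have Bm i : monic_of_size (B i) (w i).
  have sz : (size (z' i)%:P < size ('X^(w i) : {poly C})%R)%N.
    rewrite size_polyXn ltnS; apply: leq_trans (size_polyC_leq1 _) _.
    by rewrite expn_gt0.
  split; last by rewrite /B addrC size_polyDl // size_polyXn.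
  by rewrite /B addrC monicE lead_coefDl // lead_coefXn.
pose G (t : nat * multinom n) := 'X^(t.1) * \prod_(i < n) B i ^+ t.2 i.
pose d (t : nat * multinom n) := (t.1 + \sum_(i < n) t.2 i * w i)%N.
have Gm t : monic_of_size (G t) (d t).
  apply: monic_of_sizeM; first by split; [exact: monicXn | rewrite size_polyXn].
  by apply: monic_of_size_prod => i; apply: monic_of_sizeX.
pose c (t : nat * multinom n) := iota (mcoeff t.2 (F t.1)).
have dinj : {in s &, injective d}.
  move=> t t' ts ts' edt.
  pose dig (t : nat * multinom n) (i : nat) :=
    if i is i'.+1 then if insub i' is Some o then t.2 o else 0%N else t.1.
  have digE t0 : d t0 = (\sum_(i < n.+1) dig t0 i * e ^ i)%N.
    rewrite big_ord_recl /= expn0 muln1; congr (_ + _)%N; apply: eq_bigr => i _.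
    by rewrite /bump /= add1n /= valK.
  have digS t0 i : t0 \in s -> (i < n.+1)%N -> (dig t0 i < e)%N.
    move=> /te h; case: i => [|i] lti /=; first by apply: leq_ltn_trans h; rewrite leq_addr.
    rewrite insubT; apply: leq_ltn_trans h; rewrite (bigD1 (Ordinal (lti : (i < n)%N))) //=.
    by rewrite addnCA leq_addr.
  have ed := digits_inj (fun i => digS t i ts) (fun i => digS t' i ts') _.
  rewrite !digE in edt; have {}ed := ed edt.
  have /= e0 := ed 0%N isT.
  rewrite (surjective_pairing t) (surjective_pairing t') e0; congr (_, _); apply/mnmP => i.
  by have := ed i.+1 (ltn_ord i); rewrite /= valK.
have s0 : s != [::].
  pose j := (size P).-1; have jP : (j < size P)%N by rewrite /j prednK ?size_poly_gt0.
  have Pj : P`_j != 0 by rewrite -lead_coefE lead_coef_eq0.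
  have Fj : F j != 0.
    apply: contraNneq Pj => Fj; rewrite FE Fj.
    by rewrite /mmap msupp0 big_nil.
  have [m mF] : exists m, m \in msupp (F j).
    move: Fj; rewrite -msupp_eq0; case: (msupp (F j)) => // m r _; exists m; exact: mem_head.
  have jms : (j, m) \in s by apply/allpairsPdep; exists j, m; split=> //; rewrite mem_iota.
  by apply/eqP => s0; move: jms; rewrite s0.
have cs t : t \in s -> [/\ c t != 0, G t \is monic & size (G t) = (d t).+1].
  move=> ts; have [h1 h2] := Gm t; split=> //; rewrite /c fmorph_eq0 -mcoeff_msupp.
  by move/allpairsPdep: ts => [j [m [_ mF ->]]].
have [t0 t0s [lQ sQ]] := lead_sum_distinct s0 us dinj cs.
set Q := \sum_(t <- s) _ in lQ sQ.
have Qy : Q.[y] = 0.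
  rewrite /Q horner_sum big_allpairs_dep -[RHS]Py [RHS]horner_coef -(big_mkord predT (fun i => P`_i * y ^+ i)) /=.
  rewrite /index_iota subn0; apply: eq_bigr => j _; rewrite FE /mmap mulr_suml.
  apply: eq_bigr => m _; rewrite hornerZ /G hornerM hornerXn /c /= -mulrA; congr (_ * _).
  rewrite mulrC; congr (_ * _); rewrite horner_prod; apply: eq_bigr => i _.
  by rewrite horner_exp /B hornerD hornerC hornerXn /z' subrK.
have SQ : polyS S' Q.
  apply: (big_ind (polyS S')) => [|p q|t _]; [exact: polyS0 | exact: polySD |].
  apply: polySZ => //; first by apply: adjs_sub => //; exists (mcoeff t.2 (F t.1)).
  apply: polySM => //; first exact: polySXn.
  apply: (big_ind (polyS S')) => [|p q|i _]; [|exact: polySM|].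
    by apply: polySC => //; case: sS'.
  elim: (fun_of_multinom t.2 i) => [|r IH]; first by apply: polySC => //; case: sS'.
  rewrite exprS; apply: polySM => //; apply: polySD => //; [exact: polySC | exact: polySXn].
have c0 : mcoeff t0.2 (F t0.1) != 0 by have [] := cs t0 t0s; rewrite /c fmorph_eq0.
apply: (@fin_over_adj _ S' (iota (mcoeff t0.2 (F t0.1))^-1 *: Q) y) => //.
- by apply: polySZ => //; apply: adjs_sub => //; exists (mcoeff t0.2 (F t0.1))^-1.
- by rewrite monicE lead_coefZ lQ /c -rmorphM mulVf // rmorph1.
- by rewrite hornerZ Qy mulr0.
apply: fin_over_sub fin; have sA := adj_subring y sS'.
apply: adj_min => //; last exact: adj_gen.
apply: adjs_min => //.
  by apply: subset_trans (adj_sub _ sS'); apply: adjs_sub.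
rewrite lE => _ /mapP[i _ ->]; have -> : z i = z' i + y ^+ w i by rewrite /z' subrK.
apply: subringD => //; first exact: adj_sub.
by apply: subringX => //; apply: adj_gen.
Qed.

(** In a shortest list over which [C] is finite, the last element is transcendental over the others,
    since [nagata] would otherwise shorten the list. Only this variable is singled out; the others
    are collected in [T]. *)
Lemma noether_normalization : finitely_generated_algebra iota ->
  fin_over kS \/ exists T y, [/\ subring T, kS `<=` T,
    forall P, polyS T P -> P.[y] = 0 -> P = 0 & fin_over (adj T y)].
Proof.
move=> fg; have [l0 hl0] := fg_adjs fg; have sk := subring_range iota.
pose R n := `[< exists2 l, size l = n & fin_over (adjs kS l) >].
have exR : exists n, R n.
  exists (size l0); apply/asboolP; exists l0 => //; exists 1%N, (fun=> 1) => x.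
  by exists (fun=> x) => //; rewrite big_ord1 mulr1.
case: (ex_minnP exR) => n /asboolP[l]; case/lastP: l => [_ fin _|l y]; first by left.
rewrite size_rcons => <- fin minl; right; exists (adjs kS l), y.
have adjsE : adjs kS (rcons l y) = adj (adjs kS l) y by rewrite /adjs foldl_rcons.
rewrite adjsE in fin; split=> //; [exact: adjs_subring | exact: adjs_sub |].
move=> P TP Py; apply/eqP; apply: contrapT => /negP P0.
have [l' sl' fin'] := nagata TP P0 Py fin.
have := minl (size l); rewrite ltnn => h; apply: notF; apply: h; apply/asboolP.
by exists l'.
Qed.

End NoetherNormalization.

(** * Curves *)

Lemma sum_multiples (V : zmodType) p I I' (f : nat -> V) : (0 < p)%N -> (I <= p * I')%N ->
  (forall i, ~~ (p %| i)%N -> f i = 0) ->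
  \sum_(i < I) f i = \sum_(i < I') (if (p * i < I)%N then f (p * i)%N else 0).
Proof.
move=> p0 II' f0.
have -> : \sum_(i < I') (if (p * i < I)%N then f (p * i)%N else 0) =
    \sum_(i < I') \sum_(l < I) (if l == (p * i)%N :> nat then f l else 0).
  apply: eq_bigr => i _; case: ifP => [lt|/negbT ge]; last first.
    rewrite big1 // => l _; case: eqP => // e; case/negP: ge; by rewrite -e.
  rewrite (bigD1 (Ordinal lt)) //= eqxx big1 ?addr0 // => l /negPf nl.
  by case: eqP => // e; move: nl; rewrite -val_eqE /= e eqxx.
rewrite exchange_big /=; apply: eq_bigr => l _.
have [/dvdnP[q e]|/f0 ->] := boolP (p %| l)%N; last first.
  by rewrite big1 // => i _; case: ifP.
have qI : (q < I')%N.
  by rewrite -(ltn_pmul2l p0) [(p * q)%N]mulnC -e; apply: leq_trans (ltn_ord l) II'.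
rewrite (bigD1 (Ordinal qI)) //= e mulnC eqxx big1 ?addr0 // => i /negPf ni.
case: eqP => // /eqP; rewrite eqn_pmul2l // => /eqP e'.
by move: ni; rewrite -val_eqE /= e' eqxx.
Qed.

(** * Algebraic dependence and derivations in dimension one *)

Section AlgebraicPairs.
Variables (k : fieldType) (p : nat) (C : idomainType) (iota : {rmorphism k -> C}).
Hypothesis pk : p \in [pchar k].
Variables (x y : C).

Definition box_sum (c : nat -> nat -> k) I J :=
  \sum_(i < I) \sum_(j < J) iota (c i j) * (x ^+ i * y ^+ j).
Definition box_dependent I J :=
  exists2 c : nat -> nat -> k, exists i j, [/\ (i < I)%N, (j < J)%N & c i j != 0] & box_sum c I J = 0.

Hypothesis frob : frobenius_free p iota.

(* If both partial derivatives of a relation of minimal bidegree vanish, all its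
   exponents are multiples of [p], and Mac Lane's criterion gives a smaller relation. *)
Lemma box_dependent_frobenius c I J I' J' : (exists i j, [/\ (i < I)%N, (j < J)%N & c i j != 0]) ->
    (forall i j, (i < I)%N -> (j < J)%N -> c i j != 0 -> (p %| i)%N && (p %| j)%N) ->
    box_sum c I J = 0 -> (I <= p * I')%N -> (J <= p * J')%N -> box_dependent I' J'.
Proof.
move=> [i0 [j0 [i0I j0J c0]]] cp e0 II' JJ'; have p0 := prime_gt0 (pcharf_prime pk).
pose d i j := if (i < I)%N && (j < J)%N then c i j else 0.
have dp i j : ~~ ((p %| i)%N && (p %| j)%N) -> d i j = 0.
  rewrite /d; case: ifP => // /andP[iI jJ]; apply: contraNeq; exact: cp.
pose lam (t : 'I_I' * 'I_J') := d (p * t.1)%N (p * t.2)%N.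
have [||mu [[t mt] _ emu]] := @frob _ (fun t : 'I_I' * 'I_J' => x ^+ t.1 * y ^+ t.2) lam.
- rewrite -[RHS]e0 /box_sum.
  rewrite -(pair_bigA _ (fun i j => iota (lam (i, j)) * (x ^+ i * y ^+ j) ^+ p)) /=.
  have inner i : (i < I)%N -> \sum_(j < J) iota (c i j) * (x ^+ i * y ^+ j) =
      \sum_(j < J') iota (d i (p * j)%N) * (x ^+ i * y ^+ (p * j)).
    move=> iI; pose f j := iota (d i j) * (x ^+ i * y ^+ j).
    rewrite (eq_bigr (fun j : 'I_J => f j)); last by move=> j _; rewrite /f /d iI ltn_ord.
    rewrite (sum_multiples p0 JJ'); last first.
      by move=> j nj; rewrite /f dp ?rmorph0 ?mul0r // negb_and nj orbT.
    apply: eq_bigr => j _; case: ifP => // nj.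
    by rewrite /d nj andbF rmorph0 mul0r.
  rewrite [RHS](eq_bigr (fun i : 'I_I => \sum_(j < J') iota (d i (p * j)%N) * (x ^+ i * y ^+ (p * j))));
    last by move=> i _; apply: inner.
  rewrite (sum_multiples (f := fun i => \sum_(j < J') iota (d i (p * j)%N) * (x ^+ i * y ^+ (p * j))) p0 II').
    apply: eq_bigr => i _; case: ifP => ni.
      by apply: eq_bigr => j _; rewrite exprMn -!exprM ![(_ * p)%N]mulnC.
    by rewrite big1 // => j _; rewrite /lam /d /= ni rmorph0 mul0r.
  by move=> i ni; rewrite big1 // => j _; rewrite dp ?rmorph0 ?mul0r // negb_and ni.
- have /andP[/dvdnP[i1 e1] /dvdnP[j1 e2]] := cp _ _ i0I j0J c0.
  have i1I : (i1 < I')%N.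
    by rewrite -(ltn_pmul2l p0) [(p * i1)%N]mulnC -e1; apply: leq_trans II'.
  have j1J : (j1 < J')%N.
    by rewrite -(ltn_pmul2l p0) [(p * j1)%N]mulnC -e2; apply: leq_trans JJ'.
  by exists (Ordinal i1I, Ordinal j1J); rewrite /lam /d /= ![(p * _)%N]mulnC -e1 -e2 i0I j0J.
pose mu' (i j : nat) : k :=
  if insub i is Some a then if insub j is Some b then mu (a, b) else 0 else 0.
exists mu'.
  by exists t.1, t.2; split; rewrite ?ltn_ord // /mu' !valK -surjective_pairing.
transitivity (\sum_t iota (mu (t.1, t.2)) * (x ^+ t.1 * y ^+ t.2)); last first.
  by rewrite -[RHS]emu; apply: eq_bigr => -[].
rewrite -(pair_bigA _ (fun i j => iota (mu (i, j)) * (x ^+ i * y ^+ j))) /=.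
by apply: eq_bigr => i _; apply: eq_bigr => j _; rewrite /mu' !valK.
Qed.

Lemma deriv_box_sum (F : idomainType) (phi : {rmorphism C -> F}) (D : C -> F) c I J :
    deriv_on phi setT D -> (forall c, D (iota c) = 0) ->
  D (box_sum c I J) =
    phi (\sum_(i < I) \sum_(j < J) iota (c i j *+ i) * (x ^+ i.-1 * y ^+ j)) * D x +
    phi (\sum_(i < I) \sum_(j < J) iota (c i j *+ j) * (x ^+ i * y ^+ j.-1)) * D y.
Proof.
move=> dD Dk; have sT := subring_setT C.
rewrite /box_sum (deriv_on_sum sT dD) // !rmorph_sum !mulr_suml -big_split /=.
apply: eq_bigr => i _; rewrite (deriv_on_sum sT dD) // !rmorph_sum !mulr_suml -big_split /=.
apply: eq_bigr => j _; rewrite !dD.2 // Dk !(deriv_onX sT dD) //.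
rewrite mulr0 addr0 !rmorphM !rmorphMn !rmorphXn /=.
rewrite mulrDr !(mulrnAl, mulrnAr) addrC.
move: (phi (iota _)) (phi x ^+ i) (phi x ^+ i.-1) (phi y ^+ j) (phi y ^+ j.-1) (D x) (D y).
by move=> *; congr (_ *+ _ + _ *+ _); ring.
Qed.

(** [a] and [b] are the values of the partial derivatives of a relation in a minimal box, so one
    linear relation between [D x] and [D y] serves all [k]-derivations. *)
Lemma algebraic_pair I J : box_dependent I J -> exists a b : C, (a != 0 \/ b != 0) /\
  forall (F : idomainType) (phi : {rmorphism C -> F}) (D : C -> F),
    deriv_on phi setT D -> (forall c, D (iota c) = 0) -> phi a * D x + phi b * D y = 0.
Proof.
have [n] := ubnP (I + J); elim: n I J => // n IH I J; rewrite ltnS => IJn [c [i0 [j0 [i0I j0J c0]]] e0].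
have I0 : (0 < I)%N by apply: leq_ltn_trans i0I.
have J0 : (0 < J)%N by apply: leq_ltn_trans j0J.
have [dep|ndepI] := pselect (box_dependent I.-1 J).
  by apply: IH dep; apply: leq_trans IJn; rewrite ltn_add2r prednK.
have [dep|ndepJ] := pselect (box_dependent I J.-1).
  by apply: IH dep; apply: leq_trans IJn; rewrite ltn_add2l prednK.
pose a := \sum_(i < I) \sum_(j < J) iota (c i j *+ i) * (x ^+ i.-1 * y ^+ j).
pose b := \sum_(i < I) \sum_(j < J) iota (c i j *+ j) * (x ^+ i * y ^+ j.-1).
exists a, b; split; last first.
  move=> F phi D dD Dk; rewrite -(deriv_box_sum c I J dD Dk) e0.
  exact: deriv_on0 (subring_setT C) dD.
apply: contrapT => ab0.
have a0 : a = 0 by apply/eqP; apply: contrapT => /negP h; apply: ab0; left.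
have b0 : b = 0 by apply/eqP; apply: contrapT => /negP h; apply: ab0; right.
have pdiv (l : k) m : l != 0 -> l *+ m = 0 -> (p %| m)%N.
  by move=> l0 /eqP; rewrite -mulr_natr mulf_eq0 (negPf l0) (dvdn_pcharf pk).
have cp i j : (i < I)%N -> (j < J)%N -> c i j != 0 -> (p %| i)%N && (p %| j)%N.
  move=> iI jJ cij; apply/andP; split.
    case: i iI cij => [|i] iI cij; first by rewrite dvdn0.
    apply: (pdiv (c i.+1 j)) => //; apply/eqP; apply: contrapT => /negP ci; apply: ndepI.
    exists (fun i j => c i.+1 j *+ i.+1).
      by exists i, j; split=> //; rewrite -ltnS prednK.
    rewrite -[RHS]a0 /a; case: (I) I0 => // I1 _.
    by rewrite big_ord_recl /= big1 ?add0r // => l _; rewrite mulr0n rmorph0 mul0r.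
  case: j jJ cij => [|j] jJ cij; first by rewrite dvdn0.
  apply: (pdiv (c i j.+1)) => //; apply/eqP; apply: contrapT => /negP cj; apply: ndepJ.
  exists (fun i j => c i j.+1 *+ j.+1).
    by exists i, j; split=> //; rewrite -ltnS prednK.
  rewrite -[RHS]b0 /b; apply: eq_bigr => l _; case: (J) J0 => // J1 _.
  by rewrite big_ord_recl mulr0n rmorph0 mul0r add0r.
have p1 := prime_gt1 (pcharf_prime pk).
have box := box_dependent_frobenius (ex_intro _ i0 (ex_intro _ j0 (And3 i0I j0J c0))) cp e0.
have le_p m : (m <= p * m)%N by rewrite leq_pmull // ltnW.
have le_pred m : (1 < m)%N -> (m <= p * m.-1)%N.
  by case: m => [//|[//|m]] _ /=; apply: leq_trans (leq_mul p1 (leqnn _)); rewrite mul2n -addnn addnS ltnS leq_addr.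
have [I1|I1] := ltnP 1 I; first by apply: ndepI; apply: box; [exact: le_pred | exact: le_p].
have [J1|J1] := ltnP 1 J; first by apply: ndepJ; apply: box; [exact: le_p | exact: le_pred].
have eI : I = 1%N by apply/eqP; rewrite eqn_leq I1.
have eJ : J = 1%N by apply/eqP; rewrite eqn_leq J1.
subst I J; move: e0; rewrite /box_sum !big_ord1 !expr0 !mulr1 => /eqP.
by rewrite fmorph_eq0; case: i0 j0 i0I j0J c0 => // -[|//] _ _ /negPf->.
Qed.

End AlgebraicPairs.

Section FiniteOverPolynomials.
Variables (k : fieldType) (C : idomainType) (iota : {rmorphism k -> C}).
Local Notation kS := (range iota).
Local Notation "q ^:C" := (map_poly iota q) (at level 2).

Lemma polyS_range (P : {poly C}) : polyS kS P -> exists q : {poly k}, P = q ^:C.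
Proof.
move=> SP; have ex i : exists c, P`_i = iota c by have [c _ <-] := SP i; exists c.
exists (\poly_(i < size P) sval (cid (ex i))); apply/polyP => i; rewrite coef_map coef_poly /=.
case: ltnP => [_|h]; first by case: cid.
by rewrite rmorph0 nth_default.
Qed.

Lemma polyS_map (q : {poly k}) : polyS kS q ^:C.
Proof. by move=> i; rewrite coef_map; exists q`_i. Qed.

Lemma adj_range b z : adj kS b z <-> exists q : {poly k}, z = q ^:C.[b].
Proof.
split=> [[P /polyS_range[q ->] ->]|[q ->]]; first by exists q.
by exists q ^:C => //; apply: polyS_map.
Qed.

Variables (b : C) (s : nat) (e : 'I_s -> C).
Hypothesis he : forall x, exists2 c : 'I_s -> C, forall i, adj kS b (c i) & x = \sum_i c i * e i.

Definition rep (q : 'I_s -> {poly k}) := \sum_l (q l) ^:C.[b] * e l.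

Lemma rep_ex x : exists q, x = rep q.
Proof.
have [c Sc ->] := he x.
have ex i : exists q : {poly k}, c i = q ^:C.[b] by apply/adj_range.
exists (fun i => sval (cid (ex i))); apply: eq_bigr => i _; congr (_ * _); by case: cid.
Qed.

Definition rep_bounded t x := exists2 q : 'I_s -> {poly k}, forall l, (size (q l) <= t)%N & x = rep q.

Lemma rep_bounded_mono t t' x : (t <= t')%N -> rep_bounded t x -> rep_bounded t' x.
Proof. by move=> tt' [q sq ->]; exists q => // l; apply: leq_trans tt'. Qed.

Lemma rep_bounded_ex x : exists t, rep_bounded t x.
Proof.
have [q ->] := rep_ex x; exists (\max_l size (q l))%N, q => // l.
exact: (leq_bigmax l).
Qed.

(** [d] bounds the degrees in a matrix of multiplication by [x], so each factor [x] costs at most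
    [d] in degree. *)
Lemma rep_bounded_mul x : exists d, forall t z, rep_bounded t z -> rep_bounded (t + d) (x * z).
Proof.
have ex i := rep_ex (x * e i); pose r i := sval (cid (ex i)).
have rP i : x * e i = rep (r i) by rewrite /r; case: cid.
exists (\max_i \max_l size (r i l))%N => t _ [q sq ->].
exists (fun l => \sum_i q i * r i l).
  move=> l; apply: (leq_trans (size_sum _ _ _)); apply/bigmax_leqP => i _.
  apply: leq_trans (size_polyMleq _ _) _; apply: leq_trans (leq_pred _) _.
  apply: leq_add => //; apply: leq_trans (leq_bigmax i); exact: (leq_bigmax l).
rewrite /rep mulr_sumr; under [RHS]eq_bigr do rewrite rmorph_sum horner_sum mulr_suml.
rewrite exchange_big /=; apply: eq_bigr => i _.
rewrite mulrCA rP /rep mulr_sumr; apply: eq_bigr => l _.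
by rewrite rmorphM hornerM mulrA.
Qed.

(** A dimension count: the [N * N] monomials of a box lie in a space spanned by [s * D] elements,
    where [D] is only linear in [N]. *)
Lemma fin_over_box_dependent x y : exists I J, box_dependent iota x y I J.
Proof.
have [t0 h0] := rep_bounded_ex 1.
have [dx hx] := rep_bounded_mul x; have [dy hy] := rep_bounded_mul y.
have hxy i j : rep_bounded (t0 + (i * dx + j * dy)) (x ^+ i * y ^+ j).
  have hyj : rep_bounded (t0 + j * dy) (y ^+ j).
    elim: j => [|j IH]; first by rewrite addn0 expr0.
    by rewrite exprS mulSn [(dy + _)%N]addnC addnA; apply: hy.
  elim: i => [|i IH]; first by rewrite add0n expr0 mul1r.
  rewrite exprS -mulrA mulSn [(dx + _)%N]addnC -addnA [(dx + _)%N]addnC !addnA.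
  by rewrite -!addnA addnA; move/hx: IH; rewrite !addnA.
(* This choice gives [s * D < N * N]. *)
pose N := (s * (t0 + dx + dy)).+1; pose D := (t0 + (N * dx + N * dy))%N.
exists N, N.
have ub (t : 'I_N * 'I_N) : exists c : 'I_s * 'I_D -> k,
    [set 0] (x ^+ t.1 * y ^+ t.2 - \sum_u iota (c u) * (b ^+ u.2 * e u.1)).
  have [q sq eq] : rep_bounded D (x ^+ t.1 * y ^+ t.2).
    apply: rep_bounded_mono (hxy _ _); rewrite leq_add2l leq_add // leq_mul2r ltnW ?orbT //.
  exists (fun u : 'I_s * 'I_D => (q u.1)`_(u.2)); apply/eqP; rewrite subr_eq0 eq; apply/eqP.
  rewrite -(pair_bigA _ (fun (l : 'I_s) (i : 'I_D) => iota (q l)`_i * (b ^+ i * e l))) /=; apply: eq_bigr => l _.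
  rewrite (@horner_coef_wide _ D); last by apply: leq_trans (sq l); rewrite size_poly.
  by rewrite mulr_suml; apply: eq_bigr => i _; rewrite coef_map mulrA.
have [ind|nind] := pselect (indep_mod iota [set 0] (fun t : 'I_N * 'I_N => x ^+ t.1 * y ^+ t.2)).
  have := indep_card_le (@ideal_set0 C) ub ind; rewrite !card_prod !card_ord leqNgt => /negP[].
  apply: (@leq_ltn_trans (s * (t0 + dx + dy) * N)); last by rewrite ltn_pmul2r.
  rewrite -mulnA leq_mul2l /D !mulnDl -addnA [(dx * N)%N]mulnC [(dy * N)%N]mulnC.
  by rewrite leq_add2r leq_pmulr ?orbT.
have [c [e0 [t ct]]] : exists c : 'I_N * 'I_N -> k,
    \sum_t iota (c t) * (x ^+ t.1 * y ^+ t.2) = 0 /\ exists t, c t <> 0.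
  apply: contrapT => h; apply: nind => c e0 t; apply: contrapT => ct; apply: h.
  by exists c; split=> //; exists t.
pose c' (i j : nat) : k :=
  if insub i is Some a then if insub j is Some a' then c (a, a') else 0 else 0.
exists c'.
  exists t.1, t.2; split; rewrite ?ltn_ord // /c' !valK -surjective_pairing; exact/eqP.
transitivity (\sum_t iota (c (t.1, t.2)) * (x ^+ t.1 * y ^+ t.2)); last first.
  by rewrite -[RHS]e0; apply: eq_bigr => -[].
rewrite -(pair_bigA _ (fun i j => iota (c (i, j)) * (x ^+ i * y ^+ j))) /=.
by apply: eq_bigr => i _; apply: eq_bigr => j _; rewrite /c' !valK.
Qed.

End FiniteOverPolynomials.

(** Any two elements are algebraically dependent, and a relation between them constrains [D] and
    [D'] by the same linear equation; so derivations over [k] form at most a line. *)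
Lemma derivations_proportional (k : fieldType) (p : nat) (C : idomainType)
    (iota : {rmorphism k -> C}) b (F : idomainType) (phi : {rmorphism C -> F}) (D D' : C -> F) :
    p \in [pchar k] -> frobenius_free p iota -> fin_over (adj (range iota) b) -> injective phi ->
    deriv_on phi setT D -> (forall c, D (iota c) = 0) ->
    deriv_on phi setT D' -> (forall c, D' (iota c) = 0) ->
  forall x y, D x * D' y = D y * D' x.
Proof.
move=> pk frob [s [e he]] inj dD Dk dD' Dk' x y.
have [I [J dep]] := fin_over_box_dependent he x y.
have [a [a' [ab h]]] := algebraic_pair pk frob dep.
have e1 := h F phi D dD Dk; have e2 := h F phi D' dD' Dk'.
have phi0 c : c != 0 -> phi c != 0 by move=> c0; rewrite -(rmorph0 phi) (inj_eq inj).
have {}e1 : phi a * D x = - (phi a' * D y) by apply/eqP; rewrite -addr_eq0 e1.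
have {}e2 : phi a * D' x = - (phi a' * D' y) by apply/eqP; rewrite -addr_eq0 e2.
case: ab => /phi0 c0; apply: (mulfI c0).
  by rewrite mulrA e1 mulrCA e2; ring.
have e1' : phi a' * D y = - (phi a * D x) by rewrite e1 opprK.
have e2' : phi a' * D' y = - (phi a * D' x) by rewrite e2 opprK.
by rewrite mulrCA e2' mulrA e1'; ring.
Qed.

Definition kernel (A B : comPzRingType) (f : A -> B) : set A := [set x | f x = 0].

Lemma kernel_ideal (A B : comPzRingType) (f : {rmorphism A -> B}) : is_ideal (kernel f).
Proof.
split; rewrite /kernel /=; first by rewrite rmorph0.
  by move=> a b ea eb; rewrite rmorphD ea eb addr0.
by move=> a b eb; rewrite rmorphM eb mulr0.
Qed.

Section Points.
Variables (k : fieldType) (A : comPzRingType) (iota : {rmorphism k -> A}).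

Definition is_point (L : fieldExtType k) (ev : A -> L) :=
  (forall z, exists x, ev x = z) /\ (forall c, ev (iota c) = c%:A).

Lemma kernel_prime (L : fieldType) (ev : {rmorphism A -> L}) : is_prime_ideal (kernel ev).
Proof.
split; first exact: kernel_ideal.
  by rewrite /kernel /= rmorph1 => /eqP; rewrite oner_eq0.
by move=> a b /eqP; rewrite rmorphM mulf_eq0 => /orP[]/eqP; [left | right].
Qed.

Lemma kernel_maximal (L : fieldExtType k) (ev : {rmorphism A -> L}) Q : is_point ev ->
  is_prime_ideal Q -> kernel ev `<=` Q -> Q `<=` kernel ev.
Proof.
move=> [sev _] pQ kQ x Qx; apply: contrapT => /eqP nx; have [z ez] := sev (ev x)^-1.
have idQ := prime_ideal pQ; case: pQ => _ nQ1 _; apply: nQ1.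
have -> : 1 = x * z - (x * z - 1) by rewrite opprB addrC subrK.
apply: idealB => //; first exact: idealMr.
by apply: kQ; rewrite /kernel /= rmorphB rmorphM ez rmorph1 divff // subrr.
Qed.

End Points.

Section PointsAndFiniteness.
Variables (k : fieldType) (C : idomainType) (iota : {rmorphism k -> C}).
Local Notation kS := (range iota).
Local Notation "q ^:C" := (map_poly iota q) (at level 2).

Lemma point_codim (L : fieldExtType k) (ev : {rmorphism C -> L}) : is_point iota ev ->
  codim iota (kernel ev) (\dim {:L}).
Proof.
move=> [sev kev]; pose b := vbasis {:L}.
pose e (i : 'I_(\dim {:L})) := sval (cid (sev b`_i)).
have eE i : ev (e i) = b`_i by rewrite /e; case: cid.
have evE (c : 'I_(\dim {:L}) -> k) : ev (\sum_i iota (c i) * e i) = \sum_i c i *: b`_i.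
  by rewrite rmorph_sum; apply: eq_bigr => i _; rewrite rmorphM kev eE mulr_algl.
exists 'I_(\dim {:L}), e; split; first by rewrite card_ord.
  move=> x; exists (fun i => coord b i (ev x)); rewrite /kernel /= rmorphB evE.
  by rewrite -(coord_vbasis (memvf (ev x))) subrr.
move=> c; rewrite /kernel /= evE => e0; have /freeP h := basis_free (vbasisP {:L}).
exact: h.
Qed.

(** More powers of [y] than the codimension of [m] are dependent modulo [m]. *)
Lemma codim_algebraic (m : set C) n y : is_ideal m -> codim iota m n ->
  exists V, [/\ V \is monic, polyS kS V & m V.[y]].
Proof.
move=> idm [J [e [_ sp _]]].
have [ind|nind] := pselect (indep_mod iota m (fun i : 'I_#|J|.+1 => y ^+ i)).
  by have := indep_card_le idm (fun i : 'I_#|J|.+1 => sp (y ^+ i)) ind; rewrite card_ord ltnn.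
have [c [mc [i ci]]] : exists c : 'I_#|J|.+1 -> k,
    m (\sum_i iota (c i) * y ^+ i) /\ exists i, c i <> 0.
  apply: contrapT => h; apply: nind => c e0 t; apply: contrapT => ct; apply: h.
  by exists c; split=> //; exists t.
pose q := \poly_(i < #|J|.+1) c (inord i).
have q0 : q != 0.
  apply/eqP => q0; apply: ci; have := congr1 (fun q : {poly k} => q`_i) q0.
  by rewrite coef_poly ltn_ord coef0 inord_val.
have V0 : (lead_coef q)^-1 *: q \is monic.
  by rewrite monicE lead_coefZ mulVf // lead_coef_eq0.
exists ((lead_coef q)^-1 *: q) ^:C; split; [exact: monic_map | exact: polyS_map |].
rewrite map_polyZ hornerZ; apply: idealM => //; move: mc; congr m.
rewrite (@horner_coef_wide _ #|J|.+1) ?size_map_poly ?size_poly //.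
by apply: eq_bigr => l _; rewrite coef_map coef_poly ltn_ord inord_val.
Qed.

Lemma fin_over_range_unit (a : C) : fin_over kS -> a != 0 -> invertible a.
Proof.
move=> fin a0; have sk := subring_range iota.
have [f [Sf fm fa]] := fin_over_integral a sk fin.
have [z [Sz z0]] := algebraic_multiple sk Sf (monic_neq0 fm) fa a0.
by have [w e] := range_alg_unit Sz z0; exists (z * w); rewrite mulrA.
Qed.

(** [T] embeds in the finite-dimensional quotient by [m], so a longest family in [T] that is
    independent modulo [m] spans [T]. *)
Lemma transversal_subring_finite (T m : set C) n : is_ideal m -> codim iota m n -> subring T -> kS `<=` T ->
    (forall u, T u -> m u -> u = 0) ->
  exists s (t : 'I_s -> C), forall x, T x -> exists2 c : 'I_s -> C,
    forall i, kS (c i) & x = \sum_i c i * t i.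
Proof.
move=> idm [J [e [_ sp _]]] sT kT Tm.
pose R s := `[< exists2 t : 'I_s -> C, forall i, T (t i) & indep_mod iota m t >].
have exR : exists s, R s.
  by exists 0%N; apply/asboolP; exists (fun=> 0) => [[]//|c _ []].
have bR s : R s -> (s <= #|J|)%N.
  by move=> /asboolP[t _ ind]; have := indep_card_le idm (fun i => sp (t i)) ind; rewrite card_ord.
case: (ex_maxnP exR bR) => s /asboolP[t Tt ind] maxs; exists s, t => x Tx.
pose t' (i : 'I_s.+1) := if unlift ord0 i is Some l then t l else x.
have Tt' i : T (t' i) by rewrite /t'; case: unlift.
have nind : ~ indep_mod iota m t'.
  move=> ind'; have : R s.+1 by apply/asboolP; exists t'.
  by move/maxs; rewrite ltnn.
have [c [mc [i ci]]] : exists c : 'I_s.+1 -> k,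
    m (\sum_i iota (c i) * t' i) /\ exists i, c i <> 0.
  apply: contrapT => h; apply: nind => c e0 l; apply: contrapT => cl; apply: h.
  by exists c; split=> //; exists l.
have {}mc : \sum_i iota (c i) * t' i = 0.
  apply: Tm => //; apply: subring_sum => // l _; case: (sT) => _ _; apply=> //.
  by apply: kT; exists (c l).
move: mc; rewrite big_ord_recl /t' unlift_none; under eq_bigr do rewrite liftK; move=> mc.
have c0 : c ord0 != 0.
  apply/eqP => c0; apply: ci; case: (unliftP ord0 i) => [l ->|->//].
  apply: (ind (fun l => c (lift ord0 l))); move: mc; rewrite c0 rmorph0 mul0r add0r => ->.
  exact: ideal0.
exists (fun l => iota (- (c (lift ord0 l) / c ord0))) => [l|]; first by exists (- (c (lift ord0 l) / c ord0)).
apply: (@mulfI _ (iota (c ord0))); first by rewrite fmorph_eq0.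
move: mc => /eqP; rewrite addr_eq0 => /eqP ->; rewrite mulr_sumr -sumrN.
apply: eq_bigr => l _; rewrite mulrA -rmorphM.
have -> : c ord0 * - (c (lift ord0 l) / c ord0) = - c (lift ord0 l) by field.
by rewrite rmorphN mulNr.
Qed.

Lemma fin_over_adj_field (T : set C) y s (t : 'I_s -> C) : subring T ->
    (forall x, T x -> exists2 c : 'I_s -> C, forall i, kS (c i) & x = \sum_i c i * t i) ->
  fin_over (adj T y) -> fin_over (adj kS y).
Proof.
move=> sT hT; have sA := adj_subring y (subring_range iota).
apply: (@fin_over_trans _ _ _ s t) => // _ [P TP ->].
have ex i : exists c : 'I_s -> C, (forall l, kS (c l)) /\ P`_i = \sum_l c l * t l.
  by have [c Sc e] := hT _ (TP i); exists c.
pose c i := sval (cid (ex i)).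
exists (fun l => \sum_(i < size P) c i l * y ^+ i).
  move=> l; apply: subring_sum => // i _; have [_ _ SM] := sA; apply: SM.
    by apply: adj_sub; [exact: subring_range | have [h _] := svalP (cid (ex i)); apply: h].
  by apply: subringX => //; apply: adj_gen; apply: subring_range.
rewrite horner_coef; under [RHS]eq_bigr do rewrite mulr_suml.
rewrite exchange_big /=; apply: eq_bigr => i _.
have [_ ->] := svalP (cid (ex i)); rewrite mulr_suml; apply: eq_bigr => l _.
by rewrite -/(c i) mulrAC.
Qed.

(** That [m] is principal locally forces dimension one: in a normalization over [T[y]] the subring
    [T] meets [m] in zero, so it is finite over [k] and can be absorbed into the module
    generators. *)
Lemma curve_finite (m : set C) n a : finitely_generated_algebra iota -> noetherian C ->
    is_prime_ideal m -> codim iota m n -> a != 0 -> m a ->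
    (forall x, m x -> sat m (gens [:: a]) x) ->
  exists y, fin_over (adj kS y).
Proof.
move=> fg nC pm cm a0 ma ha; have idm := prime_ideal pm.
have [fin|[T [y [sT kT tr fin]]]] := noether_normalization fg.
  have [z az] := fin_over_range_unit fin a0.
  by case: pm => _ n1 _; case: n1; rewrite -az; apply: idealMr.
have [V [Vm SV mV]] := codim_algebraic y idm cm.
have Tm := uniformizer_transversal nC pm sT tr fin a0 ma ha
  (ex_intro _ V (And3 Vm (fun i => kT _ (SV i)) mV)).
have [s [t ht]] := transversal_subring_finite idm cm sT kT Tm.
by exists y; apply: fin_over_adj_field sT ht fin.
Qed.

Section FreeBasis.
Variable g : C.
Hypothesis finC : fin_over (adj kS g).
Hypothesis trg : forall q : {poly k}, q ^:C.[g] = 0 -> q = 0.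

(* A relation of minimal total degree between a minimal number of generators would
   shrink under Euclidean division. *)
Lemma free_basis : exists s (e : 'I_s -> C), (forall x, exists q, x = rep iota g e q) /\
  forall q, rep iota g e q = 0 -> forall l, q l = 0.
Proof.
pose R s := `[< exists e : 'I_s -> C, forall x, exists q, x = rep iota g e q >].
have exR : exists s, R s.
  by have [s [e he]] := finC; exists s; apply/asboolP; exists e; apply: rep_ex.
case: (ex_minnP exR) => s /asboolP[e0 he0] mins.
suff key n : forall (e : 'I_s -> C) (q : 'I_s -> {poly k}), (\sum_l size (q l) < n)%N ->
    (forall x, exists q, x = rep iota g e q) -> rep iota g e q = 0 -> forall l, q l = 0.
  by exists s, e0; split=> // q; apply: key he0; apply: ltnSn.
elim: n => // n IH e q; rewrite ltnS => qn he e0' l0; apply/eqP; apply: contrapT => /negP ql0.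
have [[l1 [l10 ql1]]|h] := pselect (exists l1, l1 != l0 /\ q l1 != 0); last first.
  have only l : l != l0 -> q l = 0.
    by move=> ll0; apply/eqP; apply: contrapT => /negP h'; apply: h; exists l.
  have el0 : e l0 = 0.
    move: e0'; rewrite /rep (bigD1 l0) //= big1 ?addr0; last first.
      by move=> l /only->; rewrite rmorph0 horner0 mul0r.
    move/eqP; rewrite mulf_eq0 => /orP[/eqP/trg/eqP|/eqP//]; by rewrite (negPf ql0).
  case: s l0 e he el0 mins {IH e0 he0 q qn e0' ql0 h only} => [[]//|s] l0 e he el0 mins.
  have : R s.
    apply/asboolP; exists (fun l => e (lift l0 l)) => x; have [q ->] := he x.
    by exists (fun l => q (lift l0 l)); rewrite /rep (bigD1_ord l0) //= el0 mulr0 add0r.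
  by move/mins; rewrite ltnn.
wlog sz : l0 l1 l10 ql0 ql1 / (size (q l1) <= size (q l0))%N.
  by move=> W; have [h|/ltnW h] := leqP (size (q l1)) (size (q l0));
    [apply: (W l0 l1) | apply: (W l1 l0); rewrite // eq_sym].
pose d := q l0 %/ q l1; pose r := q l0 %% q l1.
(* Adding [d] times [e l0] to [e l1] turns the coefficient [q l0] into its remainder modulo
   [q l1]. *)
pose e' l := if l == l1 then e l1 + d ^:C.[g] * e l0 else e l.
pose upd (q : 'I_s -> {poly k}) (l : 'I_s) := if l == l0 then q l0 - d * q l1 else q l.
have updE q' : rep iota g e' (upd q') = rep iota g e q'.
  rewrite /rep (bigD1 l0) //= (bigD1 l1) //= [RHS](bigD1 l0) //= [X in _ = _ + X](bigD1 l1) //=.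
  rewrite /upd /e' eqxx (negPf l10) eqxx eq_sym (negPf l10) !addrA; congr (_ + _).
    by rewrite rmorphB rmorphM !hornerE; ring.
  by apply: eq_bigr => l /andP[/negPf-> /negPf->].
have he' x : exists q, x = rep iota g e' q.
  by have [q' ->] := he x; exists (upd q').
have qn' : (\sum_l size (upd q l) < n)%N.
  apply: leq_trans qn; rewrite (bigD1 l0) //= [X in (_ < X)%N](bigD1 l0) //= -addSn.
  apply: leq_add; last first.
    by apply: leq_sum => l /negPf ll0; rewrite /upd ll0.
  have e1 : q l0 - d * q l1 = r by rewrite {1}(divp_eq (q l0) (q l1)) addrAC subrr add0r.
  rewrite /upd eqxx e1.
  by apply: leq_trans sz; rewrite ltn_modp.
have := IH e' (upd q) qn' he'; rewrite updE => /(_ e0' l1).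
by rewrite /upd (negPf l10) => /eqP; rewrite (negPf ql1).
Qed.

(** In a basis over [k[g]], passing to the fibre over [c] evaluates coordinates at [c], so the
    dimension is the rank for every [c]. *)
Lemma codim_fibers : exists s, forall c, codim iota (gens [:: g - iota c]) s.
Proof.
have [s [e [he fe]]] := free_basis; exists s => c.
have idg := gens_ideal [:: g - iota c].
have repD q q' : rep iota g e (fun l => q l + q' l) = rep iota g e q + rep iota g e q'.
  by rewrite /rep -big_split; apply: eq_bigr => l _; rewrite rmorphD hornerD mulrDl.
have repM q q' : rep iota g e (fun l => q * q' l) = q ^:C.[g] * rep iota g e q'.
  by rewrite /rep mulr_sumr; apply: eq_bigr => l _; rewrite rmorphM hornerM mulrA.
have XC : ('X - c%:P) ^:C.[g] = g - iota c by rewrite map_polyXsubC hornerXsubC.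
exists 'I_s, e; split; first by rewrite card_ord.
  move=> x; have [q ->] := he x; exists (fun l => (q l).[c]); apply/gens1.
  exists (rep iota g e (fun l => q l %/ ('X - c%:P))); rewrite mulrC -XC -repM.
  apply/eqP; rewrite subr_eq; apply/eqP.
  have -> : \sum_l iota (q l).[c] * e l = rep iota g e (fun l => (q l).[c]%:P).
    by apply: eq_bigr => l _; rewrite map_polyC hornerC.
  rewrite -repD; apply: eq_bigr => l _; congr (_ ^:C.[g] * _).
  by rewrite {1}(divp_eq (q l) ('X - c%:P)) modp_XsubC mulrC.
move=> d /gens1[r]; have [q ->] := he r; rewrite mulrC -XC -repM.
have -> : \sum_l iota (d l) * e l = rep iota g e (fun l => (d l)%:P).
  by apply: eq_bigr => l _; rewrite map_polyC hornerC.
move=> e0 l; have := fe (fun l => (d l)%:P - ('X - c%:P) * q l).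
have repN q' : rep iota g e (fun l => - q' l) = - rep iota g e q'.
  by rewrite /rep -sumrN; apply: eq_bigr => i _; rewrite rmorphN hornerN mulNr.
rewrite repD repN e0 subrr => /(_ erefl l) h.
have := congr1 (horner^~ c) h; rewrite !hornerE subrr mul0r subr0; exact.
Qed.

End FreeBasis.

(** Coefficients over [k[b]] are reduced modulo [q], so finitely many products [b ^+ i * e l] span
    the quotient. *)
Lemma fin_over_codim (I : set C) b (q : {poly k}) : is_ideal I -> fin_over (adj kS b) ->
  q != 0 -> I q ^:C.[b] -> exists n, codim iota I n.
Proof.
move=> idI [s [e he]] q0 Iq.
apply: (@codim_spanned _ _ iota I ('I_s * 'I_(size q))%type (fun t => b ^+ t.2 * e t.1)) => // x.
have [P ->] := rep_ex he x.
exists (fun t : 'I_s * 'I_(size q) => (P t.1 %% q)`_(t.2)).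
rewrite -(pair_bigA _ (fun (l : 'I_s) (i : 'I_(size q)) => iota (P l %% q)`_i * (b ^+ i * e l))) /= /rep -sumrB.
apply: ideal_sum => // l _; rewrite {1}(divp_eq (P l) q) rmorphD rmorphM hornerD hornerM.
have -> : \sum_(i < size q) iota (P l %% q)`_i * (b ^+ i * e l) = (P l %% q) ^:C.[b] * e l.
  rewrite (@horner_coef_wide _ (size q)) ?size_map_poly; last by rewrite ltnW // ltn_modp.
  by rewrite mulr_suml; apply: eq_bigr => i _; rewrite coef_map mulrA.
by rewrite mulrDl addrK; apply: idealMr => //; apply: idealM.
Qed.

End PointsAndFiniteness.

(** * The index at a regular point of a curve *)

Section Curve.
Variables (k : fieldType) (p : nat) (C : idomainType) (iota : {rmorphism k -> C}).
Hypotheses (pk : p \in [pchar k]) (kinf : infinite_ring k).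
Hypothesis fg : finitely_generated_algebra iota.
Local Notation kS := (range iota).
Local Notation "q ^:C" := (map_poly iota q) (at level 2).

(** [u ^+ n] lies in the square of [m]. With [t u = v a] one has [(t ^+ n + c a ^+ n.-1 v ^+ n) a =
    t ^+ n (a + c u ^+ n)], and the factor of [a] on the left is outside [m]. *)
Lemma uniformizer_shift (m : set C) a u c n : is_prime_ideal m -> m a -> m u -> (1 < n)%N ->
    (forall x, m x -> sat m (gens [:: a]) x) ->
  m (a + c * u ^+ n) /\ forall x, m x -> sat m (gens [:: a + c * u ^+ n]) x.
Proof.
move=> pm ma mu n1 ha; have idm := prime_ideal pm.
have mun : m (u ^+ n) by rewrite -(prednK (ltnW n1)) exprS; apply: idealMr.
split; first by apply: idealD => //; apply: idealM.
move=> x /ha[s [ns /gens1[r e]]]; have [t [nt /gens1[v ev]]] := ha u mu.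
exists (s * (t ^+ n + c * a ^+ n.-1 * v ^+ n)); split.
  apply: primeNM => // h; apply: (primeX (n := n) pm nt); apply: idealDr h => //.
  apply: idealMr => //; apply: idealM => //.
  by case: n n1 {mun} => [//|[//|n]] _; rewrite /= exprS; apply: idealMr.
apply/gens1; exists (t ^+ n * r).
rewrite mulrAC e -(prednK (ltnW n1)) /=; move: (n.-1) => l.
have -> : t ^+ l.+1 * r * (a + c * u ^+ l.+1) = r * (t ^+ l.+1 * a) + r * c * (t * u) ^+ l.+1.
  by rewrite exprMn; ring.
by rewrite ev exprMn [a ^+ l.+1]exprS; ring.
Qed.

(** As derivations are proportional, it suffices that one non-zero [D0] does not kill [a']. If
    [D0 a = 0], then [a] is multiplied by a [v] outside [m] with [D0 v != 0], namely [y] or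
    [1 + y]. *)
Lemma separating_uniformizer (m : set C) a b : is_prime_ideal m -> frobenius_free p iota ->
    fin_over (adj kS b) -> a != 0 -> m a -> (forall x, m x -> sat m (gens [:: a]) x) ->
  exists a', [/\ a' != 0, m a', forall x, m x -> sat m (gens [:: a']) x &
    forall D : C -> {fraction C}, deriv_on (@tofrac C) setT D -> (forall c, D (iota c) = 0) ->
      D a' = 0 -> forall x, D x = 0].
Proof.
move=> pm frob fin a0 ma ha; have idm := prime_ideal pm.
have [[D0 [dD0 D0k [y D0y]]]|noD] := pselect (exists D0 : C -> {fraction C},
    [/\ deriv_on (@tofrac C) setT D0, forall c, D0 (iota c) = 0 & exists y, D0 y <> 0]); last first.
  exists a; split=> // D dD Dk _ x; apply: contrapT => Dx; apply: noD.
  by exists D; split=> //; exists x.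
have prop D a' : deriv_on (@tofrac C) setT D -> (forall c, D (iota c) = 0) ->
    D0 a' != 0 -> D a' = 0 -> forall x, D x = 0.
  move=> dD Dk Da' Da x; have := derivations_proportional pk frob fin (@tofrac_inj C) dD0 D0k dD Dk a' x.
  by rewrite Da mulr0 => /eqP; rewrite mulf_eq0 (negPf Da') => /eqP.
have [Da|Da] := eqVneq (D0 a) 0; last by exists a; split=> // D dD Dk Da'; apply: (prop D a).
have [v [nv Dv]] : exists v, ~ m v /\ D0 v != 0.
  have [my|nmy] := pselect (m y); last by exists y; split=> //; apply/eqP.
  exists (1 + y); split; first by move=> h; case: pm => _ n1 _; apply: n1; apply: idealDr h.
  by rewrite dD0.1 // (deriv_on1 (subring_setT C) dD0) add0r; apply/eqP.
exists (v * a); split.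
- by rewrite mulf_neq0 //; apply/eqP => v0; apply: nv; rewrite v0; apply: ideal0.
- exact: idealM.
- move=> x /ha[s [ns /gens1[r e]]]; exists (v * s); split; first exact: primeNM.
  by apply/gens1; exists r; rewrite -mulrA e mulrCA.
move=> D dD Dk; apply: prop => //; rewrite dD0.2 // Da mulr0 add0r mulf_neq0 //.
by rewrite tofrac_eq0.
Qed.

(** Substituting [a = g - c b ^+ M] in an integral equation of [a] over [k[b]] gives an equation for
    [b] over [k[g]]. When [M] exceeds the degrees of all coefficients, the power [(- c b ^+ M) ^+ n]
    dominates, so the leading coefficient is a non-zero scalar. *)
Lemma integral_shift a b f : polyS (adj kS b) f -> f \is monic -> f.[a] = 0 ->
  exists M0, forall M c, (M0 < M)%N -> c != 0 ->
    exists F, [/\ polyS (adj kS (a + iota c * b ^+ M)) F, F \is monic & F.[b] = 0].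
Proof.
move=> Sf fm fa; pose n := (size f).-1.
have sf : size f = n.+1 by rewrite prednK // size_poly_gt0 monic_neq0.
have ex i : exists q : {poly k}, f`_i = q ^:C.[b] by apply/adj_range.
pose q i := sval (cid (ex i)); have qE i : f`_i = (q i) ^:C.[b] by rewrite /q; case: cid.
exists (\max_(i < n) size (q i))%N => M c MM c0; set g := a + _.
have sg := adj_subring g (subring_range iota).
have ic0 : iota c != 0 by rewrite fmorph_eq0.
pose h : {poly C} := g%:P - iota c *: 'X^M.
have Sh : polyS (adj kS g) h.
  apply: polySB => //; first by apply: polySC => //; apply: adj_gen; apply: subring_range.
  apply: polySZ => //; last exact: polySXn.
  by apply: adj_sub; [exact: subring_range | exists c].
have sXM : size (iota c *: 'X^M) = M.+1 by rewrite size_scale // size_polyXn.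
have gM : (size (g%:P : {poly C}) < M.+1)%N.
  apply: leq_ltn_trans (size_polyC_leq1 _) _; rewrite ltnS; exact: leq_ltn_trans MM.
have sh : size h = M.+1 by rewrite /h addrC size_polyDl size_polyN sXM.
have lh : lead_coef h = - iota c.
  by rewrite /h addrC lead_coefDl ?size_polyN ?sXM // lead_coefN lead_coefZ lead_coefXn mulr1.
have h0 : h != 0 by rewrite -size_poly_gt0 sh.
have hb : h.[b] = a by rewrite /h !hornerE /g addrK.
have Shn i : polyS (adj kS g) (h ^+ i).
  elim: i => [|i IH]; first by apply: polySC => //; case: sg.
  by rewrite exprS; apply: polySM.
pose G := h ^+ n + \sum_(i < n) (q i) ^:C * h ^+ i.
have shn i : size (h ^+ i) = (M * i).+1.
  have := size_exp h i; rewrite sh /= => e1.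
  by rewrite -e1 prednK // size_poly_gt0 expf_neq0.
have sG : (size (\sum_(i < n) (q i) ^:C * h ^+ i)%R < size (h ^+ n)%R)%N.
  rewrite shn ltnS; apply: leq_trans (size_sum _ _ _) _; apply/bigmax_leqP => i _.
  apply: leq_trans (size_polyMleq _ _) _; rewrite shn addnS /= size_map_poly.
  have qi : (size (q i) <= M)%N by apply: leq_trans (ltnW MM); apply: (leq_bigmax i).
  apply: leq_trans (leq_add qi (leqnn _)) _; rewrite -mulnS leq_mul2l.
  by rewrite ltn_ord orbT.
have lG : lead_coef G = iota ((- c) ^+ n).
  by rewrite /G lead_coefDl // lead_coef_exp lh rmorphXn rmorphN.
have Gb : G.[b] = 0.
  rewrite /G hornerD horner_exp hb horner_sum -[RHS]fa [RHS]horner_coef sf big_ord_recr /= addrC.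
  congr (_ + _).
    by have := monicP fm; rewrite lead_coefE sf /= => ->; rewrite mul1r.
  by apply: eq_bigr => i _; rewrite hornerM horner_exp hb qE.
have SG : polyS (adj kS g) G.
  apply: polySD => //; apply: (big_ind (polyS (adj kS g))) => [|r s|i _].
  - exact: polyS0.
  - exact: polySD.
  - apply: polySM => // l; rewrite coef_map; apply: adj_sub; first exact: subring_range.
    by exists (q i)`_l.
have cn0 : (- c) ^+ n != 0 by rewrite expf_neq0 // oppr_eq0.
exists (iota ((- c) ^+ n)^-1 *: G); split.
- apply: polySZ => //; apply: adj_sub; first exact: subring_range.
  by exists ((- c) ^+ n)^-1.
- by rewrite monicE lead_coefZ lG -rmorphM mulVf // rmorph1.
- by rewrite hornerZ Gb mulr0.
Qed.

Lemma finite_codim_maximal (Q Q' : set C) n : is_prime_ideal Q -> codim iota Q n ->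
  is_prime_ideal Q' -> Q `<=` Q' -> Q' `<=` Q.
Proof.
move=> pQ cQ pQ' QQ'; have [L [ev [sev kev evk _]]] := residue_field pQ cQ.
move=> x Q'x; apply/kev; apply: (@kernel_maximal _ _ iota L ev Q' _ pQ') => //.
by move=> z /kev/QQ'.
Qed.

(** The function is [g = a1 + c u^p + c' b^M] with [p] dividing [M]. Every [k]-derivation sees only
    [a1], and the added terms lie in the square of [m], so [g] is still a uniformizer. The term in
    [u] moves [g] off the zeros of [h] other than [m]; the term in [b] makes [C] finite over
    [k[g]]. *)
Theorem curve_index (L0 : fieldExtType k) (ev0 : {rmorphism C -> L0}) a (N : nat) :
    frobenius_free p iota -> is_point iota ev0 ->
    a != 0 -> kernel ev0 a -> (forall x, kernel ev0 x -> sat (kernel ev0) (gens [:: a]) x) ->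
    (forall (L : fieldExtType k) (ev : {rmorphism C -> L}), is_point iota ev ->
       separable 1 {:L} -> (N %| \dim {:L})%N) ->
  (N %| \dim {:L0})%N.
Proof.
move=> frob pt0 a0 ma0 ha0 hN; set m := kernel ev0 in ma0 ha0.
have nC := fg_noetherian fg; have pm : is_prime_ideal m := kernel_prime ev0.
have idm := prime_ideal pm; have cm : codim iota m (\dim {:L0}) := point_codim pt0.
have sk := subring_range iota; have [_ nm1 _] := pm.
have [y finy] := curve_finite fg nC pm cm a0 ma0 ha0.
have [a1 [a10 ma1 ha1 sep1]] := separating_uniformizer pm frob finy a0 ma0 ha0.
have [l hl] := fg_adjs fg.
have sS1 := adj_subring a1 sk.
have hl1 x : adjs (adj kS a1) l x.
  move: x (hl x) => x; apply: adjs_min; first exact: adjs_subring.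
    by apply: subset_trans (adj_sub a1 sk) _; apply: adjs_sub.
  by move=> z zl; apply: adjs_gen.
(* A derivation into the fraction field that kills [k] and [a1] is zero, so the tower over [k[a1]]
   is separable off the zeros of some [h]. *)
have [h [h0 hF _]] : adjs_separable (adj kS a1) l.
  have [[D [dD DS [z _ Dz]]]|//] := separable_tower (@tofrac_inj C) l sS1.
  have dD' : deriv_on (@tofrac C) setT D by apply: deriv_on_sub dD => x _.
  by move: Dz; rewrite (sep1 D dD') ?eqxx //; [move=> c; apply: DS; apply: adj_sub => //; exists c | apply: DS; apply: adj_gen].
(* A derivation of the residue field over [k] pulls back to [C], where it kills [g], hence [a1],
   because the other terms are scalars times p-th powers. *)
have separable_outside (L : fieldExtType k) (ev : {rmorphism C -> L}) u b g c c' c'' M :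
    is_point iota ev -> ev h != 0 -> g = a1 + iota c * u ^+ p + iota c' * b ^+ (M * p) ->
    ev (g - iota c'') = 0 -> separable 1 {:L}.
  move=> [sev kev] evh eg evg; apply: separable_no_derivation => D dD kD.
  pose d x := D (ev x).
  have pL : p \in [pchar L] := pchar_alg pk (in_alg L).
  have dd : deriv_on ev setT d.
    split=> x z _ _; rewrite /d; first by rewrite rmorphD linearD.
    by rewrite rmorphM (Derivation_mul dD) ?memvf // addrC [D _ * _]mulrC.
  have Dk e : d (iota e) = 0.
    by rewrite /d kev; apply/eqP; rewrite -memv_ker; apply: (subvP kD); rewrite memvZ // memv_line.
  have sT := subring_setT C.
  have dpth e z : d (iota e * z ^+ p) = 0.
    by rewrite dd.2 // Dk mulr0 addr0 (deriv_pth z pL dd) mulr0.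
  have da1 : d a1 = 0.
    have : d (g - iota c'') = 0 by rewrite /d evg linear0.
    rewrite (deriv_onB sT dd) // Dk subr0 eg !dd.1 // exprM !dpth !addr0.
    done.
  have d0 x : d x = 0.
    apply: (hF L ev d dd _ evh x (hl1 x)) => _ [q Sq ->].
    rewrite (deriv_horner (p := q) sT dd) // /tot da1 mulr0 addr0.
    rewrite (_ : map_poly d q = 0) ?horner0 //; apply/polyP => i.
    by rewrite coef_map_id0 ?(deriv_on0 sT dd) // coef0; have [e _ <-] := Sq i.
  apply/lfunP => z; have [x <-] := sev z; rewrite lfunE; exact: d0.
(* Replacing [y] by the monic expression [V.[y]] puts the coordinate into [m], and [C] stays finite
   over it. *)
have [V [Vm SV mV]] := codim_algebraic y idm cm.
set b := V.[y] in mV; have sSb := adj_subring b sk.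
have finb : fin_over (adj kS b).
  have V1 : (1 < size V)%N.
    rewrite ltnNge; apply/negP => /size1_polyC; move: (V`_0) => v eV; apply: nm1.
    by move: mV (monicP Vm); rewrite /b eV hornerC lead_coefC => mV <-.
  apply: (@fin_over_adj _ _ (V - b%:P) y) => //.
  - apply: polySB => //; last by apply: polySC => //; apply: adj_gen.
    by move=> i; apply: adj_sub.
  - rewrite monicE lead_coefDl ?(monicP Vm) // size_polyN.
    exact: leq_ltn_trans (size_polyC_leq1 _) _.
  - by rewrite hornerD hornerN hornerC subrr.
  apply: fin_over_sub finy; apply: adj_min; first exact: adj_subring.
    by apply: subset_trans (adj_sub b sk) _; apply: adj_sub.
  exact: adj_gen.
have [lQ [lQ1 lQ2]] := minimal_primes nC (gens_ideal [:: h]).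
have hh : gens [:: h] h by apply: adds_gen ideal_set0 _; rewrite mem_head.
have lQcodim Q : List.In Q lQ -> exists n, codim iota Q n.
  move=> /lQ1[pQ hQ]; have [f [Sf fm fh]] := fin_over_integral h sSb finb.
  have [z [/adj_range[q eq] hz]] := algebraic_multiple sSb Sf (monic_neq0 fm) fh h0.
  apply: (fin_over_codim (prime_ideal pQ) finb (q := q)).
    by apply: contraNneq hz => q0; rewrite eq q0 rmorph0 horner0.
  by rewrite -eq; apply: idealMr; [exact: prime_ideal | exact: hQ].
(* These are the zeros of [h] to be avoided; the point [m] itself, where [h] may vanish, is taken
   out of the list. *)
pose l' := [seq Q <- lQ | ~~ `[< m `<=` Q >]].
have l'P Q : List.In Q l' <-> List.In Q lQ /\ ~ m `<=` Q.
  rewrite (List.filter_In _ Q lQ); split=> -[h1 h2]; split=> //; exact/asboolPn.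
have l'id Q : List.In Q l' -> is_ideal Q by move=> /l'P[/lQ1[/prime_ideal]].
have [sm esm] := (noetherianP C).1 nC m idm.
have [u mu hu] := avoid_primes iota kinf 0 sm l'id.
have {}mu : m u by rewrite esm -[u]subr0.
have {}hu Q : List.In Q l' -> ~ Q u.
  move=> Ql; apply: hu => // -[_ Qs]; have [_] := (l'P Q).1 Ql; apply.
  by rewrite esm; apply: gens_min => //; apply: l'id.
have p0 := prime_gt0 (pcharf_prime pk); have p1 := prime_gt1 (pcharf_prime pk).
have Qpow Q n x : List.In Q l' -> Q (x ^+ n) -> Q x.
  by move=> /l'P[/lQ1[pQ _] _] Qx; apply: contrapT => /(primeX (n := n) pQ).
have [c _ hc] := generic_scalar iota kinf [::] a1 (u ^+ p) l'id.
set a2 := a1 + iota c * u ^+ p in hc.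
have {}hc Q : List.In Q l' -> ~ Q a2.
  by move=> Ql; apply: hc => // -[_ /Qpow-/(_ Ql)]; exact: hu.
have [ma2 ha2] := uniformizer_shift (iota c) pm ma1 mu p1 ha1.
have [f [Sf fm fa2]] := fin_over_integral a2 sSb finb.
have [M0 hM0] := integral_shift Sf fm fa2.
(* A multiple of [p], so that derivations do not see [b ^+ M]; above [M0] for integrality and above
   1 for [uniformizer_shift]. *)
pose M := (M0.+2 * p)%N.
have M0M : (M0 < M)%N by apply: leq_trans (leq_pmulr _ p0); rewrite ltnW.
have M1 : (1 < M)%N by apply: leq_trans (leq_pmulr _ p0).
have [c' c'0 hc'] := generic_scalar iota kinf [:: 0] a2 (b ^+ M) l'id.
set g := a2 + iota c' * b ^+ M in hc'.
have {}hc' Q : List.In Q l' -> ~ Q g by move=> Ql; apply: hc' => // -[/hc-/(_ Ql)].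
have {}c'0 : c' != 0 by move: c'0; rewrite inE.
have [mg hg] := uniformizer_shift (iota c') pm ma2 mV M1 ha2.
have sSg := adj_subring g sk.
have fing : fin_over (adj kS g).
  have [F [SF Fm Fb]] := hM0 M c' M0M c'0; apply: (fin_over_adj sSg SF Fm Fb).
  apply: fin_over_sub finb; apply: adj_min; first exact: adj_subring.
    by apply: subset_trans (adj_sub g sk) _; apply: adj_sub.
  exact: adj_gen.
have trg (q : {poly k}) : q ^:C.[g] = 0 -> q = 0.
  move=> qg; apply/eqP; apply: contrapT => /negP q0.
  have [n cn] := fin_over_codim ideal_set0 fing q0 qg.
  have p00 : is_prime_ideal [set (0 : C)].
    split; [exact: ideal_set0 | by move=> /eqP; rewrite oner_eq0 |].
    by move=> x z /= /eqP; rewrite mulf_eq0 => /orP[]/eqP; [left | right].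
  have m0 := finite_codim_maximal p00 cn pm; move/eqP: a0; apply.
  by apply: m0 => // _ ->; apply: ideal0.
have [s cs] := codim_fibers fing trg.
have bad Q : is_prime_ideal Q -> Q h -> exists2 Q1, List.In Q1 lQ & Q = Q1.
  move=> pQ Qh; have [Q1 Q1l Q1Q] : exists2 Q1, List.In Q1 lQ & Q1 `<=` Q.
    by apply: lQ2 => //; apply: gens_min; [exact: prime_ideal | move=> z; rewrite inE => /eqP->].
  have [n cn] := lQcodim Q1 Q1l; exists Q1 => //; apply/seteqP; split=> //.
  exact: (finite_codim_maximal (lQ1 _ Q1l).1 cn pQ Q1Q).
have Qm Q : is_prime_ideal Q -> Q h -> ~ List.In Q l' -> Q = m.
  move=> pQ Qh nQl; have [Q1 Q1l eQ] := bad Q pQ Qh; subst Q1.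
  have mQ : m `<=` Q by apply: contrapT => nmQ; apply: nQl; apply/l'P.
  by apply/seteqP; split=> //; apply: (kernel_maximal pt0).
have divide (I : set C) n c'' : is_ideal I -> codim iota I n -> I (g - iota c'') ->
    (forall Q, is_prime_ideal Q -> I `<=` Q -> ~ Q h) -> (N %| n)%N.
  move=> idI cI Ig nh; apply: (dvd_codim nC idI cI) => Q n' pQ IQ cQ.
  have [L [ev [sev kev evk <-]]] := residue_field pQ cQ.
  apply: (hN L ev) => //; apply: (@separable_outside L ev u b g c c' c'' M0.+2) => //.
    by apply/eqP => /kev; apply: nh.
  exact/kev/IQ.
(* A non-zero [c''] keeps [m] off the fibre [g = c''], and genericity keeps the other zeros of [h]
   off it. *)
have [c'' c''0 hc''] := generic_scalar iota kinf [:: 0] g (-1) l'id.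
have {}c''0 : c'' != 0 by move: c''0; rewrite inE.
rewrite mulrN1 in hc''.
have Ns : (N %| s)%N.
  apply: (divide (gens [:: g - iota c'']) s c''); [exact: gens_ideal | exact: cs | |].
    by apply: adds_gen ideal_set0 _; rewrite mem_head.
  move=> Q pQ gQ Qh; have Qg : Q (g - iota c'').
    by apply: gQ; apply: adds_gen ideal_set0 _; rewrite mem_head.
  have [Ql|nQl] := pselect (List.In Q l').
    apply: (hc'' Q Ql) Qg => -[_ Q1]; case: pQ => idQ nQ1 _; apply: nQ1.
    by rewrite -[1]opprK; apply: idealN.
  have eQ := Qm Q pQ Qh nQl; rewrite eQ in Qg.
  apply: nm1; have : m (iota c'').
    by rewrite -[iota c''](subKr g); apply: idealB.
  by move/(idealM idm (iota c''^-1)); rewrite -rmorphM mulVf // rmorph1.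
(* Multiplicity one: a single [t] outside [m] carries [m] into [(g)], so [colon (gens [:: g]) t] is
   [m], and the fibre of [g] splits into [m] and the fibre of [idadd (gens [:: g]) t], which avoids
   [m]. *)
have [t nt ht] : exists2 t, ~ m t & forall x, gens sm x -> gens [:: g] (t * x).
  have : forall x, x \in sm -> sat m (gens [:: g]) x.
    by move=> x xs; apply: hg; rewrite esm; apply: adds_gen xs; apply: ideal_set0.
  have idg := gens_ideal [:: g].
  elim: sm {esm} => [|x r IH] hs.
    by exists 1 => // z ->; rewrite mulr0; apply: ideal0.
  have [|t nt ht] := IH; first by move=> z zr; apply: hs; rewrite inE zr orbT.
  have [t' [nt' ht']] := hs x (mem_head _ _).
  exists (t * t'); first exact: primeNM.
  move=> z /gens_cons[w hw]; rewrite -(subrK (w * x) z) mulrDr; apply: idealD => //.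
    by rewrite mulrAC; apply: idealMr => //; apply: ht.
  by rewrite -mulrA mulrCA [t * _]mulrC mulrA; apply: idealMr => //; rewrite mulrCA; apply: idealM.
have idg := gens_ideal [:: g].
have colon_m : colon (gens [:: g]) t = m.
  apply/seteqP; split=> x; rewrite /colon /=; last by rewrite mulrC => mx; apply: ht; rewrite -esm.
  move=> /gens1[r e]; have : m (t * x) by rewrite mulrC e; apply: idealM.
  by move/(primeM pm); apply.
have idgt := idadd_ideal t idg.
have ggt : idadd (gens [:: g]) t g.
  by apply: idadd_sub; apply: adds_gen ideal_set0 _; rewrite mem_head.
have [n1 cn1] : exists n, codim iota (idadd (gens [:: g]) t) n.
  apply: (fin_over_codim idgt fing (q := 'X)); first by rewrite polyX_eq0.
  by rewrite map_polyX hornerX.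
have cg : codim iota (gens [:: g]) s by have := cs 0; rewrite rmorph0 subr0.
have es : s = (n1 + \dim {:L0})%N.
  have cm' : codim iota (colon (gens [:: g]) t) (\dim {:L0}) by rewrite colon_m.
  exact: (codim_unique idg cg (codim_colon idg cn1 cm')).
have Nn1 : (N %| n1)%N.
  apply: (divide _ n1 0 idgt cn1); first by rewrite rmorph0 subr0.
  move=> Q pQ gQ Qh; have [Ql|nQl] := pselect (List.In Q l').
    by apply: (hc' Q Ql); apply: gQ.
  by apply: nt; rewrite -(Qm Q pQ Qh nQl); apply: gQ; apply: idadd_gen.
by move: Ns; rewrite es dvdn_addr.
Qed.

End Curve.

(** * Hypersurface sections *)

Section Factorization.
Variables (A D : comPzRingType) (q : {rmorphism A -> D}).
Hypothesis qs : forall z, exists x, q x = z.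

Definition preimage_of z : A := sval (cid (qs z)).

Lemma preimage_ofK z : q (preimage_of z) = z.
Proof. by rewrite /preimage_of; case: cid. Qed.

Lemma factor_rmorphism (B : comPzRingType) (f : {rmorphism A -> B}) :
  (forall x, q x = 0 -> f x = 0) -> exists f' : {rmorphism D -> B}, forall x, f' (q x) = f x.
Proof.
move=> qf; pose f' z := f (preimage_of z).
have f'E x : f' (q x) = f x.
  by apply/eqP; rewrite -subr_eq0 -rmorphB qf ?rmorphB ?preimage_ofK ?subrr.
have f'B : {morph f' : x y / x - y}.
  move=> x y; have [a <-] := qs x; have [b <-] := qs y.
  by rewrite -rmorphB !f'E rmorphB.
have f'M : monoid_morphism f'.
  split; first by rewrite -(rmorph1 q) f'E rmorph1.
  move=> x y; have [a <-] := qs x; have [b <-] := qs y.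
  by rewrite -rmorphM !f'E rmorphM.
pose f'A := GRing.isZmodMorphism.Build _ _ f' f'B.
pose f'R := GRing.isMonoidMorphism.Build _ _ f' f'M.
pose F : {rmorphism D -> B} := HB.pack f' f'A f'R.
by exists F.
Qed.

Lemma fg_image (k : fieldType) (iota : {rmorphism k -> A}) (iota' : {rmorphism k -> D}) :
  (forall c, iota' c = q (iota c)) ->
  finitely_generated_algebra iota -> finitely_generated_algebra iota'.
Proof.
move=> iE [n [a afg]]; exists n, (q \o a) => S Sk Sa SD SM.
have : [set x | S (q x)] = setT.
  apply: afg => /=.
  - by move=> c; rewrite -iE.
  - exact: Sa.
  - by move=> b c Sb Sc; rewrite rmorphD; apply: SD.
  - by move=> b c Sb Sc; rewrite rmorphM; apply: SM.
move=> ST; apply/seteqP; split=> // z _; have [x <-] := qs z.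
by have : [set x | S (q x)] x by rewrite ST.
Qed.

Lemma prime_image (Q : set D) : is_prime_ideal [set x | Q (q x)] -> is_prime_ideal Q.
Proof.
move=> [[Q0 QD QM] Q1 QP]; split; first split.
- by rewrite -(rmorph0 q).
- move=> a b; have [x <-] := qs a; have [y <-] := qs b; rewrite -rmorphD; exact: QD.
- move=> a b; have [x <-] := qs a; have [y <-] := qs b; rewrite -rmorphM; exact: QM.
- by rewrite -(rmorph1 q).
- by move=> a b; have [x <-] := qs a; have [y <-] := qs b; rewrite -rmorphM; apply: QP.
Qed.

Lemma gens_image (P : set A) s x : (forall x, q x = 0 <-> P x) ->
  gens [seq q i | i <- s] (q x) <-> adds P s x.
Proof.
move=> qP; elim: s x => [|g s IH] x; first exact: qP.
rewrite map_cons gens_cons adds_cons; split=> [[r]|[r /IH h]]; last first.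
  by exists (q r); rewrite -rmorphM -rmorphB.
by have [r' <-] := qs r; rewrite -rmorphM -rmorphB => /IH; exists r'.
Qed.

End Factorization.

(** * Regularity at a prime and its passage to quotients *)

Section RegularAt.
Variable A : comPzRingType.

Definition local_generators (m : set A) s :=
  (forall g, g \in s -> m g) /\ m `<=` sat m (gens s).

(** A form of regularity of dimension [d] that mentions neither the local ring nor chains of primes.
    Quantifying over all systems of [d] local generators is what lets it pass to the quotient by one
    of them. *)
Definition regular_at (m : set A) d :=
  (exists2 s, size s = d & local_generators m s) /\
  forall s, size s = d -> local_generators m s ->
    (forall s1 s2, s = s1 ++ s2 -> is_prime_ideal (sat m (gens s1))) /\
    (forall s1 g s2, s = s1 ++ g :: s2 -> ~ sat m (gens s1) g).

Lemma sat_mono (P I J : set A) : I `<=` J -> sat P I `<=` sat P J.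
Proof. by move=> IJ x [s [ns Is]]; exists s; split=> //; apply: IJ. Qed.

Lemma sat_trans (P I J : set A) : is_prime_ideal P -> I `<=` sat P J -> sat P I `<=` sat P J.
Proof. by move=> pP IJ x [s [ns /IJ]]; apply: sat_saturated. Qed.

Lemma sat_adds (m : set A) g s : is_prime_ideal m ->
  sat m (adds (sat m (gens [:: g])) s) = sat m (gens (g :: s)).
Proof.
move=> pm; have idg := gens_ideal [:: g]; apply/seteqP; split.
  have idgs := sat_ideal pm (gens_ideal (g :: s)).
  apply: (sat_trans pm); apply: (adds_min idgs).
    by apply: sat_mono; apply: gens_sub => x; rewrite !inE => ->.
  by move=> h hs; apply: sub_sat => //; apply: (adds_gen ideal_set0); rewrite inE hs orbT.
by apply: sat_mono; rewrite -cat1s adds_cat; apply: adds_mono; apply: sub_sat.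
Qed.

Lemma local_generators_cons (m : set A) u g r a s : is_prime_ideal m -> ~ m u -> gens s r -> m g ->
  g = u * a + r -> local_generators m (a :: s) -> local_generators m (g :: s).
Proof.
move=> pm nu sr mg gE [sm hm]; split.
  by move=> x; rewrite inE => /predU1P[->//|xs]; apply: sm; rewrite inE xs orbT.
apply: (subset_trans hm); apply: (sat_trans pm); apply: gens_min.
  exact: sat_ideal (gens_ideal _).
have idgs := gens_ideal (g :: s).
have ss : gens s `<=` gens (g :: s) by apply: gens_sub => x xs; rewrite inE xs orbT.
move=> x; rewrite inE => /predU1P[->|xs]; last first.
  by apply: sub_sat => //; apply: ss; apply: adds_gen ideal_set0 _.
exists u; split=> //; have -> : u * a = g - r by rewrite gE addrK.
apply: idealB => //; last exact: ss.
by apply: (adds_gen ideal_set0); rewrite mem_head.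
Qed.

Lemma regular_at_head (m : set A) d g s : is_prime_ideal m -> regular_at m d.+2 ->
    local_generators m (g :: s) -> size s = d.+1 ->
  is_prime_ideal (sat m (gens [:: g])) /\ ~ sat m (gens [:: g]) (head 0 s).
Proof.
move=> pm [_ hs] lg ss; have [|h1 h2] := hs _ _ lg; first by rewrite /= ss.
split; first exact: (h1 [:: g] s).
by case: s ss {lg h1} h2 => // a s _ h2; apply: (h2 [:: g] a s).
Qed.

End RegularAt.

Lemma sat_image (A D : comPzRingType) (q : {rmorphism A -> D}) (P m : set A) (m' : set D) s x :
    (forall z, exists x, q x = z) -> (forall x, q x = 0 <-> P x) -> (forall x, m' (q x) <-> m x) ->
  sat m' (gens [seq q i | i <- s]) (q x) <-> sat m (adds P s) x.
Proof.
move=> qs qP m'E; split.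
  move=> [z [nz]]; have [y yz] := qs z; rewrite -yz in nz *; rewrite -rmorphM => h.
  by exists y; split; [move=> my; apply: nz; apply/m'E | apply/(gens_image qs _ _ qP)].
move=> [y [ny h]]; exists (q y); split; first by move=> /m'E.
by rewrite -rmorphM; apply/(gens_image qs _ _ qP).
Qed.

(** Systems of [d] generators at [m'] lift to systems of [d.+1] generators at [m] that begin with
    [g], and [satE] translates the conditions. *)
Lemma regular_at_quotient (A D : comPzRingType) (q : {rmorphism A -> D}) (m : set A) (m' : set D) d g s :
    (forall z, exists x, q x = z) -> (forall x, q x = 0 <-> sat m (gens [:: g]) x) ->
    (forall x, m' (q x) <-> m x) -> is_prime_ideal m -> m g ->
    local_generators m (g :: s) -> size s = d -> regular_at m d.+1 -> regular_at m' d.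
Proof.
move=> qs qP m'E pm mg [sm hm] sd [_ hreg]; have idm := prime_ideal pm.
have satE t x : sat m' (gens [seq q i | i <- t]) (q x) <-> sat m (gens (g :: t)) x.
  by rewrite -sat_adds //; apply: sat_image.
split.
  exists [seq q i | i <- s]; first by rewrite size_map.
  split; first by move=> _ /mapP[x xs ->]; apply/m'E; apply: sm; rewrite inE xs orbT.
  by move=> z; have [x <-] := qs z; move=> /m'E /hm h; apply/satE.
move=> t td [tm ht]; pose s' := map (preimage_of qs) t.
have tE : t = map q s'.
  by rewrite -map_comp map_id_in // => x _ /=; apply: preimage_ofK.
have [||h1 h2] := hreg (g :: s').
- by rewrite /= size_map td.
- split=> [x|x mx].
    rewrite inE => /predU1P[->//|xs]; apply/m'E; apply: tm; rewrite tE.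
    exact: map_f.
  by apply/satE; rewrite -tE; apply: ht; apply/m'E.
split.
  move=> t1 t2 e; apply: (prime_image qs); have -> : t1 = map q (take (size t1) s').
    by rewrite map_take -tE e take_size_cat.
  have -> : [set x | sat m' (gens [seq q i | i <- take (size t1) s']) (q x)] =
            sat m (gens (g :: take (size t1) s')).
    by apply/seteqP; split=> x /satE.
  by apply: (h1 _ (drop (size t1) s')); rewrite cat_cons cat_take_drop.
move=> t1 z t2 e; pose n := size t1.
have lt : (n < size s')%N by rewrite size_map e size_cat /= -addSnnS leq_addr.
have -> : t1 = map q (take n s') by rewrite map_take -tE e take_size_cat.
have -> : z = q (nth 0 s' n).
  by rewrite -(nth_map 0 0) // -tE e nth_cat ltnn subnn.
by move=> /satE; apply: (h2 _ _ (drop n.+1 s')); rewrite cat_cons -drop_nth // cat_take_drop.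
Qed.

Lemma regular_at0 (A : comPzRingType) (m : set A) a d : is_prime_ideal m -> regular_at m d.+1 ->
  forall s, size s = d -> local_generators m (a :: s) -> a != 0.
Proof.
move=> pm [_ hreg] s sd lg; have [|_ h] := hreg _ _ lg; first by rewrite /= sd.
apply/eqP => a0; apply: (h [::] a s) => //=; rewrite a0; exists 1.
by rewrite mulr0; split=> //; case: pm.
Qed.

(** * Generic hypersurface sections and induction on dimension *)

Section Bertini.
Variables (k : fieldType) (p : nat).
Hypotheses (pk : p \in [pchar k]) (kinf : infinite_ring k).

(* If [b] lay in the prime [P_c] of almost every [g_c := a + c e^p], its local quotient
   by one [g_c] would lie in the remaining ones, giving an infinite ascending chain. *)
Lemma generic_hypersurface (C : idomainType) (iota : {rmorphism k -> C}) (m : set C) a e n b :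
    noetherian C -> is_prime_ideal m ->
    (forall c, m (a + iota c * e ^+ n)) ->
    (forall c, is_prime_ideal (sat m (gens [:: a + iota c * e ^+ n]))) ->
    (forall c, ~ sat m (gens [:: a + iota c * e ^+ n]) e) -> b != 0 ->
  exists c, ~ sat m (gens [:: a + iota c * e ^+ n]) b.
Proof.
move=> nC pm mg pP ne b0; apply: contrapT => nc.
pose g c := a + iota c * e ^+ n; pose P c := sat m (gens [:: g c]).
have ng c c' : c != c' -> ~ P c' (g c).
  move=> cc' h; apply: (primeX (n := n) (pP c') (ne c')).
  have idP := prime_ideal (pP c').
  have c0 : c - c' != 0 by rewrite subr_eq0.
  apply: (prime_scalar (iota := iota) idP c0).
  have -> : iota (c - c') * e ^+ n = g c - g c' by rewrite rmorphB /g; ring.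
  apply: idealB => //; apply: sub_sat => //; apply: adds_gen ideal_set0 _.
  by rewrite mem_head.
pose F : set (set C) := [set I | exists y (s : seq k),
  [/\ I = sat m (gens [:: y]), y != 0 & forall c, c \notin s -> P c y]].
have [I||] := @noeth_max _ nC F (sat m (gens [:: b])).
- by move=> [y [s [-> _ _]]]; apply: sat_ideal => //; apply: gens_ideal.
- by exists b, [::]; split=> // c _; apply: contrapT => h; apply: nc; exists c.
move=> _ [y [s [-> y0 ys]]] ymax.
have [c cs] := kinf s; have [t [nt /gens1[y' e1]]] := ys c cs.
have t0 : t != 0.
  by apply: contra_not_neq nt => ->; apply: ideal0; apply: prime_ideal.
have y'0 : y' != 0.
  by apply: contra_neq (mulf_neq0 t0 y0); rewrite e1 => ->; rewrite mul0r.
have [|||] := ymax (sat m (gens [:: y'])) _ _ y'.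
- exists y', (c :: s); split=> // c'; rewrite inE negb_or => /andP[cc' c's].
  apply: (@primeM _ _ (g c)) (pP c') _ (ng _ _ _); last by rewrite eq_sym.
  have idP := prime_ideal (pP c').
  by have -> : g c * y' = t * y; [rewrite mulrC | apply: idealM => //; apply: ys].
- apply: (sat_trans pm); apply: gens_min; first exact: sat_ideal (gens_ideal _).
  move=> x; rewrite inE => /eqP->; exists t; split=> //.
  by apply/gens1; exists (g c); rewrite e1 mulrC.
- apply: sub_sat => //; apply: adds_gen ideal_set0 _; exact: mem_head.
(* By maximality [y'] is locally a multiple of [y]; cancelling [y] puts [t' * t], which is outside
   [m], into [m]. *)
move=> t' [nt' /gens1[r e2]].
have := primeNM pm nt' nt; apply.
have -> : t' * t = r * g c.
  by apply: (mulIf y0); rewrite -mulrA e1 mulrA e2; ring.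
by apply: idealM (mg c); apply: prime_ideal.
Qed.

Lemma deriv_quotient (C D : idomainType) (q : {rmorphism C -> D}) (E : C -> C) :
  (forall z, exists x, q x = z) -> deriv_on idfun setT E ->
  (forall x, q x = 0 -> q (E x) = 0) ->
  exists E' : D -> D, deriv_on idfun setT E' /\ forall x, E' (q x) = q (E x).
Proof.
move=> qs dE qE; pose E' z := q (E (preimage_of qs z)).
have E'E x : E' (q x) = q (E x).
  apply/eqP; rewrite -subr_eq0 -rmorphB -(deriv_onB (subring_setT C) dE) //; apply/eqP/qE.
  by rewrite rmorphB preimage_ofK subrr.
exists E'; split=> //; split=> x y _ _; have [a <-] := qs x; have [b <-] := qs y.
  by rewrite -rmorphD !E'E dE.1 // rmorphD.
by rewrite -rmorphM !E'E dE.2 // rmorphD !rmorphM.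
Qed.

(** A derivation that kills [g] preserves the prime [sat m (gens [:: g])]. The extra factor
    [w = h * d g ^+ N] makes [E1] multiply [D0] by exactly [(d g * h) ^+ N.+1], as the definition of
    lifting asks. *)
Lemma derivations_lift_quotient (C D : idomainType) (iota : {rmorphism k -> C})
    (q : {rmorphism C -> D}) (iota' : {rmorphism k -> D}) (m : set C) h g (d : C -> C) :
    (forall z, exists x, q x = z) -> (forall c, iota' c = q (iota c)) ->
    is_prime_ideal m -> m g -> (forall x, q x = 0 <-> sat m (gens [:: g]) x) ->
    is_prime_ideal (sat m (gens [:: g])) ->
    deriv_on idfun setT d -> (forall c, d (iota c) = 0) ->
    q (d g * h) != 0 -> derivations_lift iota h -> derivations_lift iota' (q (d g * h)).
Proof.
move=> qs iE pm mg qP pP dd dk q0 [_ lift]; split=> // D0 dD0.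
have [N [E [dE Ek]]] := lift D0 dD0.
have idm := prime_ideal pm; have sT := subring_setT C.
have idP := prime_ideal pP.
pose w := h * d g ^+ N; pose E1 x := w * (d g * E x - E g * d x).
have dE1 : deriv_on idfun setT E1.
  split=> x y _ _; rewrite /E1 /=; first by rewrite dE.1 // dd.1 //; ring.
  by rewrite dE.2 // dd.2 //=; ring.
have E1g : E1 g = 0 by rewrite /E1; ring.
have [|E' [dE' E'E]] := deriv_quotient qs dE1.
  move=> x /qP xP; apply/qP; have [t [nt /gens1[r e]]] := xP.
  have nPt : ~ sat m (gens [:: g]) t.
    move=> [u [nu /gens1[r' e']]]; apply: (primeNM pm nu nt).
    by rewrite e'; apply: idealM.
  apply: (primeM (x := t) pP) => //.
  have := dE1.2 t x I I; rewrite e dE1.2 //= E1g mulr0 add0r => e1.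
  have -> : t * E1 x = E1 r * g - E1 t * x.
    by apply/eqP; rewrite eq_sym subr_eq mulrC e1 [x * _]mulrC.
  apply: idealB => //; first last.
    by apply: idealM.
  by apply: idealM => //; apply: sub_sat => //; apply/gens1; exists 1; rewrite mul1r.
exists N.+1, E'; split=> // c; rewrite !iE E'E -rmorphXn -rmorphM; congr (q _).
by rewrite /E1 dk Ek /w !exprS !exprMn; ring.
Qed.

Theorem point_index d (C : idomainType) (iota : {rmorphism k -> C}) h (L0 : fieldExtType k)
    (ev0 : {rmorphism C -> L0}) (N : nat) :
    finitely_generated_algebra iota -> is_point iota ev0 -> regular_at (kernel ev0) d ->
    derivations_lift iota h ->
    (forall (L : fieldExtType k) (ev : {rmorphism C -> L}), is_point iota ev ->
       separable 1 {:L} -> (N %| \dim {:L})%N) ->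
  (N %| \dim {:L0})%N.
Proof.
elim: d C iota h ev0 => [|[|d] IH] C iota h ev0 fg pt0 reg lift hN;
  have pm := kernel_prime ev0; have idm := prime_ideal pm.
- apply: (hN L0 ev0) => //; apply: (frobenius_free_separable pk).
  (* In dimension zero [m] vanishes locally, so [C] is the residue field and Mac Lane's criterion
     passes to it. *)
  have inj x : ev0 x = 0 -> x = 0.
    have [[s /size0nil-> [_ hs]] _] := reg.
    by move=> /hs[t [nt]] /= /eqP; rewrite mulf_eq0 => /orP[/eqP t0|/eqP//]; case: nt; rewrite t0 /kernel /= rmorph0.
  have [sev kev] := pt0; move=> I e lam e0 lam0.
  have [||mu [mu0 mul mu1]] := lift_frobenius_free pk lift (e := fun i => preimage_of sev (e i)) (lam := lam).
  + apply: inj; rewrite rmorph_sum -[RHS]e0; apply: eq_bigr => i _.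
    by rewrite rmorphM rmorphXn kev preimage_ofK.
  + exact: lam0.
  exists mu; split=> //; rewrite -[RHS](rmorph0 ev0) -[in RHS]mu1 rmorph_sum.
  by apply: eq_bigr => i _; rewrite rmorphM kev preimage_ofK.
- have [s] := reg.1; case: s => [|a [|? ?]] // _ lg.
  have a0 := regular_at0 pm reg (erefl : size [::] = 0%N) lg.
  have [sm hm] := lg.
  apply: (curve_index pk kinf fg (lift_frobenius_free pk lift) pt0 a0 _ hm hN).
  by apply: sm; rewrite mem_head.
have [s] := reg.1; case: s => [|a1 s] // [sd] lg.
have a10 := regular_at0 pm reg sd lg.
have ma1 : kernel ev0 a1 by apply: lg.1; rewrite mem_head.
have na1 : ~ invertible a1.
  by move=> [b ab]; have [_ + _] := pm; apply; rewrite -ab; apply: idealMr.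
have [dl [ddl dk [y dy]]] := exists_derivation fg a10 na1; have sT := subring_setT C.
have pC := pchar_alg pk iota.
(* The parameter [a1] may be killed by [dl]; a suitable multiple by a unit at [m] is not. *)
have [u [nu du]] : exists u, ~ kernel ev0 u /\ dl (u * a1) != 0.
  have [da1|da1] := eqVneq (dl a1) 0; last first.
    by exists 1; rewrite mul1r; split=> //; case: pm.
  have aux u : dl u != 0 -> dl (u * a1) != 0.
    by move=> du; rewrite ddl.2 //= da1 mulr0 add0r mulf_neq0.
  have [my|ny] := pselect (kernel ev0 y); last by exists y; split=> //; apply: aux.
  exists (1 + y); split; last by apply: aux; rewrite ddl.1 // (deriv_on1 sT ddl) add0r.
  by move=> h1; have [_ + _] := pm; apply; apply: (idealDr idm my h1).
pose a := u * a1; pose e := head 0 s; pose g c := a + iota c * e ^+ p.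
have p0 : (0 < p)%N := prime_gt0 (pcharf_prime pk).
have es : e \in s by rewrite /e; case: s sd {lg e g} => // x s _; rewrite mem_head.
have me : kernel ev0 e by apply: lg.1; rewrite inE es orbT.
have mg c : kernel ev0 (g c).
  apply: idealD => //; first exact: idealM.
  by apply: idealM => //; case: (p) p0 => // p' _; rewrite exprS; apply: idealMr.
have lgc c : local_generators (kernel ev0) (g c :: s).
  apply: (local_generators_cons pm nu _ (mg c) _ lg); last by [].
  apply: idealM; first exact: gens_ideal.
  case: (p) p0 => // p' _; rewrite exprS; apply: idealMr; first exact: gens_ideal.
  exact: adds_gen ideal_set0 es.
have dg c : dl (g c) = dl a.
  by rewrite ddl.1 // ddl.2 //= dk (deriv_pth e pC ddl) !mulr0 !addr0.
have h0 : h != 0 by case: lift.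
have [c nPc] : exists c, ~ sat (kernel ev0) (gens [:: g c]) (dl a * h).
  apply: (generic_hypersurface (fg_noetherian fg) pm) => //.
  - by move=> c; apply: (regular_at_head pm reg (lgc c) sd).1.
  - by move=> c; apply: (regular_at_head pm reg (lgc c) sd).2.
  - exact: mulf_neq0.
have pP := (regular_at_head pm reg (lgc c) sd).1.
have [D [q [qs qP]]] := quotient_domain pP.
pose iota' : {rmorphism k -> D} := q \o iota.
have Pm : sat (kernel ev0) (gens [:: g c]) `<=` kernel ev0.
  apply: sat_min => //; apply: gens_min => // x; rewrite inE => /eqP->; exact: mg.
have [x /qP /Pm //|ev0' ev0'E] := factor_rmorphism qs (f := ev0).
have [sev kev] := pt0.
apply: (IH D iota' (q (dl (g c) * h)) ev0').
- exact: (fg_image qs _ fg).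
- split=> [z|c']; last by rewrite ev0'E.
  by have [x <-] := sev z; exists (q x); rewrite ev0'E.
- apply: (regular_at_quotient qs qP _ pm (mg c) (lgc c) sd reg) => x.
  by rewrite /kernel /= ev0'E.
- apply: (derivations_lift_quotient qs _ pm (mg c) qP pP ddl dk _ lift) => //.
  by rewrite dg; apply/eqP => /qP.
move=> L ev [sevL kevL]; apply: (hN L (ev \o q)); split=> [z|c'] /=; last exact: kevL.
by have [y' <-] := sevL z; have [x <-] := qs y'; exists x.
Qed.

End Bertini.

(** * Localizations and dual numbers *)

Section LocalizationLift.
Variables (A B C : comPzRingType) (g : {rmorphism A -> B}) (S : set A).
Hypotheses (S1 : S 1) (SM : forall s t, S s -> S t -> S (s * t)).
Hypothesis frac : forall b, exists s a, S s /\ b * g s = g a.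
Hypothesis ker : forall a, g a = 0 -> exists2 s, S s & s * a = 0.

(** The universal property of fractions for a multiplicative set [S], in a form that serves both
    basic open sets and stalks. *)
Lemma localization_lift (f : {rmorphism A -> C}) : (forall s, S s -> invertible (f s)) ->
  exists f' : {rmorphism B -> C}, forall a, f' (g a) = f a.
Proof.
move=> funit.
have ex b : exists c, forall s a, S s -> b * g s = g a -> f s * c = f a.
  have [s0 [a0 [Ss0 e0]]] := frac b; have [z fz] := funit _ Ss0.
  exists (f a0 * z) => s a Ss e.
  have [|u Su e'] := ker (a := a0 * s - a * s0).
    by rewrite rmorphB !rmorphM -e0 -e; apply/eqP; rewrite subr_eq0 mulrAC.
  have [w fw] := funit _ Su.
  have e'' : f a0 * f s = f a * f s0.
    apply/eqP; rewrite -subr_eq0 -!rmorphM -rmorphB.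
    by rewrite -[f _]mul1r -fw mulrAC -rmorphM e' rmorph0 mul0r.
  by rewrite mulrA [f s * _]mulrC e'' -mulrA fz mulr1.
pose h b := sval (cid (ex b)).
have hP b s a : S s -> b * g s = g a -> f s * h b = f a by rewrite /h; case: cid => c hc; apply: hc.
have uniq s x y : S s -> f s * x = f s * y -> x = y.
  move=> /funit[z fz] e.
  by rewrite -[x]mul1r -[y]mul1r -fz [f s * z]mulrC -!mulrA e.
have hg a : h (g a) = f a.
  by rewrite -[LHS]mul1r -(rmorph1 f); apply: hP => //; rewrite rmorph1 mulr1.
have hB : {morph h : x y / x - y}.
  move=> x y; have [s [a [Ss es]]] := frac x; have [t [b [St et]]] := frac y.
  apply: (uniq (s * t)); first exact: SM.
  have -> : f (s * t) * (h x - h y) = f t * (f s * h x) - f s * (f t * h y).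
    by rewrite rmorphM; ring.
  rewrite (hP _ _ _ Ss es) (hP _ _ _ St et) -!rmorphM -rmorphB.
  apply: hP; first exact: SM.
  by rewrite rmorphB !rmorphM -es -et; ring.
have hM : monoid_morphism h.
  split; first by rewrite -(rmorph1 g) hg rmorph1.
  move=> x y; have [s [a [Ss es]]] := frac x; have [t [b [St et]]] := frac y.
  apply: (uniq (s * t)); first exact: SM.
  have -> : f (s * t) * (h x * h y) = (f s * h x) * (f t * h y).
    by rewrite rmorphM mulrACA.
  rewrite (hP _ _ _ Ss es) (hP _ _ _ St et) -!rmorphM.
  apply: hP; first exact: SM.
  by rewrite !rmorphM -es -et mulrACA.
pose hA := GRing.isZmodMorphism.Build _ _ h hB.
pose hR := GRing.isMonoidMorphism.Build _ _ h hM.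
pose H : {rmorphism B -> C} := HB.pack h hA hR.
by exists H.
Qed.

End LocalizationLift.

Section DualNumbers.
Variable R : comPzRingType.

(** The ring [R[eps]] with [eps ^+ 2 = 0]; a morphism into it is a morphism to [R] together with a
    derivation along it. *)
Definition dual := (R * R)%type.
HB.instance Definition _ := GRing.Zmodule.on dual.

Definition dual_mul (x y : dual) : dual := (x.1 * y.1, x.1 * y.2 + y.1 * x.2).

Lemma dual_mulA : associative dual_mul.
Proof. by move=> x y z; rewrite /dual_mul /=; congr pair; ring. Qed.

Lemma dual_mulC : commutative dual_mul.
Proof. by move=> x y; rewrite /dual_mul /=; congr pair; ring. Qed.

Lemma dual_mul1 : left_id ((1, 0) : dual) dual_mul.
Proof. by move=> [x y]; rewrite /dual_mul /=; congr pair; ring. Qed.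

Lemma dual_mulDl : left_distributive dual_mul +%R.
Proof.
move=> [x x'] [y y'] [z z'].
rewrite -[((x, x') : dual) + (y, y')]/((x + y, x' + y') : dual) /dual_mul /=.
by congr pair; rewrite /=; ring.
Qed.

HB.instance Definition _ := GRing.Zmodule_isComPzRing.Build dual
  dual_mulA dual_mulC dual_mul1 dual_mulDl.

Definition dual_fst (x : dual) : R := x.1.

Lemma dual_fst_additive : {morph dual_fst : x y / x - y}.
Proof. by []. Qed.

Lemma dual_fst_monoid : monoid_morphism dual_fst.
Proof. by []. Qed.

HB.instance Definition _ := GRing.isZmodMorphism.Build dual R dual_fst dual_fst_additive.
HB.instance Definition _ := GRing.isMonoidMorphism.Build dual R dual_fst dual_fst_monoid.

Lemma dual_unit (x : dual) : invertible (dual_fst x) -> invertible x.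
Proof.
move=> [b xb]; exists ((b, - (b * b * x.2)) : dual).
apply: (congr2 pair xb); rewrite /=.
have -> : x.1 * - (b * b * x.2) + b * x.2 = b * x.2 * (1 - dual_fst x * b).
  by rewrite /dual_fst; ring.
by rewrite xb subrr mulr0.
Qed.

Lemma dual_graph (k : comPzRingType) (f : {rmorphism k -> R}) (d : k -> R) :
  (forall x y, d (x + y) = d x + d y) -> (forall x y, d (x * y) = f x * d y + f y * d x) ->
  exists F : {rmorphism k -> dual}, forall x, F x = (f x, d x).
Proof.
move=> dD dM; pose h x : dual := (f x, d x).
have dB x y : d (x - y) = d x - d y by apply: (addIr (d y)); rewrite -dD !subrK.
have hB : {morph h : x y / x - y}.
  by move=> x y; rewrite /h rmorphB dB.
have hM : monoid_morphism h.
  have d1 : d 1 = 0.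
    by apply: (addrI (d 1)); rewrite addr0 -[RHS](congr1 d (mulr1 1)) dM rmorph1 mul1r.
  split; first by rewrite /h rmorph1 d1.
  by move=> x y; rewrite /h rmorphM dM.
pose hA := GRing.isZmodMorphism.Build _ _ h hB.
pose hR := GRing.isMonoidMorphism.Build _ _ h hM.
pose H : {rmorphism k -> dual} := HB.pack h hA hR.
by exists H.
Qed.

End DualNumbers.

Lemma fg_noetherian_pz (k : fieldType) (A : comPzRingType) (iota : {rmorphism k -> A}) :
  finitely_generated_algebra iota -> noetherian A.
Proof.
move=> fg; have [A0|A1] := eqVneq (1 : A) 0.
  apply/noetherianP => I idI; exists [::]; apply/seteqP; split=> [x _|x ->]; last exact: ideal0.
  by rewrite /= -[x]mulr1 A0 mulr0.
pose nz := GRing.PzSemiRing_isNonZero.Build A A1.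
pose A' : comNzRingType := HB.pack (GRing.ComPzRing.sort A) nz.
exact: (@fg_noetherian k A' iota).
Qed.

Section DescendDerivation.
Variables (k : fieldType) (A B : comPzRingType) (C : idomainType).
Variables (iota : {rmorphism k -> A}) (r : {rmorphism A -> B}) (q : {rmorphism A -> C}) (h : A).
Hypotheses (fg : finitely_generated_algebra iota) (loc : is_localization h r).
Hypotheses (qs : forall z, exists x, q x = z) (qh : q h != 0).
Hypothesis qker : forall x, q x = 0 -> exists2 s, q s != 0 & s * x = 0.

(** A power of [h] clears the denominators of [d] on generators. The resulting map is defined up to
    the kernel of [r], which [q] kills because [q h != 0]; it respects the kernel of [q], whose
    members are killed by elements outside it. *)
Lemma descend_derivation (D : k -> k) (d : A -> B) :
    (forall x y, d (x + y) = d x + d y) -> (forall x y, d (x * y) = r x * d y + r y * d x) ->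
    (forall c, d (iota c) = r (iota (D c))) ->
  exists N (E : C -> C), deriv_on idfun setT E /\
    forall c, E (q (iota c)) = q h ^+ N * q (iota (D c)).
Proof.
move=> dD dM dk; have [_ frac ker] := loc.
have rq x : r x = 0 -> q x = 0.
  move=> /ker[n /(congr1 q)/eqP]; rewrite rmorphM rmorphXn rmorph0 mulf_eq0.
  by rewrite (negPf (expf_neq0 n qh)) => /eqP.
have [N hN] : exists N, forall x, exists y, d x * r h ^+ N = r y.
  have [n [a afg]] := fg.
  have ex i : exists M y, d (a i) * r h ^+ M = r y.
    by have [y [M e]] := frac (d (a i)); exists M, y.
  pose M i := sval (cid (ex i)); pose N := (\max_i M i)%N; exists N.
  pose S : set A := [set x | exists y, d x * r h ^+ N = r y].
  suff ST : S = setT by move=> x; have : S x by rewrite ST.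
  apply: afg; rewrite /S /=.
  - by move=> c; exists (iota (D c) * h ^+ N); rewrite dk rmorphM rmorphXn.
  - move=> i; have [y e] : exists y, d (a i) * r h ^+ M i = r y by rewrite /M; case: cid.
    have le : (M i <= N)%N by apply: (leq_bigmax i).
    exists (y * h ^+ (N - M i)).
    by rewrite rmorphM rmorphXn -e -mulrA -exprD subnKC.
  - move=> b c [y ey] [z ez]; exists (y + z).
    by rewrite dD mulrDl ey ez rmorphD.
  - move=> b c [y ey] [z ez]; exists (b * z + c * y).
    by rewrite dM rmorphD !rmorphM -ey -ez; ring.
pose E0 x := sval (cid (hN x)).
have E0P x : r (E0 x) = d x * r h ^+ N by rewrite /E0; case: cid.
have eqq x y : r x = r y -> q x = q y.
  by move=> e; apply/eqP; rewrite -subr_eq0 -rmorphB rq // rmorphB e subrr.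
have E0D x y : q (E0 (x + y)) = q (E0 x) + q (E0 y).
  by rewrite -rmorphD; apply: eqq; rewrite rmorphD !E0P dD mulrDl.
have E0M x y : q (E0 (x * y)) = q x * q (E0 y) + q y * q (E0 x).
  rewrite -!rmorphM -rmorphD; apply: eqq; rewrite rmorphD !rmorphM !E0P dM; ring.
have E00 x : x = 0 -> q (E0 x) = 0.
  by move=> ->; apply: (addrI (q (E0 0))); rewrite -E0D !addr0.
have E0q x : q x = 0 -> q (E0 x) = 0.
  move=> qx; have [s qs0 /E00] := qker qx; rewrite E0M qx mul0r addr0 => /eqP.
  by rewrite mulf_eq0 (negPf qs0) => /eqP.
pose E z := q (E0 (preimage_of qs z)).
have EE x : E (q x) = q (E0 x).
  rewrite /E; set y := preimage_of _ _.
  have -> : y = x + (y - x) by rewrite addrC subrK.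
  by rewrite E0D (E0q (y - x)) ?addr0 // rmorphB preimage_ofK subrr.
exists N, E; split; last first.
  move=> c; rewrite EE -rmorphXn -rmorphM; apply: eqq.
  by rewrite E0P dk rmorphM rmorphXn mulrC.
split=> x y _ _; have [a <-] := qs x; have [b <-] := qs y.
  by rewrite -rmorphD !EE E0D.
by rewrite -rmorphM !EE E0M.
Qed.

End DescendDerivation.

(** * Schemes *)

Definition spec_chart (X : ringedSpace) (U : opens X) (phi : X -> set (sect U)) :=
  @is_spectrum X U (sect U) phi idfun.

(** The localization clause at [f = 1] shows that [theta] is bijective, so [sect U] itself can serve
    as the coordinate ring. *)
Lemma affine_chart (X : ringedSpace) (U : opens X) : affine U -> exists phi, @spec_chart X U phi.
Proof.
move=> [A [phi [theta [[phiF phiI phiS] top loc]]]].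
have ptheta : {phi' : sect U -> A | cancel theta phi' & cancel phi' theta}.
  have [_ hs hk] : is_localization 1 theta.
    have := loc 1 U (@subset_refl _ _); rewrite (_ : (fun a => _) = theta); last first.
      by apply/funext => a; rewrite restr_id.
    apply; apply/seteqP; split=> [y Uy|y [Uy _]//]; split=> //.
    by have [_] := phiF y Uy.
  have ex b : exists a, theta a = b.
    by have [a [n e]] := hs b; exists a; rewrite -e rmorph1 expr1n mulr1.
  have inj a b : theta a = theta b -> a = b.
    move=> e; have [|n] := hk (a - b); first by rewrite rmorphB e subrr.
    by rewrite expr1n mul1r => /eqP; rewrite subr_eq0 => /eqP.
  exists (fun b => sval (cid (ex b))) => b; first by apply: inj; case: cid.
  by case: cid.
have {ptheta}[phi' thetaK phi'K] := ptheta.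
have primeE (Q : set A) : is_prime_ideal Q -> is_prime_ideal [set s | Q (phi' s)].
  have pm : monoid_morphism phi'.
    by split; [rewrite -[RHS]thetaK rmorph1 | move=> a b; rewrite -[RHS]thetaK rmorphM !phi'K].
  have pa : {morph phi' : a b / a - b} by move=> a b; rewrite -[RHS]thetaK rmorphB !phi'K.
  pose pA := GRing.isZmodMorphism.Build _ _ phi' pa.
  pose pM := GRing.isMonoidMorphism.Build _ _ phi' pm.
  pose p : {rmorphism sect U -> A} := HB.pack phi' pA pM.
  move=> [[Q0 QD QM] Q1 QP]; split; first split=> /=.
  - by rewrite (rmorph0 p : phi' 0 = 0).
  - by move=> a b Qa Qb; rewrite (rmorphD p a b : phi' _ = phi' _ + phi' _); apply: QD.
  - by move=> a b Qb; rewrite (rmorphM p a b : phi' _ = phi' _ * phi' _); apply: QM.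
  - by rewrite /= (rmorph1 p : phi' 1 = 1).
  - by move=> a b; rewrite /= (rmorphM p a b : phi' _ = phi' _ * phi' _); apply: QP.
exists (fun y => [set s | phi y (phi' s)]); split.
- split.
  + by move=> y /phiF; apply: primeE.
  + move=> y z Uy Uz e; apply: phiI => //; apply/seteqP.
    by split=> a; have := congr1 (fun Q : set _ => Q (theta a)) e; rewrite /= thetaK => ->.
  + move=> Q pQ; have [|y Uy e] := phiS [set a | Q (theta a)].
      have [[Q0 QD QM] Q1 QP] := pQ; split; first split=> /=.
      * by rewrite rmorph0.
      * by move=> a b Qa Qb; rewrite rmorphD; apply: QD.
      * by move=> a b Qb; rewrite rmorphM; apply: QM.
      * by rewrite /= rmorph1.
      * by move=> a b; rewrite /= rmorphM; apply: QP.
    by exists y => //; rewrite e; apply/seteqP; split=> s /=; rewrite phi'K.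
- move=> W /top->; split=> -[E ->].
    exists [set s | E (phi' s)]; apply/seteqP; split=> y [Uy h]; split=> // h'; apply: h => a Ea.
      by rewrite -[a]thetaK; apply: h'; rewrite /= thetaK.
    exact: h'.
  exists [set a | E (theta a)]; apply/seteqP; split=> y [Uy h]; split=> // h'; apply: h => a Ea.
    by apply: h'; rewrite /= phi'K.
  by rewrite -[a]thetaK; apply: h'.
move=> f D h eD; have := loc (phi' f) D h eD.
move=> [inv frac ker]; rewrite phi'K in inv; split=> // [b|a].
  by have [a [n e]] := frac b; exists (theta a), n; rewrite -e phi'K.
move=> /=; rewrite -[a]phi'K => /ker[n /(congr1 theta)]; rewrite rmorphM rmorphXn rmorph0 !phi'K.
by move=> e; exists n.
Qed.

Section Chart.
Variables (X : ringedSpace) (U : opens X) (phi : X -> set (sect U)).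
Hypothesis chart : spec_chart phi.

Lemma chart_prime y : oset U y -> is_prime_ideal (phi y).
Proof. by have [[h _ _] _ _] := chart; apply: h. Qed.

Lemma chart_inj y z : oset U y -> oset U z -> phi y = phi z -> y = z.
Proof. by have [[_ h _] _ _] := chart => Uy Uz; apply: h; apply/mem_set. Qed.

Lemma chart_surj Q : is_prime_ideal Q -> exists2 y, oset U y & phi y = Q.
Proof. by have [[_ _ h] _ _] := chart; apply: h. Qed.

Lemma basic_open_open f : open [set y | oset U y /\ ~ phi y f].
Proof.
have [_ top _] := chart; apply/top; first by move=> y [].
exists [set f]; apply/seteqP; split=> y [Uy h]; split=> // h'; apply: h; first exact: h'.
by move=> g ->.
Qed.

Definition basic_open f : opens X := Opens (basic_open_open f).

Lemma basic_open_sub f : basic_open f `<=` U.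
Proof. by move=> y []. Qed.

Lemma basic_open_loc f : is_localization f (restr (@basic_open_sub f)).
Proof. by have [_ _ h] := chart; apply: (h f (basic_open f)). Qed.

Lemma basic_open_nbhd (W : opens X) y : oset U y -> oset W y ->
  exists2 f, ~ phi y f & basic_open f `<=` W.
Proof.
move=> Uy Wy; have [_ top _] := chart.
have /top : opensI W U `<=` U by move=> z [].
move=> [/(_ (oset_open _))[E eW] _].
have : oset (opensI W U) y by split.
rewrite eW => -[_] /existsNP[f /not_implyP[Ef nf]]; exists f => // z [Uz nz].
have : oset (opensI W U) z by rewrite eW; split=> // h; apply: nz; apply: h.
by case.
Qed.

Variables (x : X) (Ux : oset U x).

Lemma germ_zmod_morphism : {morph (germ Ux) : s t / s - t}.
Proof. by move=> s t; rewrite -[LHS]germD -germN. Qed.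

Lemma germ_monoid_morphism : monoid_morphism (germ Ux).
Proof. by split; [exact: germ1 | move=> s t; rewrite -germM]. Qed.

HB.instance Definition _ := GRing.isZmodMorphism.Build _ _ (germ Ux) germ_zmod_morphism.
HB.instance Definition _ := GRing.isMonoidMorphism.Build _ _ (germ Ux) germ_monoid_morphism.

Definition germ_map : {rmorphism sect U -> stalk x} := germ Ux.

Lemma stalk_frac (z : stalk x) : exists s a, ~ phi x s /\ z * germ_map s = germ_map a.
Proof.
have [W [Wx [t ->]]] := germ_surj z; have [f nf fW] := basic_open_nbhd Ux Wx.
have Dx : oset (basic_open f) x by [].
have [_ /(_ (restr fW t))[a [n e]] _] := basic_open_loc f; exists (f ^+ n), a.
split; first exact: primeX (chart_prime Ux) nf.
rewrite /germ_map /= -(germ_restr fW Wx Dx) -!(germ_restr (@basic_open_sub f) Ux Dx).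
by rewrite -e rmorphXn -germM.
Qed.

Lemma stalk_ker a : germ_map a = 0 -> exists2 s, ~ phi x s & s * a = 0.
Proof.
rewrite -(rmorph0 germ_map) => /germP[W [h [h' [Wx e]]]] /=.
have [f nf fW] := basic_open_nbhd Ux Wx; have [_ _ /(_ a)[|n en]] := basic_open_loc f.
  by rewrite -(restr_comp h fW) e !rmorph0.
by exists (f ^+ n) => //; apply: primeX (chart_prime Ux) nf.
Qed.

Lemma germ_unit s : invertible (germ_map s) <-> ~ phi x s.
Proof.
have px := chart_prime Ux; split=> [[z sz] ps|ns].
  have [t [b [nt e]]] := stalk_frac z.
  have [|u nu e'] := @stalk_ker (s * b - t).
    by rewrite rmorphB rmorphM -e mulrA sz mul1r subrr.
  apply: (primeNM px nu nt); have -> : u * t = u * b * s - u * (s * b - t) by ring.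
  by rewrite e' subr0; apply: idealM => //; apply: prime_ideal.
have Dx : oset (basic_open s) x by [].
have [[b sb] _ _] := basic_open_loc s; exists (germ Dx b).
rewrite /germ_map /= -(germ_restr (@basic_open_sub s) Ux Dx).
by have := germM Dx (restr (@basic_open_sub s) s) b; rewrite sb germ1.
Qed.

End Chart.

Section SchemePoints.
Variables (k : fieldType) (X : scheme_over k).

Lemma sect_alg_germ (U V : opens X) x (Ux : oset U x) (Vx : oset V x) c :
  germ Ux (sect_alg U c) = germ Vx (sect_alg V c).
Proof. by rewrite /sect_alg /= !(germ_restr _ (I : oset (opensT X) x)). Qed.

(** A residue at a stalk is a fraction of residues of sections. Since [L] is finite over [k], the
    inverse of a residue is a polynomial in it, so sections alone already map onto [L]. *)
Lemma chart_point (U : opens X) (phi : X -> set (sect U)) x (L : fieldExtType k) :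
    spec_chart phi -> oset U x -> is_residue_field x L ->
  exists2 ev : {rmorphism sect U -> L}, is_point (sect_alg U) ev & kernel ev = phi x.
Proof.
move=> ch Ux [ev [sev nev kev]]; pose ev0 : {rmorphism sect U -> L} := ev \o germ_map Ux.
have ker s : ev0 s = 0 <-> phi x s.
  split=> [/nev h|ps]; first by apply: contrapT => /(germ_unit ch Ux).
  by apply/nev => /(germ_unit ch Ux).
have evk c : ev0 (sect_alg U c) = c%:A by apply: kev.
exists ev0; last by apply/seteqP; split=> s /ker.
have inv s : exists t, ev0 t = (ev0 s)^-1.
  have : (ev0 s)^-1 \in <<1; ev0 s>>%VS by rewrite memvV memv_adjoin.
  move=> /Fadjoin1_polyP[q ->]; exists (\sum_(i < size q) sect_alg U q`_i * s ^+ i).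
  rewrite rmorph_sum horner_coef size_map_poly; apply: eq_bigr => i _.
  by rewrite rmorphM rmorphXn evk coef_map.
split=> // l; have [z zl] := sev l.
have [s [a [ns e]]] := stalk_frac ch Ux z; have [t et] := inv s.
exists (a * t); rewrite rmorphM et.
have -> : ev0 a = l * ev0 s by rewrite -zl /ev0 /= -rmorphM e.
by rewrite mulfK //; apply/eqP => /ker.
Qed.

Lemma point_chart (U : opens X) (phi : X -> set (sect U)) (L : fieldExtType k)
    (ev : {rmorphism sect U -> L}) :
    spec_chart phi -> is_point (sect_alg U) ev ->
  exists x, [/\ oset U x, phi x = kernel ev & is_residue_field x L].
Proof.
move=> ch [sev kev]; have pk := kernel_prime ev.
have [x Ux ex] := chart_surj ch pk; exists x; split=> //.
have px := chart_prime ch Ux.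
have evu s : ~ phi x s -> invertible (ev s).
  by rewrite ex => /eqP s0; exists (ev s)^-1; rewrite divff.
have [||ev' ev'E] := localization_lift _ _ (stalk_frac ch Ux) (@stalk_ker _ _ _ ch _ Ux) evu.
- by case: px.
- by move=> s t; apply: primeNM.
exists ev'; split.
- by move=> l; have [a <-] := sev l; exists (germ_map Ux a); apply: ev'E.
- move=> z; have [s [a [ns e]]] := stalk_frac ch Ux z.
  have evs : ev s != 0 by apply/eqP; move: ns; rewrite ex.
  have /(congr1 ev') := e; rewrite rmorphM !ev'E => e'.
  split=> [z0|nz].
    move=> [w zw]; have := congr1 ev' zw; rewrite rmorphM z0 mul0r rmorph1 => /eqP.
    by rewrite eq_sym oner_eq0.
  have pa : phi x a.
    apply: contrapT => /(germ_unit ch Ux)[w aw]; apply: nz.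
    by exists (germ_map Ux s * w); rewrite mulrA e.
  by move: pa e'; rewrite ex => -> /eqP; rewrite mulf_eq0 (negPf evs) orbF => /eqP.
- by move=> V Vx c; rewrite (sect_alg_germ Vx Ux) -kev; apply: ev'E.
Qed.

(** In a chart around another point [y] that contains [x], the prime of [x] is maximal, so some [f]
    vanishes at [x] and not at [y]. Thus the points found in one chart are closed in the whole
    scheme. *)
Lemma residue_field_closed (x : X) (L : fieldExtType k) : is_residue_field x L -> closed [set x].
Proof.
move=> rx; rewrite -openC openE => y /= yx; rewrite /interior.
have [V Vy /affine_chart[phi ch]] := affine_nbhd y.
have [Vx|nVx] := pselect (oset V x); last first.
  apply: (filterS (P := V)); first by move=> z Vz zx; apply: nVx; rewrite -zx.
  by apply: open_nbhs_nbhs; split=> //; apply: oset_open.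
have [ev pt ex] := chart_point ch Vx rx.
have [f fx fy] : exists2 f, phi x f & ~ phi y f.
  apply: contrapT => h; apply: yx; apply: (chart_inj ch) => //.
  have xy : phi x `<=` phi y.
    by move=> f fx; apply: contrapT => nf; apply: h; exists f.
  apply/seteqP; split=> //; rewrite -ex in xy *.
  exact: (kernel_maximal pt (chart_prime ch Vy) xy).
apply: (filterS (P := basic_open ch f)); first by move=> z [_ nz] zx; apply: nz; rewrite zx.
by apply: open_nbhs_nbhs; split=> //; apply: oset_open.
Qed.

End SchemePoints.

(** * From regular stalks to regularity in a chart *)

Section RegularStalk.
Variables (k : fieldType) (X : scheme_over k) (U : opens X) (phi : X -> set (sect U)).
Hypothesis ch : spec_chart phi.
Variables (x : X) (Ux : oset U x).
Local Notation m := (phi x).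
Local Notation p0 := (kernel (germ_map Ux)).

Lemma stalk_clear (z : stalk x) : exists a s t,
  [/\ ~ m s, germ_map Ux s * t = 1, z = germ_map Ux a * t & z * germ_map Ux s = germ_map Ux a].
Proof.
have [s [a [ns e]]] := stalk_frac ch Ux z; have [t st] := (germ_unit ch Ux s).2 ns.
by exists a, s, t; split=> //; rewrite -e -mulrA st mulr1.
Qed.

Lemma ideal_germM (I : set (stalk x)) s a : is_ideal I -> ~ m s ->
  I (germ_map Ux (s * a)) -> I (germ_map Ux a).
Proof.
move=> idI /(germ_unit ch Ux)[t st]; rewrite rmorphM => /(idealM idI t).
by rewrite mulrA [t * _]mulrC st mul1r.
Qed.

(** The contraction of an ideal of the stalk; as the germ map need not be injective, its kernel is
    added. *)
Lemma gens_germ s a :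
  gens [seq germ_map Ux i | i <- s] (germ_map Ux a) <-> sat m (adds p0 s) a.
Proof.
have pm := chart_prime ch Ux; have idg s := gens_ideal [seq germ_map Ux i | i <- s].
elim: s a => [|g s IH] a.
  split=> [e|[s [ns]]]; last exact: (ideal_germM (idg [::]) ns).
  by apply: sub_sat.
split.
  rewrite map_cons gens_cons => -[z]; have [b [t [t' [nt tt' zE e]]]] := stalk_clear z.
  move=> /(idealM (idg s) (germ_map Ux t)).
  rewrite mulrBr mulrA [_ * z]mulrC e -!rmorphM -rmorphB => /IH[u [nu h]].
  exists (u * t); split; first exact: primeNM.
  by apply/adds_cons; exists (u * b); move: h; rewrite mulrBr !mulrA.
move=> [u [nu /adds_cons[r h]]]; apply: (ideal_germM (idg _) nu).
rewrite map_cons gens_cons; exists (germ_map Ux r); rewrite -rmorphM -rmorphB.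
by apply/IH; apply: sub_sat.
Qed.

Variables (D : comPzRingType) (q : {rmorphism sect U -> D}) (m' : set D).
Hypotheses (qs : forall z, exists a, q a = z) (qP : forall a, q a = 0 <-> p0 a).
Hypothesis m'E : forall a, m' (q a) <-> m a.
Hypotheses (kinf : infinite_ring k) (reg : regular_local (stalk x)).

Lemma local_generators_stalk s : (forall g, g \in s -> m g) ->
  m' `<=` sat m' (gens [seq q i | i <- s]) <->
  @nonunits (stalk x) = gens [seq germ_map Ux i | i <- s].
Proof.
have [_ idn _] := reg; move=> sm; split=> [h|h z].
  apply/seteqP; split=> [z nz|].
    have [a [t [t' [nt tt' zE e]]]] := stalk_clear z; rewrite zE.
    apply: idealMr; first exact: gens_ideal.
    apply/gens_germ/(sat_image _ _ qs qP m'E)/h/m'E.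
    apply: contrapT => /(germ_unit ch Ux) [w aw]; apply: nz.
    by exists (germ_map Ux t * w); rewrite mulrA e.
  by apply: gens_min => // _ /mapP[g /sm gm ->]; move/(germ_unit ch Ux).
have [a <-] := qs z => /m'E ma; apply/(sat_image _ _ qs qP m'E)/gens_germ.
by rewrite -h => /(germ_unit ch Ux).
Qed.

(** Generators of the maximal ideal of the stalk become germs of sections after multiplication by
    units. Conversely, any [d] local generators in [D] generate that ideal, so [regular_sequence]
    applies to each such system. *)
Lemma regular_stalk : exists d, regular_at m' d.
Proof.
have [noethR locR [d [[Ch cCh] _] [r er]]] := reg; exists d.
have chain e : e = d -> @has_chain_above (stalk x) e [set 0].
  move=> ->; exists Ch => // _ ->.
  by have [C1 _] := cCh; apply: ideal0; apply: prime_ideal; apply: C1.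
split.
  have ex i := stalk_clear (r i); pose a i := sval (cid (ex i)).
  have aP i : exists s t, [/\ ~ m s, germ_map Ux s * t = 1, r i = germ_map Ux (a i) * t
      & r i * germ_map Ux s = germ_map Ux (a i)].
    by rewrite /a; case: cid.
  have am i : m (a i).
    apply: contrapT => /(germ_unit ch Ux)[w aw]; have [s [t [_ _ _ e]]] := aP i.
    have : @nonunits (stalk x) (r i).
      by rewrite er; exists (fun j => (j == i)%:R); rewrite (bigD1 i) //= eqxx mul1r big1 ?addr0 // => j /negPf->; rewrite mul0r.
    by case; exists (germ_map Ux s * w); rewrite mulrA e.
  exists [seq q (a i) | i <- enum 'I_d]; first by rewrite size_map size_enum_ord.
  split; first by move=> _ /mapP[i _ ->]; apply/m'E.
  rewrite (map_comp q a); apply/local_generators_stalk; first by move=> _ /mapP[i _ ->].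
  apply/seteqP; split.
    rewrite er ideal_genE; apply: gens_min; first exact: gens_ideal.
    move=> _ /mapP[i _ ->]; have [s [t [_ _ -> _]]] := aP i.
    apply: idealMr; first exact: gens_ideal.
    by apply: adds_gen ideal_set0 _; rewrite !map_f // mem_enum.
  by apply: gens_min => // _ /mapP[_ /mapP[i _ ->] ->]; move/(germ_unit ch Ux).
move=> s sd [sm hs]; pose s' := map (preimage_of qs) s.
have sE : s = map q s' by rewrite -map_comp map_id_in // => y _ /=; apply: preimage_ofK.
have s'm g : g \in s' -> m g by move=> gs; apply/m'E; apply: sm; rewrite sE map_f.
rewrite sE in hs; have em := (local_generators_stalk s'm).1 hs.
pose iotaR : {rmorphism k -> stalk x} := germ_map Ux \o sect_alg U.
have [|h1 h2] := regular_sequence iotaR kinf noethR locR em.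
  by apply: chain; rewrite !size_map.
have satE t a : sat m' (gens [seq q i | i <- t]) (q a) <->
    gens [seq germ_map Ux i | i <- t] (germ_map Ux a).
  by rewrite gens_germ; apply: sat_image.
split.
  move=> s1 s2 e; have -> : s1 = map q (take (size s1) s').
    by rewrite map_take -sE e take_size_cat.
  set t1 := take _ _; set t2 := drop (size s1) s'.
  have {h1} [|[h10 h1D h1M] h11 h1P] := h1 (map (germ_map Ux) t1) (map (germ_map Ux) t2).
    by rewrite -map_cat cat_take_drop.
  apply: (prime_image qs).
  have -> : [set y | sat m' (gens [seq q i | i <- t1]) (q y)] =
            [set y | gens [seq germ_map Ux i | i <- t1] (germ_map Ux y)].
    by apply/seteqP; split=> y /satE.
  split; first split; rewrite /=.
  - by rewrite rmorph0.
  - by move=> y z; rewrite rmorphD; apply: h1D.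
  - by move=> y z; rewrite rmorphM; apply: h1M.
  - by rewrite rmorph1.
  - by move=> y z; rewrite rmorphM; apply: h1P.
move=> s1 z s2 e; pose n := size s1.
have lt : (n < size s')%N by rewrite size_map e size_cat /= -addSnnS leq_addr.
have -> : s1 = map q (take n s') by rewrite map_take -sE e take_size_cat.
have -> : z = q (nth 0 s' n) by rewrite -(nth_map 0 0) // -sE e nth_cat ltnn subnn.
move=> /satE; apply: (h2 _ _ (map (germ_map Ux) (drop n.+1 s'))).
by rewrite -map_cons -map_cat -drop_nth // cat_take_drop.
Qed.

End RegularStalk.

(** * Lifting derivations from the smooth locus *)

Section GenericSmoothness.
Variables (k : fieldType) (X : scheme_over k).

Lemma restr_sect_alg (U V : opens X) (h : V `<=` U) c : restr h (sect_alg U c) = sect_alg V c.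
Proof. by rewrite /sect_alg /=; apply: restr_comp. Qed.

Lemma localized_map (V : opens X) (psi : X -> set (sect V)) (ch : spec_chart psi) f (C : comPzRingType)
    (g : {rmorphism sect V -> C}) : invertible (g f) ->
  exists g' : {rmorphism sect (basic_open ch f) -> C},
    forall a, g' (restr (@basic_open_sub _ _ _ ch f) a) = g a.
Proof.
move=> [z gz]; have [_ frac ker] := basic_open_loc ch f.
apply: (@localization_lift _ _ _ _ [set s | exists n, s = f ^+ n]).
- by exists 0%N.
- by move=> _ _ [i ->] [j ->]; exists (i + j)%N; rewrite exprD.
- by move=> b; have [a [n e]] := frac b; exists (f ^+ n), a; split; [exists n | rewrite rmorphXn].
- by move=> a /ker[n e]; exists (f ^+ n) => //; exists n.
- by move=> _ [n ->]; exists (z ^+ n); rewrite rmorphXn -exprMn gz expr1n.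
Qed.

(* Formal smoothness lifts [c |-> c + D(c) eps] to the dual numbers over [sect W]. *)
Lemma smooth_derivation (V W : opens X) (psi : X -> set (sect V)) (ch : spec_chart psi) f
    (h : W `<=` basic_open ch f) (D : k -> k) :
    formally_smooth (sect_alg V) -> deriv_on idfun setT D ->
  exists d : sect (basic_open ch f) -> sect W,
    [/\ forall x y, d (x + y) = d x + d y,
        forall x y, d (x * y) = restr h x * d y + restr h y * d x &
        forall c, d (sect_alg _ c) = sect_alg W (D c)].
Proof.
move=> smV [DD DM]; pose hV := subset_trans h (@basic_open_sub _ _ _ ch f).
have [||gam gamE] := @dual_graph _ _ (sect_alg W) (sect_alg W \o D).
- by move=> x y; rewrite [LHS](congr1 (sect_alg W) (DD x y I I)) rmorphD.
- by move=> x y; rewrite [LHS](congr1 (sect_alg W) (DM x y I I)) rmorphD !rmorphM.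
have [|||g [gk gf]] := smV _ _ gam (@dual_fst (sect W)) (restr hV).
- by move=> b; exists (b, 0).
- move=> c c'; rewrite /dual_fst => c0 c'0.
  by apply: (congr2 pair); rewrite /= c0 c'0 ?mul0r ?addr0.
- by move=> c; rewrite restr_sect_alg gamE.
have [|g' g'E] := @localized_map V psi ch f _ g.
  apply: dual_unit; rewrite gf -(restr_comp (@basic_open_sub _ _ _ ch f) h).
  have [[z e] _ _] := basic_open_loc ch f; exists (restr h z).
  by rewrite -rmorphM e rmorph1.
have g'1 z : (g' z).1 = restr h z.
  have [[w fw] frac _] := basic_open_loc ch f; have [a [n e]] := frac z.
  have e1 : (g' z).1 * restr hV f ^+ n = restr hV a.
    have := congr1 (@dual_fst (sect W)) (congr1 g' e).
    by rewrite (rmorphM g') (rmorphXn g') !g'E rmorphM rmorphXn !gf.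
  have e2 : restr h z * restr hV f ^+ n = restr hV a.
    by rewrite -!(restr_comp (@basic_open_sub _ _ _ ch f) h) -e rmorphM rmorphXn.
  have e3 : restr hV f ^+ n * restr h w ^+ n = 1.
    by rewrite -exprMn -(restr_comp (@basic_open_sub _ _ _ ch f) h) -rmorphM fw rmorph1 expr1n.
  by rewrite -[LHS]mulr1 -e3 mulrA e1 -e2 -mulrA e3 mulr1.
exists (fun z => (g' z).2); split.
- by move=> y z; rewrite rmorphD.
- move=> y z; rewrite -!g'1.
  by rewrite (rmorphM g').
- by move=> c; rewrite -(restr_sect_alg (@basic_open_sub _ _ _ ch f)) g'E gk gamE.
Qed.

Hypothesis Xsmooth : generically_smooth X.
Variables (U : opens X) (phi : X -> set (sect U)).
Hypotheses (ch : spec_chart phi) (fg : finitely_generated_algebra (sect_alg U)).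
Variables (x : X) (Ux : oset U x).
Variables (C : idomainType) (q : {rmorphism sect U -> C}).
Hypotheses (qs : forall z, exists a, q a = z) (qP : forall a, q a = 0 <-> germ_map Ux a = 0).

(** The kernel is finitely generated, so one [s] outside the prime of [x] kills it; on the basic
    open set of [s] only the component through [x] remains. *)
Lemma kernel_germ_killed : exists2 s, ~ phi x s & forall a, germ_map Ux a = 0 -> s * a = 0.
Proof.
have /noetherianP /(_ _ (kernel_ideal (germ_map Ux)))[l el] := fg_noetherian_pz fg.
have [s ns hs] : exists2 s, ~ phi x s & forall g, g \in l -> s * g = 0.
  have : forall g, g \in l -> germ_map Ux g = 0.
    move=> g gl; suff : kernel (germ_map Ux) g by [].
    by rewrite el; apply: adds_gen ideal_set0 gl.
  elim: l {el} => [|g l IH] hl; first by exists 1 => //; case: (chart_prime ch Ux).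
  have [|s ns hs] := IH; first by move=> b bl; apply: hl; rewrite inE bl orbT.
  have [|t nt ht] := stalk_ker ch (Ux := Ux) (a := g); first by apply: hl; rewrite mem_head.
  exists (s * t); first exact: (primeNM (chart_prime ch Ux)).
  move=> b; rewrite inE => /predU1P[->|/hs e]; first by rewrite -mulrA ht mulr0.
  by rewrite mulrAC e mul0r.
exists s => // a; have : gens l `<=` [set a | s * a = 0].
  apply: gens_min => //; split; rewrite /=.
  - by rewrite mulr0.
  - by move=> b c sb sc; rewrite mulrDr sb sc addr0.
  - by move=> b c sc; rewrite mulrCA sc mulr0.
by rewrite -el; apply.
Qed.

(** Density puts a smooth point in the basic open set of [s], that is, on the component through [x].
    A derivation is lifted near that point and brought down to [C] by clearing denominators. *)
Lemma component_derivations_lift (iota : {rmorphism k -> C}) : (forall c, iota c = q (sect_alg U c)) ->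
  exists h, derivations_lift iota h.
Proof.
move=> iE; have [s ns hs] := kernel_germ_killed; have px := chart_prime ch Ux.
have [Us dUs sUs] := Xsmooth.
have [|y [[Uy nsy] Usy]] := dUs _ _ (basic_open_open ch s); first by exists x.
have py := chart_prime ch Uy.
have p0y a : q a = 0 -> phi y a.
  move=> /qP /hs e; apply: (primeM py) nsy; rewrite e; apply: ideal0; exact: prime_ideal.
have [V [Vy _ /affine_chart[psi chV] [_ smV]]] := sUs y Usy.
(* Smoothness acts on the chart [V] and the lift is wanted on [U]; hence a basic open set of [U]
   inside a basic open set of [V] that lies in [U]. *)
have [f nf fU] := basic_open_nbhd chV Vy Uy.
have [h nh hW] := basic_open_nbhd ch Uy (conj Vy nf : oset (basic_open chV f) y).
have q0 : q h != 0 by apply/eqP => /p0y.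
exists (q h); split=> // D dD.
have [d [dD' dM dk]] := smooth_derivation hW smV dD.
have sE a : restr hW (restr fU a) = restr (@basic_open_sub _ _ _ ch h) a by apply: restr_comp.
have [||||N [E [dE Ek]]] := descend_derivation fg (basic_open_loc ch h) qs q0 _ (D := D)
   (d := d \o restr fU).
- move=> a /qP /hs e; exists s => //; apply/eqP => /qP /hs e'.
  by apply: (primeNM px ns ns); rewrite e'; apply: ideal0; apply: prime_ideal.
- by move=> a b /=; rewrite rmorphD dD'.
- by move=> a b /=; rewrite rmorphM dM !sE.
- by move=> c /=; rewrite !restr_sect_alg dk.
by exists N, E; split=> // c; rewrite !iE.
Qed.

End GenericSmoothness.

(** On a finite field the injective Frobenius map would be onto. *)
Lemma imperfect_infinite (k : fieldType) p (lam : k) : p \in [pchar k] -> ~ pth_powers p lam ->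
  infinite_ring k.
Proof.
move=> pk nlam s; apply: contrapT => hs; apply: nlam.
have sT c : c \in undup s by rewrite mem_undup; apply/negPn/negP => nc; apply: hs; exists c.
have inj : injective (fun c : k => c ^+ p) by apply: (fmorph_inj (pFrobenius_aut pk)).
have [|||_ e] := @uniq_min_size _ [seq c ^+ p | c <- undup s] (undup s).
- by rewrite map_inj_uniq // undup_uniq.
- by move=> c _; apply: sT.
- by rewrite size_map.
by have := sT lam; rewrite -e => /mapP[c _ ->]; exists c.
Qed.

(** The stalk, being regular, is a domain, so the kernel of the germ map is prime; its quotient [C]
    is the coordinate ring of the component through [x] in a chart, and separable points of [C] are
    closed points of [X]. *)
Lemma closed_point_index (k : fieldType) (X : scheme_over k) p (N : nat) (x : X) (L : fieldExtType k) :
    p \in [pchar k] -> infinite_ring k -> finite_type X -> regular_scheme X -> generically_smooth X ->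
    is_residue_field x L -> (forall n, separable_point_degrees X n -> (N %| n)%N) ->
  (N %| \dim {:L})%N.
Proof.
move=> pk kinf [n [U [cov hU]]] reg sm rx hN.
have [i Ux] := cov x; have [/affine_chart[phi ch] fg] := hU i.
have [ev pt ek] := chart_point ch Ux rx; have [sev kev] := pt.
pose iotaR : {rmorphism k -> stalk x} := germ_map Ux \o sect_alg (U i).
have [noethR locR [d [[Ch cCh] _] [r er]]] := reg x.
have pk0 : is_prime_ideal (kernel (germ_map Ux)).
  have hch : @has_chain_above (stalk x) (size [seq r i | i <- enum 'I_d]) [set 0].
    rewrite size_map size_enum_ord; exists Ch => // _ ->.
    by have [C1 _] := cCh; apply: ideal0; apply: prime_ideal; apply: C1.
  have em : @nonunits (stalk x) = gens [seq r i | i <- enum 'I_d] by rewrite er ideal_genE.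
  have [/(_ [::] _ erefl)[[P0 PD PM] P1 PP] _] := regular_sequence iotaR kinf noethR locR em hch.
  split; first split; rewrite /kernel /=.
  - by rewrite rmorph0.
  - by move=> a b; rewrite rmorphD; apply: PD.
  - by move=> a b; rewrite rmorphM; apply: PM.
  - by rewrite rmorph1.
  - by move=> a b; rewrite rmorphM; apply: PP.
have [C [q [qs qP]]] := quotient_domain pk0.
have [|ev' ev'E] := factor_rmorphism qs (f := ev).
  move=> a /qP a0; suff : kernel ev a by [].
  rewrite ek; apply: contrapT => /(germ_unit ch Ux)[z az].
  have [[_ _ _] P1 _] := pk0; apply: P1; rewrite /kernel /= rmorph1 -az.
  by rewrite (a0 : germ_map Ux a = 0) mul0r.
pose iota : {rmorphism k -> C} := q \o sect_alg (U i).
have m'E a : kernel ev' (q a) <-> phi x a by rewrite -ek /kernel /= ev'E.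
have [h lift] := component_derivations_lift sm ch fg qs qP (iota := iota) (fun=> erefl).
have [e regC] := regular_stalk ch qs qP m'E kinf (reg x).
apply: (point_index pk kinf _ _ regC lift).
- exact: (fg_image qs _ fg).
- split=> [z|c]; last exact: etrans (ev'E _) (kev c).
  by have [a <-] := sev z; exists (q a).
move=> L' ev1 [sev1 kev1] sep.
pose ev2 : {rmorphism sect (U i) -> L'} := ev1 \o q.
have [|x' [_ _ rx']] := point_chart (ev := ev2) ch.
  split=> [z|c]; last exact: kev1.
  by have [y <-] := sev1 z; have [a <-] := qs y; exists a.
by apply: hN; exists x', L'; split=> //; apply: residue_field_closed rx'.
Qed.

(** In characteristic zero every algebraic element is separable; in characteristic [p], roots of the
    scalars give Mac Lane's criterion. *)
Lemma perfect_separable (k : fieldType) (L : fieldExtType k) :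
  (forall p, p \in [pchar k] -> forall c : k, pth_powers p c) -> separable 1 {:L}.
Proof.
move=> perf; have [[p pk]|n0] := pselect (exists p, p \in [pchar k]).
  by apply: (frobenius_free_separable pk); apply: (perfect_frobenius_free pk); apply: perf.
apply/separableP => y _; apply: pcharf0_separable => p.
by rewrite pchar_lalg; apply/negP => h; apply: n0; exists p.
Qed.

Theorem theorem9p2 (k : fieldType) (X : scheme_over k)
  (Xne : [set: X] !=set0) (Xft : finite_type X)
  (Xreg : regular_scheme X) (Xsmooth : generically_smooth X) :
  scheme_index X = separable_index X.
Proof.
rewrite /scheme_index /separable_index.
have [dvd_all max_all] := gcd_setP (closed_point_degrees X).
have [dvd_sep max_sep] := gcd_setP (separable_point_degrees X).
apply/eqP; rewrite eqn_dvd; apply/andP; split.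
  by apply: max_sep => n [x [L [cx rx _ dL]]]; apply: dvd_all; exists x, L.
apply: max_all => n [x [L [cx rx dL]]].
have [[p [pk [lam nlam]]]|perf] :=
    pselect (exists p, p \in [pchar k] /\ exists lam : k, ~ pth_powers p lam).
  rewrite -dL; apply: (closed_point_index pk (imperfect_infinite pk nlam) Xft Xreg Xsmooth rx).
  exact: dvd_sep.
apply: dvd_sep; exists x, L; split=> //; apply: perfect_separable => p pk c.
by apply: contrapT => nc; apply: perf; exists p; split=> //; exists c.
Qed.
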